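(* Let $\mathcal{M}$ be a loopless oriented matroid of rank $r\ge0$ on $E$, $\chi$ a chirotope of $\mathcal{M}$, $P$ a tope of $\mathcal{M}$, and $R$ a unital commutative ring. Define $\Omega(P,\chi):=\sum_{B\in\Delta}({}_P\chi)(B)\,e_B\in\mathrm{OS}^r_R(\mathrm{M})$ for a triangulation $\Delta$ of ${}_P\mathcal{M}$. Then $\Omega(P,\chi)$ does not depend on the choice of triangulation of ${}_P\mathcal{M}$, and it satisfies the characterizing recursion: (i) if $r=0$, then $\Omega(P,\chi)=\chi(\emptyset)\cdot1\in\mathrm{OS}^0_R(\mathrm{M})$; (ii) if $r>0$, then for every atom $a$ of $\mathrm{M}$, $\operatorname{Res}_a\Omega(P,\chi)=\Omega(P/a,\chi/^Pa)$ if $a\in\partial P$, and $\operatorname{Res}_a\Omega(P,\chi)=0$ if $a\notin\partial P$.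
   Context: Oriented matroid conventions are those of Björner–Las Vergnas–Sturmfels–White–Ziegler; $\mathrm{M}$ is the underlying matroid, atoms are rank one flats, $X^-=\{i:X(i)=-\}$. Orlik–Solomon algebra: $\mathrm{OS}^\bullet_R(\mathrm{M})=\bigwedge^\bullet R^{\mathfrak{A}}/\langle \partial e_S : S\subseteq\mathfrak{A}\text{ dependent}\rangle$ ($\mathfrak{A}$ the atoms, $S$ dependent if its rank is less than $|S|$), where $e_S=e_{s_1}\wedge\cdots\wedge e_{s_k}$ and $\partial e_S=\sum_{i=0}^{k-1}(-1)^i e_{S\setminus s_{k-i}}$; for elements of $E$, $e_{(i_1,\dots,i_k)}$ uses the atoms containing the $i_j$, and each basis $B$ is ordered arbitrarily (the product ${}_P\chi(B)e_B$ is independent of ordering). $\operatorname{Res}_a:\mathrm{OS}^\bullet_R(\mathrm{M})\to\mathrm{OS}^{\bullet-1}_R(\mathrm{M}/a)$ sends $e_{(i_1,\dots,i_{k-1},a)}\mapsto e_{(i_1,\dots,i_{k-1})}$ (read in $\mathrm{M}/a$) and $e_I\mapsto0$ if $a\notin I$. Triangulation (Santos): a nonempty collection $\Delta$ of bases such that for any $B,B'\in\Delta$ no signed circuit $C$ has $C^+\subseteq B$, $C^-\subseteq B'$, and for every $B\in\Delta$, $b\in B$, either $B\setminus b$ lies in the zero set of a positive cocircuit or $B\setminus b\subset B'$ for some other $B'\in\Delta$. For a tope $P$, ${}_P\mathcal{M}$ is the reorientation with chirotope ${}_P\chi(B)=(-1)^{|B\cap P^-|}\chi(B)$. An atom $a$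 is a facet of $P$ ($a\in\partial P$) if the sign vector $P_a$ with $P_a(i)=P(i)$ for $i\notin a$, $P_a(i)=0$ for $i\in a$ is a covector; then $P/a:=P|_{E\setminus a}$ is a tope of $\mathcal{M}/a$ and $(\chi/^Pa)(I):=P(i)\chi(I,i)$ (any $i\in a$) is a chirotope of $\mathcal{M}/a$. *)

(* Defs.v *)
From HB Require Import structures.
From mathcomp Require Import all_boot perm all_algebra.
From mathcomp Require Import boolp.

(** Oriented matroids follow Björner, Las Vergnas, Sturmfels, White and Ziegler,
    "Oriented Matroids" (BLSWZ). *)

Set Implicit Arguments.
Unset Strict Implicit.
Unset Printing Implicit Defensive.

Import GRing.Theory.
Local Open Scope ring_scope.
Local Open Scope quotient_scope.

Inductive sign := Neg | Zero | Pos.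

Definition sign_code (s : sign) : option bool :=
  match s with Neg => Some false | Zero => None | Pos => Some true end.
Definition sign_decode (o : option bool) : sign :=
  match o with Some false => Neg | None => Zero | Some true => Pos end.
Lemma sign_codeK : cancel sign_code sign_decode. Proof. by case. Qed.
HB.instance Definition _ := Finite.copy sign (can_type sign_codeK).

Definition sopp (s : sign) : sign :=
  match s with Neg => Pos | Zero => Zero | Pos => Neg end.

Definition smul (s t : sign) : sign :=
  match s with Neg => sopp t | Zero => Zero | Pos => t end.

Definition sact (V : zmodType) (s : sign) (x : V) : V :=
  match s with Neg => - x | Zero => 0 | Pos => x end.

(** A sign vector on a ground set [E : {set T}] is a function on [T] which is
    zero outside [E]. *)
Notation signvec T := {ffun T -> sign}.

Section SignVectors.
Variable T : finType.
Implicit Types X Y : signvec T.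

Definition svzero : signvec T := [ffun=> Zero].
Definition svopp X : signvec T := [ffun i => sopp (X i)].
Definition svcomp X Y : signvec T :=
  [ffun i => if X i == Zero then Y i else X i].
Definition svrestr X (A : {set T}) : signvec T :=
  [ffun i => if i \in A then X i else Zero].

Definition supp X : {set T} := [set i | X i != Zero].
Definition pospart X : {set T} := [set i | X i == Pos].
Definition negpart X : {set T} := [set i | X i == Neg].

(** [X] is obtained from [Y] by replacing some entries by 0. *)
Definition svle X Y : bool := [forall i in supp X, Y i == X i].

Definition orthogonal X Y : bool :=
  [disjoint supp X & supp Y] ||
  [exists e in supp X :&: supp Y, exists f in supp X :&: supp Y,
     smul (X e) (Y e) == sopp (smul (X f) (Y f))].

End SignVectors.

(** The data is a ground set and a set of signed circuits; the axioms are the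
    predicate [oriented_matroid]. *)
Record om (T : finType) := OM {
  ground : {set T};
  circuits : {set signvec T}
}.

Section OrientedMatroid.
Variables (T : finType) (M : om T).
Local Notation E := (ground M).
Implicit Types (A B I S D : {set T}) (X Y P : signvec T).

(** The axioms (C0)-(C3) of BLSWZ, Definition 3.2.1. *)
Definition oriented_matroid : Prop :=
  [/\ forall X, X \in circuits M -> supp X \subset E,
      svzero T \notin circuits M,
      forall X, X \in circuits M -> svopp X \in circuits M,
      forall X Y, X \in circuits M -> Y \in circuits M ->
        supp X \subset supp Y -> X = Y \/ X = svopp Y
    & forall X Y e, X \in circuits M -> Y \in circuits M -> X <> svopp Y ->
        e \in pospart X :&: negpart Y ->
        exists2 Z, Z \in circuits M
          & pospart Z \subset (pospart X :|: pospart Y) :\ e /\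
            negpart Z \subset (negpart X :|: negpart Y) :\ e].

Definition indep I : bool :=
  (I \subset E) && [forall X in circuits M, ~~ (supp X \subset I)].

Definition rank S : nat := (\max_(I : {set T} | indep I && (I \subset S)) #|I|)%N.

Definition basis B : bool := indep B && (#|B| == rank E).

Definition flat A : bool :=
  (A \subset E) && [forall x in E :\: A, (rank A < rank (x |: A))%N].

Definition is_atom A : bool := flat A && (rank A == 1%N).

Definition atom : finType := {A : {set T} | is_atom A}.

Definition loopless : Prop := forall i, i \in E -> indep [set i].

(** The cocircuits of the underlying matroid are the minimal sets meeting every
    basis; their signatures are determined by orthogonality to the signed
    circuits (BLSWZ, Theorem 3.4.3). *)
Definition cocircuit Y : bool :=
  minset (fun D => (D \subset E) && [forall B, basis B ==> (B :&: D != set0)])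
         (supp Y)
  && [forall X in circuits M, orthogonal X Y].

Definition covector X : Prop :=
  exists s : seq (signvec T), all cocircuit s /\ X = foldr (@svcomp T) (svzero T) s.

Definition tope P : Prop :=
  covector P /\ forall X, covector X -> svle P X -> X = P.

Definition positive_cocircuit Y : bool := cocircuit Y && (negpart Y == set0).

(** An atom [a] is a facet of [P]: the vector [P_a] is [svrestr P (E :\: a)]. *)
Definition facet P (a : {set T}) : Prop := covector (svrestr P (E :\: a)).

Definition ordered_basis (s : seq T) : bool := uniq s && basis [set i in s].

(** [chi] is only constrained on sequences of length the rank with entries in
    [E], and only its values there are ever used.  The last clause is the pivoting
    property (PV) of BLSWZ, Definition 3.5.1. *)
Definition chirotope (chi : seq T -> sign) : Prop :=
  [/\ forall s, size s = rank E -> {subset s <= E} ->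
        (chi s != Zero) = ordered_basis s,
      forall (s : (rank E).-tuple T) (p : 'S_(rank E)), {subset s <= E} ->
        chi [tuple tnth s (p i) | i < rank E]
          = (if odd_perm p then sopp (chi s) else chi s)
    & forall e f s C, e != f ->
        ordered_basis (e :: s) -> ordered_basis (f :: s) ->
        C \in circuits M -> supp C \subset [set i in [:: e, f & s]] ->
        chi (f :: s) = sopp (smul (smul (C e) (C f)) (chi (e :: s)))].

(** Triangulations in the sense of Santos. *)
Definition triangulation (Delta : {set {set T}}) : Prop :=
  [/\ Delta != set0,
      forall B, B \in Delta -> basis B,
      forall B B', B \in Delta -> B' \in Delta ->
        ~ exists C, [/\ C \in circuits M, pospart C \subset B
                      & negpart C \subset B']
    & forall B b, B \in Delta -> b \in B ->
        (exists2 Y, positive_cocircuit Y & B :\ b \subset E :\: supp Y) \/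
        (exists B', [/\ B' \in Delta, B' != B & B :\ b \subset B'])].

End OrientedMatroid.

Section Operations.
Variable T : finType.
Implicit Types (M : om T) (P C : signvec T) (a : {set T}) (chi : seq T -> sign).

Definition reorient_vec P C : signvec T :=
  [ffun i => if i \in negpart P then sopp (C i) else C i].

Definition reorient P M : om T :=
  OM (ground M) [set reorient_vec P C | C in circuits M].

Definition reorient_chi P chi (s : seq T) : sign :=
  if odd #|[set i in s] :&: negpart P| then sopp (chi s) else chi s.

Definition contract_vecs M a : {set signvec T} :=
  [set svrestr C (ground M :\: a) | C in circuits M] :\ svzero T.

Definition contract M a : om T :=
  OM (ground M :\: a)
     [set C in contract_vecs M a
        | [forall D in contract_vecs M a, ~~ (supp D \proper supp C)]].

(** The chirotope of the contraction by the atom containing [i]. *)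
Definition contract_chi P chi (i : T) (s : seq T) : sign :=
  smul (P i) (chi (rcons s i)).

End Operations.

(** The exterior algebra of the free module on the basis [X], on the basis of
    the products e_S of the elements of [S] in increasing order; [X] is ordered by
    [enum_rank]. *)
Definition ext (R : comPzRingType) (X : finType) : lmodType R :=
  {ffun {set X} -> R^o}.

Section Exterior.
Variables (R : comPzRingType) (X : finType).
Implicit Types (S U V : {set X}) (u v : ext R X).

Definition xlt (x y : X) : bool := (enum_rank x < enum_rank y)%N.

Definition mono S : ext R X := [ffun U => (U == S)%:R].

Definition ext1 : ext R X := mono set0.

Definition inversions U V : nat :=
  #|[set p : X * X | [&& p.1 \in U, p.2 \in V & xlt p.2 p.1]]|.

Definition wedge u v : ext R X :=
  [ffun S : {set X} =>
     \sum_(U : {set X} | U \subset S)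
        (-1) ^+ inversions U (S :\: U) * (u U : R) * (v (S :\: U) : R)].

(** The sign of moving [x] to the last position in e_S.  For S = (s_1, ..., s_k) it is
    (-1)^i at s_(k-i), which is also the sign of e_(S \ s_(k-i)) in the boundary. *)
Definition sgn_last (x : X) S : R := (-1) ^+ #|[set y in S | xlt x y]|.

Definition bdry S : ext R X := \sum_(x in S) sgn_last x S *: mono (S :\ x).

End Exterior.

Section OrlikSolomon.
Variables (R : comPzRingType) (T : finType).

Section Def.
Variable M : om T.
Local Notation Lam := (ext R (atom M)).

Definition dependent_atoms (S : {set atom M}) : bool :=
  (rank M (\bigcup_(a in S) val a) < #|S|)%N.

Definition is_ideal (J : Lam -> Prop) : Prop :=
  [/\ J 0, forall u v, J u -> J v -> J (u - v),
      forall u v, J v -> J (wedge u v)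
    & forall u v, J u -> J (wedge u v)].

Definition in_OS_ideal (u : Lam) : Prop :=
  forall J : Lam -> Prop, is_ideal J ->
    (forall S, dependent_atoms S -> J (bdry R S)) -> J u.

Definition OS_ideal : {pred Lam} := fun u => `[< in_OS_ideal u >].

Lemma OS_ideal_zmod_closed : zmod_closed OS_ideal.
Proof.
split=> [|u v /asboolP Iu /asboolP Iv]; apply/asboolP => J idJ dJ.
  by case: idJ.
by case: (idJ) => _ JB _ _; apply: JB; [apply: Iu | apply: Iv].
Qed.
HB.instance Definition _ :=
  GRing.isZmodClosed.Build Lam OS_ideal OS_ideal_zmod_closed.

(** Only the additive structure of the quotient is needed. *)
Definition OS : zmodType := {ideal_quot OS_ideal}.

Definition OSpi (u : Lam) : OS := \pi_{ideal_quot OS_ideal} u.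

Definition OSrepr (w : OS) : Lam := repr w.

Definition OS1 : OS := OSpi (ext1 R (atom M)).

(** The sum has exactly one term when [A] is a nonempty subset of an atom of a
    loopless [M]. *)
Definition atom_gen (A : {set T}) : Lam :=
  \sum_(a : atom M | A \subset val a) mono R [set a].

Definition ext_seq (s : seq T) : Lam :=
  foldr (fun i => wedge (atom_gen [set i])) (ext1 R (atom M)) s.

Definition OSe (s : seq T) : OS := OSpi (ext_seq s).

End Def.

(** An atom [b <> a] of [M] is disjoint from [a] and contained in a unique atom of
    [M / a], which gives its image.  On monomials this is e_I |-> 0 if [a] is not in
    [I], and otherwise e_I = sgn_last a I . e_(I \ a) /\ e_a is sent to the image of
    sgn_last a I . e_(I \ a). *)
Definition ext_res (M : om T) (a : atom M) (u : ext R (atom M)) :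
    ext R (atom (contract M (val a))) :=
  \sum_(I : {set atom M} | a \in I)
     ((u I : R) * sgn_last R a I) *:
       foldr (fun b : atom M => wedge (atom_gen (contract M (val a)) (val b)))
             (ext1 R (atom (contract M (val a)))) (enum (I :\ a)).

(** [ext_res a] maps the ideal of [M] into that of [M / a], so that the value does
    not depend on the representative. *)
Definition Res (M : om T) (a : atom M) (w : OS M) : OS (contract M (val a)) :=
  OSpi (ext_res a (OSrepr w)).

Definition Omega (M : om T) (P : signvec T) (chi : seq T -> sign)
    (Delta : {set {set T}}) : OS M :=
  \sum_(B in Delta) sact (reorient_chi P chi (enum B)) (OSe M (enum B)).

End OrlikSolomon.

(* Main.v *)
(** Let [e_p /\ e_B] be expanded by the relation [bdry (p, B) = 0]: in the sum
    [sum_B chi(B) e_B] over a triangulation the contributions of the two simplices on an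
    interior ridge cancel, and what remains is, over the facets [H] not containing [p],
    the product of [e_p] with the sum attached to the triangulation induced on [H].
    Induction on the rank shows that the sum does not depend on the triangulation, and
    that it vanishes if some [p] lies on all facets.  That every facet does carry an
    induced triangulation is the point where a Farkas lemma is needed.
    The residue at [a] of the sum is the sum attached to the link of [a], which is a
    triangulation of the contraction.  If [a] is a facet of [P] the link is not empty and
    independence of the triangulation gives the recursion; otherwise some element outside
    [a] lies on all facets through [a], and the sum over the link vanishes. *)

Require Import Defs.
From mathcomp Require Import all_boot perm all_algebra.
From mathcomp Require Import boolp zify.

Set Implicit Arguments.
Unset Strict Implicit.
Unset Printing Implicit Defensive.

Import GRing.Theory.

(** * Signs, alternating functions and matroids *)

(** Volumes take values in one fixed abelian group: on a hyperplane the function [e] on sequences is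
    replaced by [cone p e], still valued in the top degree of the original algebra, so the induction
    on the rank needs no map between the algebras of different matroids. The sign of the cocircuit
    of a facet is fixed by an element off the facet; this cocircuit being one-sided, the choice of
    the element is immaterial.

    The obstacle is covering: the conditions on a triangulation exclude overlaps and missing
    neighbours, but do not say that a given facet contains a ridge. Two claims support each other,
    that every element lies in the hull of the vertices in use and that every facet of such a hull
    carries a ridge; they are obtained together by a double induction, on the codimension of a face
    and on the number of elements. The hull claim also shows that a facet atom of [P] contains a
    vertex.

    A chirotope is given by pivoting only, so its orthogonality to the circuits has to be derived.
    The residue of [e_a] times [u] is, up to the grading involution, the image of [u] in the
    contraction; hence the ideal has to be followed under both maps at once. *)

Lemma soppK : involutive sopp. Proof. by case. Qed.

Lemma sopp_eq0 x : (sopp x == Zero) = (x == Zero). Proof. by case: x. Qed.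

Lemma sact_sopp (V : zmodType) x (w : V) : sact (sopp x) w = (- sact x w)%R.
Proof. by case: x; rewrite /= ?opprK ?oppr0. Qed.

Lemma sactN (V : zmodType) x (w : V) : sact x (- w)%R = (- sact x w)%R.
Proof. by case: x; rewrite /= ?oppr0. Qed.

Lemma sactD (V : zmodType) x (v w : V) : sact x (v + w)%R = (sact x v + sact x w)%R.
Proof. by case: x; rewrite /= ?opprD ?addr0. Qed.

Lemma sact0 (V : zmodType) x : sact x (0 : V)%R = 0%R.
Proof. by case: x; rewrite /= ?oppr0. Qed.

Section Alternating.
Variable T : eqType.

Definition alternating X (op : X -> X) (f : seq T -> X) : Prop :=
  forall s1 x y s2, f (s1 ++ x :: y :: s2) = op (f (s1 ++ y :: x :: s2)).

Lemma alternating_cons X (op : X -> X) f x :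
  alternating op f -> alternating op (fun s => f (x :: s)).
Proof. by move=> fA s1 y z s2; rewrite -!cat_cons fA. Qed.

Lemma alternating_rcons X (op : X -> X) f x :
  alternating op f -> alternating op (fun s => f (rcons s x)).
Proof. by move=> fA s1 y z s2; rewrite !rcons_cat /= fA. Qed.

(** The parity [b] depends on the two sequences only, so it is the same for all
    alternating functions. *)
Lemma alternating_perm (s s' : seq T) : perm_eq s s' ->
  exists b : bool, forall X (op : X -> X) f, involutive op -> alternating op f ->
    forall t, f (t ++ s) = if b then op (f (t ++ s')) else f (t ++ s').
Proof.
suff front (x : T) u v : exists b : bool, forall X (op : X -> X) f,
    involutive op -> alternating op f ->
    forall t, f (t ++ x :: u ++ v) = if b then op (f (t ++ u ++ x :: v)) else f (t ++ u ++ x :: v).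
  elim: s s' => [|x s IH] s'.
    by rewrite perm_sym => /perm_nilP->; exists false.
  move=> ps; have xs' : x \in s' by rewrite -(perm_mem ps) mem_head.
  case/splitPr: xs' ps => u v ps.
  have {}ps : perm_eq s (u ++ v).
    by move: ps; rewrite perm_sym perm_catC /= perm_cons perm_catC perm_sym.
  have [b Hb] := IH _ ps; have [c Hc] := front x u v.
  exists (b (+) c) => X op f opK fA t.
  have := Hb X op f opK fA (rcons t x); rewrite !cat_rcons => ->.
  rewrite (Hc X op f opK fA t).
  by case: (b); case: (c) => //=; rewrite opK.
elim: u => [|y u [b Hb]]; first by exists false.
exists (~~ b) => X op f opK fA t.
have := Hb X op f opK fA (rcons t y); rewrite !cat_rcons /= => H.
by rewrite fA H; case: (b) => //=; rewrite opK.
Qed.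

Lemma alternating_eq0 f (s s' : seq T) : alternating sopp f -> perm_eq s s' ->
  (f s == Zero) = (f s' == Zero).
Proof.
move=> fA /alternating_perm[b Hb].
rewrite (Hb _ _ _ soppK fA [::]) /=.
by case: (b); rewrite ?sopp_eq0.
Qed.

(** Both factors change by the same parity, so a term of a volume depends on the simplex [B] and not
    on the order in which [enum B] lists it. *)
Lemma sact_perm (V : zmodType) f g (s s' : seq T) :
  alternating sopp f -> alternating (@GRing.opp V) g -> perm_eq s s' ->
  sact (f s) (g s) = sact (f s') (g s').
Proof.
move=> fA gA /alternating_perm[b Hb].
rewrite (Hb _ _ _ soppK fA [::]) (Hb _ _ _ (@opprK V) gA [::]) /=.
by case: (b) => //; rewrite sact_sopp sactN opprK.
Qed.

(** [delete_sum f s] is the alternating sum of the values of [f] on the sequences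
    obtained by deleting one entry of [s]. *)
Fixpoint delete_sum (V : zmodType) (f : seq T -> V) (s : seq T) : V :=
  if s is x :: s' then (f s' - delete_sum (fun u => f (x :: u)) s')%R else 0%R.

Lemma eq_delete_sum (V : zmodType) (f g : seq T -> V) s :
  f =1 g -> delete_sum f s = delete_sum g s.
Proof.
elim: s f g => //= x s IH f g fg; rewrite fg; congr (_ - _)%R.
by apply: IH => u; rewrite fg.
Qed.

(** Alternation of [chi] absorbs the deletion sign: moving the deleted entry [b] to the front costs
    exactly the sign that [delete_sum] attaches to it. What remains depends only on the ridge and on
    the side of [b]. *)
Lemma sact_delete_sum (V : zmodType) (chi : seq T -> sign) (f : seq T -> V) s :
  alternating sopp chi -> uniq s ->
  sact (chi s) (delete_sum f s)
    = (\sum_(b <- s) sact (chi (b :: rem b s)) (f (rem b s)))%R.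
Proof.
elim: s chi f => [|x s IH] chi f chiA.
  by rewrite big_nil sact0.
case/andP=> xs us; rewrite /= big_cons /= eqxx sactD sactN; congr (_ + _)%R.
rewrite (IH (fun u => chi (x :: u))) //; last exact: alternating_cons.
rewrite -sumrN !big_seq; apply: eq_bigr => b bs.
have -> : x == b = false by apply: contraNF xs => /eqP->.
by have := chiA [::] b x (rem b s); rewrite /= => ->; rewrite sact_sopp.
Qed.

End Alternating.

Section Matroid.
Variable T : finType.
Implicit Types (A B I J K : {set T}) (ind : pred {set T}).

Record matroid ind : Prop := Matroid {
  ind0 : ind set0;
  indS : forall I J, I \subset J -> ind J -> ind I;
  indA : forall I J, ind I -> ind J -> #|I| < #|J| ->
    exists2 x, x \in J :\: I & ind (x |: I)
}.

Variables (ind : pred {set T}) (mat : matroid ind).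

Lemma ind_extend I K : ind I -> ind K ->
  exists J, [/\ I \subset J, J \subset I :|: K, ind J & #|K| <= #|J|].
Proof.
move=> iI iK; have [n] := ubnP (#|K| - #|I|); elim: n I iI => // n IH I iI lt.
have [le|lt2] := leqP #|K| #|I|.
  by exists I; rewrite subxx subsetUl.
have [x /setDP[xK xI] ix] := indA mat iI iK lt2.
have [|J [IJ JU iJ le]] := IH _ ix; first by rewrite cardsU1 xI; lia.
exists J; split=> //; first by apply: subset_trans IJ; apply: subsetUr.
by apply: (subset_trans JU); rewrite !subUset sub1set !inE xK orbT subsetUl subsetUr.
Qed.

Lemma ind_max A I : I \subset A -> ind I ->
  exists J, [/\ I \subset J, J \subset A, ind J
              & forall x, x \in A -> x \notin J -> ~~ ind (x |: J)].
Proof.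
move=> IA iI.
have [J /maxsetP[/andP[iJ JA] maxJ] IJ] :=
  @maxset_exists _ (fun J => ind J && (J \subset A)) I (introT andP (conj iI IA)).
exists J; split=> // x xA xJ; apply/negP => ix.
have := maxJ (x |: J); rewrite ix subUset sub1set xA JA subsetUr => /(_ isT isT) e.
by move: xJ; rewrite -e setU11.
Qed.

Lemma ind_max_card A J K :
  (forall x, x \in A -> x \notin J -> ~~ ind (x |: J)) ->
  ind J -> K \subset A -> ind K -> #|K| <= #|J|.
Proof.
move=> maxJ iJ KA iK; rewrite leqNgt; apply/negP => lt.
have [x /setDP[xK xJ] ix] := indA mat iJ iK lt.
by move: (maxJ x (subsetP KA _ xK) xJ); rewrite ix.
Qed.

End Matroid.

(** * Oriented matroids given by independent sets, circuits and a chirotope *)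

Section Oriented.
Variable T : finType.
Implicit Types (A B I J K V W : {set T}) (C : signvec T) (s : seq T).

(** An oriented matroid of rank [r] on [E], given by its independent sets, (some of)
    its signed circuits and a chirotope; for [s] a basis of a hyperplane the vector
    [fun e => chi (e :: s)] is a signed cocircuit.  This form passes to
    the restriction to a hyperplane and to the contraction of an element. *)
Record oriented (E : {set T}) (r : nat) (ind : pred {set T})
    (circ : pred (signvec T)) (chi : seq T -> sign) : Prop := Oriented {
  o_mat : matroid ind;
  o_base : exists B, [/\ B \subset E, ind B & #|B| = r];
  o_max : forall I, I \subset E -> ind I -> #|I| <= r;
  o_chi : forall s, {subset s <= E} ->
    (chi s != Zero) = [&& size s == r, uniq s & ind [set x in s]];
  o_alt : alternating sopp chi;
  o_opp : forall C, circ C -> circ (svopp C);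
  o_orth : forall C s, circ C -> supp C \subset E -> {subset s <= E} ->
    (size s).+1 = r -> (forall e, smul (C e) (chi (e :: s)) != Neg) ->
    forall e, smul (C e) (chi (e :: s)) = Zero;
  o_circ : forall I h, I \subset E -> h \in E -> ind I -> h \notin I ->
    ~~ ind (h |: I) -> exists C, [/\ circ C, supp C \subset h |: I & C h = Neg]
}.

(** In [t_ridge] the boundary clause refers to the cocircuit spanned by the ridge itself, and a
    neighbour is given by the element [b'] exchanged for [b]; both are the forms in which signs can
    be compared directly. *)
Record triang (E : {set T}) (r : nat) (ind : pred {set T})
    (circ : pred (signvec T)) (chi : seq T -> sign) (D : {set {set T}}) : Prop :=
  Triang {
  t_ne : D != set0;
  t_base : forall B, B \in D -> [/\ B \subset E, ind B & #|B| = r];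
  t_disj : forall B B' C, B \in D -> B' \in D -> circ C ->
    pospart C \subset B -> negpart C \subset B' -> False;
  t_ridge : forall B b, B \in D -> b \in B ->
    (forall e, e \in E -> chi (e :: enum (B :\ b)) != Zero ->
       chi (e :: enum (B :\ b)) = chi (b :: enum (B :\ b))) \/
    (exists b', [/\ b' \notin B, b' != b & b' |: (B :\ b) \in D])
}.

Lemma suppP C e : reflect (C e <> Zero) (e \in supp C).
Proof. by rewrite inE; apply: (iffP idP) => /eqP. Qed.

Lemma supp_opp C : supp (svopp C) = supp C.
Proof. by apply/setP=> x; rewrite !inE !ffunE sopp_eq0. Qed.

Lemma notin_supp C e : e \notin supp C -> C e = Zero.
Proof. by rewrite inE negbK => /eqP. Qed.

Lemma set_in_enum (A : {set T}) : [set x in enum A] = A.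
Proof. by apply/setP=> x; rewrite inE mem_enum. Qed.

Lemma size_enum (A : {set T}) : size (enum A) = #|A|.
Proof. by rewrite cardE. Qed.

Lemma rem_enum (A : {set T}) b : rem b (enum A) = enum (A :\ b).
Proof.
rewrite rem_filter ?enum_uniq // /enum_mem -filter_predI.
by apply: eq_filter => x; rewrite !inE.
Qed.

Lemma perm_enumU1 (A : {set T}) b : b \notin A -> perm_eq (enum (b |: A)) (b :: enum A).
Proof.
move=> bA; apply: uniq_perm; rewrite /= ?enum_uniq ?mem_enum ?bA //.
by move=> x; rewrite inE !mem_enum !inE.
Qed.

Lemma perm_enumD1 (A : {set T}) b : b \in A -> perm_eq (enum A) (b :: enum (A :\ b)).
Proof. by move=> bA; rewrite -{1}(setD1K bA); apply: perm_enumU1; rewrite !inE eqxx. Qed.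

Section Theory.
Variables (E : {set T}) (r : nat) (ind : pred {set T}).
Variables (circ : pred (signvec T)) (chi : seq T -> sign).
Hypothesis O : oriented E r ind circ chi.
Let mat := o_mat O.

Lemma subset_enum A : A \subset E -> {subset enum A <= E}.
Proof. by move/subsetP=> AE x; rewrite mem_enum => /AE. Qed.

Lemma chi_cons e s : e \in E -> {subset s <= E} ->
  (chi (e :: s) != Zero)
    = [&& (size s).+1 == r, e \notin s, uniq s & ind (e |: [set x in s])].
Proof.
move=> eE sE; rewrite (o_chi O); last first.
  by move=> x; rewrite inE => /predU1P[->|/sE].
rewrite -!andbA /=; do 3?congr andb; congr ind.
by apply/setP=> x; rewrite !inE.
Qed.

Lemma chi_cons_enum e A : e \in E -> A \subset E ->
  (chi (e :: enum A) != Zero) = [&& #|A|.+1 == r, e \notin A & ind (e |: A)].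
Proof.
move=> eE AE; rewrite (chi_cons eE (subset_enum AE)) size_enum enum_uniq.
by rewrite mem_enum set_in_enum.
Qed.

Lemma chi_mem e s : e \in s -> {subset s <= E} -> chi (e :: s) = Zero.
Proof.
move=> es sE; apply/eqP/negPn; rewrite chi_cons ?sE // es /=.
by rewrite andbF.
Qed.

(** Only the products at [e] and [f] can be nonzero. If neither were [Neg], [o_orth] would make them
    vanish, and if neither were [Pos], [o_orth] for [svopp C] would do so; hence they are
    opposite. *)
Lemma orth2 C s e f : circ C -> supp C \subset E -> {subset s <= E} ->
  (size s).+1 = r -> e != f ->
  (forall g, g != e -> g != f -> C g != Zero -> chi (g :: s) = Zero) ->
  smul (C e) (chi (e :: s)) = sopp (smul (C f) (chi (f :: s))).
Proof.
move=> cC CE sE sr ef others.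
pose p g := smul (C g) (chi (g :: s)).
have oth g : g != e -> g != f -> p g = Zero.
  move=> ge gf; rewrite /p; have [->//|Cg] := eqVneq (C g) Zero.
  by rewrite others //; case: (C g).
have oN g : smul (svopp C g) (chi (g :: s)) = sopp (p g).
  by rewrite /p ffunE; case: (C g); case: (chi _).
have both (x : sign) : x != Zero -> p e != x -> p f != x -> forall g, p g != x.
  move=> x0 ex fx g; have [->//|ge] := eqVneq g e; have [->//|gf] := eqVneq g f.
  by rewrite oth // eq_sym.
have neg : p e != Neg -> p f != Neg -> forall g, p g = Zero.
  by move=> pe pf; apply: (o_orth O) => //; apply: both.
have pos : p e != Pos -> p f != Pos -> forall g, sopp (p g) = Zero.
  move=> pe pf g; rewrite -oN; apply: (o_orth O (o_opp O cC)); rewrite ?supp_opp // => h.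
  by rewrite oN; have := both Pos isT pe pf h; case: (p h).
rewrite -/(p e) -/(p f); case pe: (p e) neg pos; case pf: (p f) => //= neg pos.
- by have := pos isT isT e; rewrite pe.
- by have := pos isT isT e; rewrite pe.
- by have := pos isT isT f; rewrite pf.
- by have := neg isT isT f; rewrite pf.
- by have := neg isT isT e; rewrite pe.
by have := neg isT isT e; rewrite pe.
Qed.

Lemma base_extend I : I \subset E -> ind I ->
  exists J, [/\ I \subset J, J \subset E, ind J & #|J| = r].
Proof.
move=> IE iI; have [B [BE iB cB]] := o_base O.
have [J [IJ JU iJ le]] := ind_extend mat iI iB.
have JE : J \subset E by apply: subset_trans JU _; rewrite subUset IE.
by exists J; split=> //; apply/eqP; rewrite eqn_leq (o_max O) // -cB.
Qed.

(** That circuits are dependent is not a field of [oriented] but follows from orthogonality: for a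
    base [J] containing [I], the cocircuit of [J :\ e] meets [C] in [e] at most. *)
Lemma circ_dep C I : circ C -> supp C \subset I -> I \subset E -> ind I ->
  forall e, C e = Zero.
Proof.
move=> cC CI IE iI e; have [//|Ce] := eqVneq (C e) Zero.
have eI : e \in I by apply: (subsetP CI); apply/suppP/eqP.
have [J [IJ JE iJ cJ]] := base_extend IE iI.
have eJ := subsetP IJ _ eI.
have cJe : #|J :\ e|.+1 = r by rewrite -cJ (cardsD1 e J) eJ.
have JeE : J :\ e \subset E by apply: subset_trans JE; apply: subsetDl.
have ye : chi (e :: enum (J :\ e)) != Zero.
  by rewrite chi_cons_enum ?(subsetP IE) // cJe eqxx !inE eqxx setD1K.
have oth g : g != e -> smul (C g) (chi (g :: enum (J :\ e))) = Zero.
  move=> ge; have [->//|Cg] := eqVneq (C g) Zero.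
  rewrite chi_mem; first by case: (C g).
    by rewrite mem_enum !inE ge (subsetP IJ) // (subsetP CI) //; apply/suppP/eqP.
  exact: subset_enum.
have CE := subset_trans CI IE; have szJ : (size (enum (J :\ e))).+1 = r by rewrite size_enum.
have nz : smul (C e) (chi (e :: enum (J :\ e))) <> Zero.
  by move: Ce ye; case: (C e) => //; case: (chi _).
case sg: (smul (C e) (chi (e :: enum (J :\ e)))) => //; last first.
  have := o_orth O cC CE (subset_enum JeE) szJ; move=> /(_ _ e); rewrite sg => H.
  suff: Pos = Zero by []; apply: H => g.
  by have [->|ge] := eqVneq g e; rewrite ?sg // oth.
have oC g : smul (svopp C g) (chi (g :: enum (J :\ e)))
    = sopp (smul (C g) (chi (g :: enum (J :\ e)))).
  by rewrite ffunE; case: (C g); case: (chi _).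
have := o_orth O (o_opp O cC) _ (subset_enum JeE) szJ; rewrite supp_opp.
move=> /(_ CE _ e); rewrite oC sg => H.
suff: sopp Neg = Zero by []; apply: H => g.
by rewrite oC; have [->|ge] := eqVneq g e; rewrite ?sg // oth.
Qed.

Lemma fund_circ B f : B \subset E -> ind B -> #|B| = r -> f \in E -> f \notin B ->
  exists C, [/\ circ C, supp C \subset f |: B & C f = Neg].
Proof.
move=> BE iB cB fE fB; apply: (o_circ O) => //; apply/negP => ifB.
have := o_max O _ ifB; rewrite subUset sub1set fE BE cardsU1 fB cB => /(_ isT).
by rewrite ltnn.
Qed.

(** The entries of [s] lie on the hyperplane of [s0], so both cocircuits meet the fundamental
    circuit of [f] over [e] and [s] only in [e] and [f]. That circuit dictates the ratio of the
    values at [e] and [f] in both cases. *)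
Lemma same_side s s0 e f : {subset s <= E} -> {subset s0 <= E} ->
  (size s).+1 = r -> (size s0).+1 = r -> e \in E -> f \in E ->
  (forall x, x \in s -> chi (x :: s0) = Zero) ->
  chi (e :: s) != Zero -> chi (e :: s0) != Zero -> chi (e :: s0) = chi (f :: s0) ->
  chi (e :: s) = chi (f :: s).
Proof.
move=> sE s0E sr s0r eE fE ss0 ye y0e y0ef.
have [->//|ef] := eqVneq e f.
have y0f : chi (f :: s0) != Zero by rewrite -y0ef.
have fs : f \notin s by apply: contraNN y0f => /ss0->.
move: (ye); rewrite chi_cons // => /and4P[_ es us ies].
have [||||| C [cC CS Cf]] := @fund_circ (e |: [set x in s]) f => //.
- by rewrite subUset sub1set eE; apply/subsetP=> x; rewrite inE => /sE.
- by rewrite cardsU1 inE es cardsE (card_uniqP us).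
- by rewrite !inE negb_or eq_sym ef.
have CE : supp C \subset E.
  apply: (subset_trans CS); rewrite !subUset !sub1set fE eE.
  by apply/subsetP=> x; rewrite inE => /sE.
have Cs g : g != e -> g != f -> C g != Zero -> g \in s.
  move=> ge gf /eqP/suppP/(subsetP CS); rewrite !inE.
  by rewrite (negPf ge) (negPf gf).
have := @orth2 C s e f cC CE sE sr ef.
have := @orth2 C s0 e f cC CE s0E s0r ef.
have H1 g : g != e -> g != f -> C g != Zero -> chi (g :: s0) = Zero.
  by move=> *; apply/ss0/Cs.
have H2 g : g != e -> g != f -> C g != Zero -> chi (g :: s) = Zero.
  by move=> *; apply: chi_mem => //; apply: Cs.
move=> /(_ H1) + /(_ H2); rewrite -y0ef Cf.
by move: y0e ye; case: (C e); case: (chi _) => //; case: (chi _) => //; case: (chi _).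
Qed.

(** A rank count: [s] is independent, of length [r - 1], and contained in the hyperplane of [s0], so
    the two sequences span the same hyperplane. *)
Lemma same_hyper s s0 e : {subset s <= E} -> {subset s0 <= E} ->
  (size s).+1 = r -> (size s0).+1 = r -> uniq s -> uniq s0 ->
  ind [set x in s] -> ind [set x in s0] -> e \in E ->
  (forall x, x \in s -> chi (x :: s0) = Zero) ->
  (chi (e :: s) == Zero) = (chi (e :: s0) == Zero).
Proof.
move=> sE s0E sr s0r us us0 inds inds0 eE ss0.
pose H := [set x in E | chi (x :: s0) == Zero].
have sH : [set x in s] \subset H.
  by apply/subsetP=> x; rewrite !inE => xs; rewrite sE // ss0.
have H0 K : K \subset H -> ind K -> #|K| < r.
  have cs0 : #|[set x in s0]| = size s0 by rewrite cardsE (card_uniqP us0).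
  move=> KH iK; rewrite -s0r ltnS -cs0.
  apply: (ind_max_card mat _ inds0 KH iK) => x; rewrite !inE => /andP[xE /eqP xH] xs0.
  apply/negP=> ix; have := @chi_cons x s0 xE s0E.
  by rewrite xH s0r xs0 us0 ix !eqxx.
apply/idP/idP; apply: contraLR; last first.
  rewrite chi_cons // => /and4P[_ es _ ie]; apply/negP=> ye.
  have := H0 (e |: [set x in s]) _ ie; rewrite subUset sub1set sH inE eE ye.
  by rewrite cardsU1 inE es cardsE (card_uniqP us) add1n sr ltnn => /(_ isT).
rewrite chi_cons // => /and4P[_ es _ ie].
have cs : #|[set x in s]| < #|e |: [set x in s0]|.
  by rewrite cardsU1 inE es !cardsE !(card_uniqP _) //; lia.
have [x] := indA mat inds ie cs; rewrite !inE => /andP[xs /predU1P[xe|xs0]] ix.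
  by rewrite chi_cons // sr us -xe xs ix eqxx.
have := H0 (x |: [set x in s]) _ ix; rewrite subUset sub1set sH inE s0E //.
rewrite chi_mem // cardsU1 inE xs cardsE (card_uniqP us) => /(_ isT).
by rewrite add1n sr ltnn.
Qed.

End Theory.
End Oriented.

(** * Hulls and boundary ridges *)

Section Theory2.
Variable T : finType.
Implicit Types (A B I J K V W : {set T}) (C : signvec T) (s : seq T).
Variables (E : {set T}) (r : nat) (ind : pred {set T}).
Variables (circ : pred (signvec T)) (chi : seq T -> sign).
Hypothesis O : oriented E r ind circ chi.
Let mat := o_mat O.

(** A spanned hyperplane determines its cocircuit up to sign; [b] selects the sign. *)
Definition cocirc (b : bool) s e := if b then sopp (chi (e :: s)) else chi (e :: s).

Lemma cocirc_eq0 b s e : (cocirc b s e == Zero) = (chi (e :: s) == Zero).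
Proof. by case: b; rewrite /= ?sopp_eq0. Qed.

Lemma orth_cocirc C b s : circ C -> supp C \subset E -> {subset s <= E} ->
  (size s).+1 = r -> (forall e, smul (C e) (cocirc b s e) != Neg) ->
  forall e, smul (C e) (cocirc b s e) = Zero.
Proof.
case: b => cC CE sE sr; last exact: (o_orth O).
have oC g : smul (svopp C g) (chi (g :: s)) = smul (C g) (sopp (chi (g :: s))).
  by rewrite ffunE; case: (C g); case: (chi _).
move=> nn e; rewrite -oC; apply: (o_orth O (o_opp O cC)); rewrite ?supp_opp //.
by move=> g; rewrite oC; apply: nn.
Qed.

(** [A] acts as the linear part and [V] as the generators: either [h] is in the cone of [V] modulo
    the span of [A], or a hyperplane through [A], spanned inside [W], separates [h] from [V]. In the
    induction a generator [v] is once dropped and once moved into [A]; if neither the hyperplane of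
    the first case nor the circuit of the second has an admissible sign at [v], the two violate
    orthogonality. *)
Lemma farkas W A V h : W \subset E ->
  (exists B, [/\ B \subset W, ind B & #|B| = r]) ->
  A \subset W -> V \subset W -> h \in E -> h \notin A -> h \notin V ->
  (exists C, [/\ circ C, supp C \subset h |: (A :|: V), C h = Neg
               & forall v, v \in V -> v \notin A -> C v != Neg]) \/
  (exists b s, [/\ {subset s <= W}, (size s).+1 = r,
     forall v, v \in A -> cocirc b s v = Zero,
     forall v, v \in V -> cocirc b s v != Neg & cocirc b s h = Neg]).
Proof.
move=> WE [B [BW iB cB]]; have [n] := ubnP #|V|; elim: n A V => // n IH A V.
case: (set_0Vmem V) => [-> _ AW _ hE hA _|[v vV] ltV AW VW hE hA hV].
  (* With no generators left, the question is whether [h] lies in the span of [A], tested on a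
     maximal independent subset [I]. *)
  have [I [_ IA iI maxI]] := ind_max (sub0set A) (ind0 mat).
  have [ih|ih] := boolP (ind (h |: I)); last first.
    left; have [||C [cC CI Ch]] := o_circ O _ hE iI _ ih.
    - by apply: subset_trans IA _; apply: subset_trans AW WE.
    - by apply: contraNN hA; apply: (subsetP IA).
    exists C; split=> // [|u]; last by rewrite inE.
    by rewrite setU0; apply: subset_trans CI _; apply: setUS.
  right; have [J [IJ JU iJ le]] := ind_extend mat ih iB.
  have JE : J \subset E.
    apply: subset_trans JU _; rewrite !subUset sub1set hE.
    by rewrite (subset_trans BW WE) (subset_trans _ WE) // (subset_trans IA AW).
  have hJ : h \in J by apply: (subsetP IJ); apply: setU11.
  have cJ : #|J :\ h|.+1 = r.
    move: (o_max O JE iJ) le; rewrite (cardsD1 h J) hJ add1n cB => le1 le2.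
    by apply/eqP; rewrite eqn_leq le1.
  have JW : J :\ h \subset W.
    apply/subsetP=> x; rewrite !inE => /andP[xh /(subsetP JU)].
    rewrite !inE (negPf xh) /= => /orP[|/(subsetP BW)//].
    by move/(subsetP IA)/(subsetP AW).
  have JhE := subset_trans JW WE.
  have ch : chi (h :: enum (J :\ h)) != Zero.
    by rewrite (chi_cons_enum O) // cJ !inE !eqxx /= setD1K.
  have [b Hb] : exists b, cocirc b (enum (J :\ h)) h = Neg.
    by rewrite /cocirc; case: (chi _) ch => // _; [exists false | exists true].
  exists b, (enum (J :\ h)); split=> //; rewrite ?size_enum //.
  - by move=> x; rewrite mem_enum => /(subsetP JW).
  - move=> u uA; apply/eqP; rewrite cocirc_eq0; apply/negPn.
    have uE := subsetP WE _ (subsetP AW _ uA).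
    rewrite (chi_cons_enum O) //; apply/negP => /and3P[_ uJ iu].
    have uI : u \notin I.
      apply: contra uJ => uI; rewrite !inE (subsetP IJ) ?inE ?uI ?orbT // andbT.
      by apply: contraNneq hA => <-.
    case/negP: (maxI u uA uI); apply: (indS mat) iu.
    apply: setUS; apply/subsetP=> x xI; rewrite !inE (subsetP IJ) ?inE ?xI ?orbT // andbT.
    by apply: contraNneq hA => <-; apply: (subsetP IA).
  by move=> u; rewrite inE.
have ltV' : #|V :\ v| < n by rewrite (cardsD1 v) vV in ltV.
have VW' : V :\ v \subset W by apply: subset_trans VW; apply: subsetDl.
have vW := subsetP VW _ vV.
have hv : h != v by apply: contraNneq hV => ->.
have hV' : h \notin V :\ v by rewrite !inE (negPf hV) andbF.
have [[C [cC CS Ch Cp]]|[b [s [sW sr y0 yp yh]]]] := IH A _ ltV' AW VW' hE hA hV'.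
  left; exists C; split=> // [|u uV uA].
    by apply: subset_trans CS _; do 2!apply: setUS; apply: subsetDl.
  have [uv|uv] := eqVneq u v; last by apply: Cp => //; rewrite !inE uv.
  rewrite notin_supp //; apply/negP => /(subsetP CS).
  by rewrite uv !inE eqxx eq_sym (negPf hv) /= orbF -uv (negPf uA).
have AW' : v |: A \subset W by rewrite subUset sub1set vW.
have hA' : h \notin v |: A by rewrite !inE negb_or hv.
have [[C [cC CS Ch Cp]]|[b' [s' [sW' sr' y0' yp' yh']]]] :=
  IH (v |: A) _ ltV' AW' VW' hE hA' hV'; last first.
  right; exists b', s'; split=> // [u uA|u uV]; first by apply: y0'; rewrite !inE uA orbT.
  have [->|uv] := eqVneq u v; first by rewrite y0' ?setU11.
  by apply: yp'; rewrite !inE uv.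
have CS' : supp C \subset h |: (A :|: V).
  apply: subset_trans CS _; by apply: setUS; rewrite -{2}(setD1K vV) setUCA setUA.
have [yv|yv] := eqVneq (cocirc b s v) Neg; last first.
  right; exists b, s; split=> // u uV.
  by have [->//|uv] := eqVneq u v; apply: yp; rewrite !inE uv.
have [Cv|Cv] := eqVneq (C v) Neg; last first.
  left; exists C; split=> // u uV uA.
  by have [->//|uv] := eqVneq u v; apply: Cp; rewrite !inE ?negb_or ?uv.
have CE : supp C \subset E.
  apply: subset_trans CS' _; rewrite subUset sub1set hE /=.
  by apply: subset_trans WE; rewrite subUset AW VW.
(* Here [C] and the cocircuit are both [Neg] at [v], and both are [Neg] at [h]. So no product is
   [Neg] and the one at [h] is [Pos], against orthogonality. *)
have := @orth_cocirc C b s cC CE _ sr.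
move=> /(_ (fun x xs => subsetP WE _ (sW x xs))) H.
have : smul (C h) (cocirc b s h) = Zero.
  apply: H => g; have [gS|/notin_supp->//] := boolP (g \in supp C).
  have := subsetP CS' _ gS; rewrite !inE => /predU1P[->|]; first by rewrite Ch yh.
  have [gA|gA] := boolP (g \in A); first by rewrite y0 //; case: (C g).
  have [->|gv] /= := eqVneq g v; first by rewrite Cv yv.
  move=> gV; have gV' : g \in V :\ v by rewrite !inE gv.
  have := Cp g gV'; rewrite !inE negb_or gv => /(_ gA); have := yp g gV'.
  by case: (C g); case: (cocirc _ _ _).
by rewrite Ch yh.
Qed.

Variable D : {set {set T}}.
Hypothesis tD : triang E r ind circ chi D.

(** If [b] and [b'] were on the same side of the ridge, the circuit in [b], [b'] and [A] would have
    opposite signs at [b] and [b']; its two parts would lie in the two simplices, which [t_disj]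
    forbids. *)
Lemma ridge_opp A b b' : b \notin A -> b' \notin A -> b != b' ->
  b |: A \in D -> b' |: A \in D -> chi (b :: enum A) = sopp (chi (b' :: enum A)).
Proof.
move=> bA b'A bb' bD b'D.
have [bE ib cb] := t_base tD bD; have [b'E ib' cb'] := t_base tD b'D.
move: bE b'E; rewrite !subUset !sub1set => /andP[bE AE] /andP[b'E _].
have cA : #|A|.+1 = r by rewrite -cb cardsU1 bA.
have y' : chi (b' :: enum A) != Zero by rewrite (chi_cons_enum O) // cA eqxx b'A.
have [||||| C [cC CS Cb']] := @fund_circ _ _ _ _ _ _ O (b |: A) b' => //.
- by rewrite subUset sub1set bE.
- by rewrite !inE negb_or eq_sym bb'.
have CE : supp C \subset E by apply: subset_trans CS _; rewrite !subUset !sub1set b'E bE.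
have sr : (size (enum A)).+1 = r by rewrite size_enum.
have oth g : g != b -> g != b' -> C g != Zero -> chi (g :: enum A) = Zero.
  move=> gb gb' /eqP/suppP/(subsetP CS); rewrite !inE (negPf gb) (negPf gb') /= => gA.
  by rewrite (chi_mem O) ?mem_enum //; apply: subset_enum.
have := orth2 O cC CE (subset_enum AE) sr bb' oth; rewrite Cb'.
case Cb : (C b).
- by case: (chi (b' :: _)); case: (chi (b :: _)).
- by case: (chi (b' :: _)) y'.
move=> _; exfalso; apply: (t_disj tD bD b'D cC).
- apply/subsetP=> g; rewrite inE => /eqP Cg.
  have : g \in supp C by rewrite inE Cg.
  by move/(subsetP CS); rewrite 3!inE => /predU1P[e|//]; rewrite e Cb' in Cg.
apply/subsetP=> g; rewrite inE => /eqP Cg.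
have : g \in supp C by rewrite inE Cg.
move/(subsetP CS); rewrite !inE => /or3P[->//|/eqP e|->]; last by rewrite orbT.
by rewrite e Cb in Cg.
Qed.

(** The vertices of the star of the face [A]. *)
Definition used A := \bigcup_(B in D | A \subset B) B.

Lemma usedP A v : reflect (exists B, [/\ B \in D, A \subset B & v \in B]) (v \in used A).
Proof.
apply: (iffP bigcupP) => [[B /andP[BD AB] vB]|[B [BD AB vB]]]; exists B => //.
by rewrite BD AB.
Qed.

Lemma used_sub A : used A \subset E.
Proof. by apply/bigcupsP=> B /andP[/(t_base tD)[]]. Qed.

(** Covering of the facets through [A] of the cone of [W]. The case wanted is [W = E], but it rests
    on the hull of [used A] and so on the case [W = used A]; therefore [W] is a parameter. *)
Definition ridge_in A W := forall b s,
  {subset s <= W} -> (size s).+1 = r -> ind [set x in s] -> uniq s ->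
  (forall v, v \in A -> cocirc b s v = Zero) ->
  (forall v, v \in W -> cocirc b s v != Neg) ->
  exists B, [/\ B \in D, A \subset B &
    exists2 x, x \in B & forall v, v \in B :\ x -> cocirc b s v = Zero].

(** Otherwise a facet of the configuration of used elements would be visible from [h],
    and the ridge on it would have no neighbour and not lie in the boundary. *)
Lemma in_hull A h : (exists2 B, B \in D & A \subset B) -> ridge_in A (used A) ->
  h \in E -> h \notin used A ->
  exists C, [/\ circ C, supp C \subset h |: used A, C h = Neg
              & forall v, v \in used A -> v \notin A -> C v != Neg].
Proof.
move=> [B0 B0D AB0] Sd hE hV; have [B0E iB0 cB0] := t_base tD B0D.
have AV : A \subset used A.
  by apply/subsetP=> x xA; apply/usedP; exists B0; rewrite (subsetP AB0).
have hA : h \notin A by apply: contraNN hV; apply: (subsetP AV).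
have BV : exists B, [/\ B \subset used A, ind B & #|B| = r].
  exists B0; split=> //; apply/subsetP=> x xB.
  by apply/usedP; exists B0.
(* The vertices of the star serve both as spanning set and as generators. In the second alternative
   the hyperplane of [s] supports [used A] and has [h] strictly on the other side. *)
have [[C [cC CS Ch Cp]]|[b [s [sW sr y0 yp yh]]]] :=
  farkas (used_sub A) BV AV (subxx _) hE hA hV.
  by exists C; split=> //; move: CS; rewrite (setUidPr AV).
exfalso; have sE x : x \in s -> x \in E by move/sW/(subsetP (used_sub A)).
have : chi (h :: s) != Zero by rewrite -(cocirc_eq0 b) yh.
rewrite (chi_cons O) // => /and4P[_ hs us ihs].
have iss : ind [set x in s] by apply: (indS mat) ihs; apply: subsetUr.
have [B [BD AB [x xB Bx]]] := Sd b s sW sr iss us y0 yp.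
have [BE iB cB] := t_base tD BD.
have BxE : B :\ x \subset E by apply: subset_trans BE; apply: subsetDl.
have zx : size (enum (B :\ x)) = size s.
  by apply: succn_inj; rewrite size_enum sr -cB (cardsD1 x B) xB.
have xE := subsetP BE _ xB.
have side e f : e \in E -> f \in E -> chi (e :: enum (B :\ x)) != Zero ->
    cocirc b s e != Zero -> cocirc b s e = cocirc b s f ->
    chi (e :: enum (B :\ x)) = chi (f :: enum (B :\ x)).
  move=> eE fE ye; rewrite cocirc_eq0 => y1e y1ef.
  apply: (same_side O (subset_enum BxE) sE _ sr) => //; rewrite ?zx //.
  - by move=> v; rewrite mem_enum => /Bx /eqP; rewrite cocirc_eq0 => /eqP.
  by move: y1ef; rewrite /cocirc; case: (b); do 2!case: (chi _).
have hyp e : e \in E -> (chi (e :: enum (B :\ x)) == Zero) = (cocirc b s e == Zero).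
  move=> eE; rewrite cocirc_eq0.
  apply: (same_hyper O (subset_enum BxE) sE _ sr); rewrite ?zx ?enum_uniq //.
    by rewrite set_in_enum; apply: (indS mat) iB; apply: subsetDl.
  by move=> v; rewrite mem_enum => /Bx /eqP; rewrite cocirc_eq0 => /eqP.
have yx : chi (x :: enum (B :\ x)) != Zero.
  by rewrite (chi_cons_enum O) // -size_enum zx sr !inE !eqxx setD1K.
have xV : x \in used A by apply/usedP; exists B.
have y1x : cocirc b s x = Pos.
  by have := yp x xV; move: yx; rewrite hyp //; case: (cocirc _ _ _).
have AB' : A \subset B :\ x.
  apply/subsetP=> a aA; rewrite !inE (subsetP AB) // andbT.
  by apply/eqP=> e; rewrite -e y0 in y1x.
(* The ridge [B :\ x] spans the hyperplane of [s]. It is not in the boundary, as [h] and [x] are on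
   opposite sides; and the apex [b'] of a neighbour would be in [used A] and yet on the side of
   [h]. *)
have [H|[b' [b'B b'x b'D]]] := t_ridge tD BD xB.
  have := H h hE; rewrite hyp // yh => /(_ isT) Hx.
  have : chi (h :: s) = chi (x :: s).
    apply: (same_side O sE (subset_enum BxE) sr) => //; rewrite ?zx //.
    - move=> v vs; apply/eqP; rewrite hyp ?sE // cocirc_eq0.
      by apply/eqP; apply: (chi_mem O).
    - by rewrite -(cocirc_eq0 b) yh.
    by rewrite hyp // yh.
  by move: yh y1x; rewrite /cocirc; case: (b) => [|-> ->]; do 2!case: (chi _).
have b'V : b' \in used A.
  by apply/usedP; exists (b' |: (B :\ x)); rewrite setU11 (subset_trans AB') ?subsetUr.
have b'E := subsetP (used_sub A) _ b'V.
have xB' : x \notin B :\ x by rewrite !inE eqxx.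
have b'B' : b' \notin B :\ x by rewrite !inE negb_and b'B orbT.
have opp := ridge_opp xB' b'B'; rewrite eq_sym b'x setD1K // in opp.
have {}opp := opp isT BD b'D.
have y1b' : cocirc b s b' = Pos.
  have := yp b' b'V; have := hyp b' b'E; rewrite -sopp_eq0 -opp (negPf yx).
  by case: (cocirc _ _ _).
have := side x b' xE b'E yx; rewrite y1x y1b' => /(_ isT erefl) e.
by move: yx opp; rewrite e; case: (chi _).
Qed.

(** A used vertex outside [A] on the supporting hyperplane is added to [A] (outer induction). If
    there is none and [A] spans the hyperplane, [A] itself is the ridge. Otherwise [s] has an
    element [h] independent of [A], hence not in use; [used A] is then smaller than [W], and the
    inner induction puts [h] in the hull of [used A]. Orthogonality confines the resulting circuit
    to the independent set [h |: A]. *)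
Lemma all_ridge_in A W : (exists2 B, B \in D & A \subset B) -> used A \subset W ->
  W \subset E -> ridge_in A W.
Proof.
have [n] := ubnP (r - #|A|); elim: n A W => // n IHn A W ltA.
have [m] := ubnP #|W|; elim: m W => // m IHm W ltW exB UW WE.
move=> b s sW sr iss us y0 yp; have sE x : x \in s -> x \in E by move/sW/(subsetP WE).
have [B0 B0D AB0] := exB; have [B0E iB0 cB0] := t_base tD B0D.
have AV : A \subset used A.
  by apply/subsetP=> x xA; apply/usedP; exists B0; rewrite (subsetP AB0).
have [/existsP[v /and3P[vU vA /eqP yv]]|none] :=
  boolP [exists v, [&& v \in used A, v \notin A & cocirc b s v == Zero]].
  have /usedP[B [BD AB vB]] := vU.
  have vAB : v |: A \subset B by rewrite subUset sub1set vB.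
  have lt : #|A| < r.
    have [_ _ <-] := t_base tD BD; apply: leq_trans (subset_leq_card vAB).
    by rewrite cardsU1 vA.
  have [||||B' [B'D AB' HB']] := IHn (v |: A) W _ _ _ WE b s sW sr iss us _ yp => //.
  - by rewrite cardsU1 vA add1n subnS; move: ltA; rewrite ltnS; apply: leq_trans; rewrite ltn_predL subn_gt0.
  - by exists B.
  - apply: subset_trans UW; apply/subsetP=> u /usedP[B2 [B2D AB2 uB2]].
    by apply/usedP; exists B2; split=> //; apply: subset_trans AB2; apply: subsetUr.
  - by move=> u; rewrite !inE => /predU1P[->|/y0].
  by exists B'; split=> //; apply: subset_trans AB'; apply: subsetUr.
have pos v : v \in used A -> v \notin A -> cocirc b s v = Pos.
  move=> vU vA; have := yp v (subsetP UW _ vU).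
  have : cocirc b s v != Zero.
    by apply: contraNneq none => yv; apply/existsP; exists v; rewrite vU vA yv.
  by case: (cocirc _ _ _).
have iA := indS mat AB0 iB0.
have AE := subset_trans AB0 B0E.
have ssE : [set x in s] \subset E by apply/subsetP=> x; rewrite inE => /sE.
have css : #|[set x in s]| = size s by rewrite cardsE (card_uniqP us).
have AH : #|A| <= size s.
  rewrite -css; apply: (ind_max_card mat _ iss (subxx A) iA) => x xA; rewrite inE => xs.
  apply/negP=> ix; have := y0 x xA => /eqP; rewrite cocirc_eq0; apply/negP.
  by rewrite (chi_cons O) ?(subsetP AE) // sr xs us ix eqxx.
have [lt|ge] := ltnP #|A| (size s); last first.
  have cA : #|A| = size s by apply/eqP; rewrite eqn_leq AH.
  have [x xB0 xA] : exists2 x, x \in B0 & x \notin A.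
    by apply/subsetPn; apply/negP=> /subset_leq_card; rewrite cB0 -sr cA ltnn.
  exists B0; split=> //; exists x => // v.
  have -> : B0 :\ x = A; last exact: y0.
  apply/esym/eqP; rewrite eqEcard subsetD1 AB0 xA /= cA.
  by rewrite -ltnS sr -cB0 [X in _ <= X](cardsD1 x B0) xB0.
rewrite -css in lt; have [h /setDP[hs hA] ih] := indA mat iA iss lt.
rewrite inE in hs; have hE := sE _ hs.
have yh : cocirc b s h = Zero by apply/eqP; rewrite cocirc_eq0 (chi_mem O).
have hV : h \notin used A by apply/negP=> hV; rewrite (pos h hV hA) in yh.
have SV : ridge_in A (used A).
  apply: IHm => //; last exact: used_sub.
  by rewrite -ltnS; apply: leq_trans ltW; rewrite ltnS; apply/proper_card/properP; split=> //; exists h => //; apply: sW.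
have [C [cC CS Ch Cp]] := in_hull exB SV hE hV.
have CE : supp C \subset E.
  by apply: subset_trans CS _; rewrite subUset sub1set hE used_sub.
(* The cocircuit is zero at [h] and on [A] and [Pos] on the other used vertices, where [C] is not
   [Neg]. All products therefore vanish, and [C] is zero at those vertices. *)
have zero := orth_cocirc cC CE sE sr (b := b).
have {}zero : forall e, smul (C e) (cocirc b s e) = Zero.
  apply: zero => g; have [gS|/notin_supp->//] := boolP (g \in supp C).
  have := subsetP CS _ gS; rewrite !inE => /predU1P[->|gU]; first by rewrite yh; case: (C h).
  have [gA|gA] := boolP (g \in A); first by rewrite y0 //; case: (C g).
  by rewrite (pos g gU gA); have := Cp g gU gA; case: (C g).
suff CA : supp C \subset h |: A.
  by have := circ_dep O cC CA _ ih h; rewrite Ch subUset sub1set hE AE => /(_ isT).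
apply/subsetP=> g gS; rewrite !inE; have := subsetP CS _ gS.
rewrite !inE => /predU1P[->|gU]; first by rewrite eqxx.
apply/orP; right; apply/negPn/negP => gA.
have := zero g; rewrite (pos g gU gA); move: gS; rewrite inE; by case: (C g).
Qed.
End Theory2.

(** * Facets of a triangulation *)

Section Facets.
Variable T : finType.
Implicit Types (A B H I J K : {set T}) (C : signvec T) (s : seq T) (D : {set {set T}}).
Variables (E : {set T}) (r : nat) (ind : pred {set T}).
Variables (circ : pred (signvec T)) (chi : seq T -> sign).
Hypothesis O : oriented E r ind circ chi.
Let mat := o_mat O.

Definition hyper A := [set e in E | chi (e :: enum A) == Zero].
Definition ridge A := [&& A \subset E, ind A & #|A|.+1 == r].
Definition onesided A := [forall e in E :\: hyper A, forall f in E :\: hyper A,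
  chi (e :: enum A) == chi (f :: enum A)].
(** A facet is identified with the hyperplane it spans; by [hyper_ridge] and [onesided_hyper] any
    ridge spanning it may be used to test it. *)
Definition is_facet H := [exists A, [&& ridge A, onesided A & hyper A == H]].
Definition fibre D A := [set b | (b \notin A) && (b |: A \in D)].
Definition facet_ridges D H :=
  [set A | [&& onesided A, fibre D A != set0 & hyper A == H]].

Lemma onesidedP A : reflect
  (forall e f, e \in E -> f \in E -> chi (e :: enum A) != Zero ->
     chi (f :: enum A) != Zero -> chi (e :: enum A) = chi (f :: enum A))
  (onesided A).
Proof.
apply: (iffP forall_inP) => [H e f eE fE ye yf|H e].
  have eH : e \in E :\: hyper A by rewrite !inE eE ye.
  by apply/eqP; have /forall_inP := H e eH; apply; rewrite !inE fE yf.
rewrite !inE => /andP[ye eE]; rewrite eE /= in ye.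
apply/forall_inP=> f; rewrite !inE => /andP[yf fE]; rewrite fE /= in yf.
by apply/eqP/H.
Qed.

(** The bijection between pairs (simplex, vertex) and pairs (ridge, apex). It serves in an abelian
    group for the cancellation of interior ridges, and in [nat] for a parity count. *)
Lemma sum_fibre (X : Type) (idx : X) (op : Monoid.com_law idx) D
    (F : {set T} -> T -> X) :
  \big[op/idx]_(B in D) \big[op/idx]_(b in B) F (B :\ b) b
    = \big[op/idx]_A \big[op/idx]_(b in fibre D A) F A b.
Proof.
rewrite !pair_big_dep /=.
rewrite (reindex_onto (fun p : {set T} * T => (p.2 |: p.1, p.2))
                      (fun p : {set T} * T => (p.1 :\ p.2, p.2))) /=; last first.
  by case=> B b /= /andP[_ bB]; rewrite setD1K.
apply: eq_big => [[A b]|[A b]] /=; rewrite !inE eqxx /=.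
  rewrite andbT andbC; have [bA|bA] /= := boolP (b \in A).
    by apply/negbTE; rewrite negb_and; apply/orP; left; apply/eqP=> -[e]; move: bA; rewrite -e !inE eqxx.
  by rewrite setU1K // eqxx.
by move=> /andP[_ /eqP[->]].
Qed.

Lemma ridge_sE A : ridge A -> {subset enum A <= E}.
Proof. by case/and3P=> /(subset_enum (E := E)). Qed.

Lemma ridge_size A : ridge A -> (size (enum A)).+1 = r.
Proof. by case/and3P=> _ _ /eqP; rewrite size_enum. Qed.

Lemma ridge_sub_hyper A : ridge A -> A \subset hyper A.
Proof.
move=> rA; apply/subsetP=> x xA; have xE := ridge_sE rA (x := x).
rewrite mem_enum in xE; rewrite inE xE //= (chi_mem O) ?mem_enum //.
exact: ridge_sE.
Qed.

Lemma hyper_ridge A A' : ridge A -> ridge A' -> A \subset hyper A' -> hyper A = hyper A'.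
Proof.
move=> rA rA' AA'; apply/setP=> e; rewrite !inE; have [eE|//] := boolP (e \in E).
case/and3P: (rA) => _ iA _; case/and3P: (rA') => _ iA' _.
apply: (same_hyper O (ridge_sE rA) (ridge_sE rA') (ridge_size rA) (ridge_size rA'));
  rewrite ?enum_uniq ?set_in_enum //.
by move=> x; rewrite mem_enum => /(subsetP AA'); rewrite inE => /andP[_ /eqP].
Qed.

Lemma hyper_out A e : e \in E -> (e \notin hyper A) = (chi (e :: enum A) != Zero).
Proof. by move=> eE; rewrite inE eE. Qed.

Lemma onesided_hyper A A' : ridge A -> ridge A' -> hyper A = hyper A' ->
  onesided A' -> onesided A.
Proof.
move=> rA rA' eH /onesidedP os; apply/onesidedP=> e f eE fE ye yf.
have ye' : chi (e :: enum A') != Zero by rewrite -hyper_out // -eH hyper_out.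
have yf' : chi (f :: enum A') != Zero by rewrite -hyper_out // -eH hyper_out.
apply: (same_side O (ridge_sE rA) (ridge_sE rA') (ridge_size rA) (ridge_size rA')) => //.
  move=> x; rewrite mem_enum => xA; have := subsetP (ridge_sub_hyper rA) _ xA.
  by rewrite eH inE => /andP[_ /eqP].
exact: os.
Qed.

Lemma hyper_card A I : ridge A -> I \subset hyper A -> ind I -> #|I| < r.
Proof.
move=> rA IH iI; case/and3P: (rA) => AE iA /eqP <-; rewrite ltnS.
apply: (ind_max_card mat _ iA IH iI) => x; rewrite inE => /andP[xE yx] xA.
apply: contraL yx => ix; rewrite (chi_cons_enum O) // xA ix.
by case/and3P: rA => _ _ ->.
Qed.

(** The predicate [circ] is kept, since orthogonality and fundamental circuits are only asked for
    supports in the hyperplane. A cocircuit of the hyperplane spanned by [s] is, up to sign, the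
    restriction of the cocircuit of [E] spanned by [e0 :: s]. *)
Lemma facet_oriented A e0 : ridge A -> e0 \in E -> e0 \notin hyper A ->
  oriented (hyper A) r.-1 ind circ (fun s => chi (e0 :: s)).
Proof.
move=> rA eE eH; have HE : hyper A \subset E by apply/subsetP=> x; rewrite inE => /andP[].
have rr : r = r.-1.+1 by case/and3P: rA => _ _ /eqP <-.
case/and3P: (rA) => AE iA /eqP cA.
split=> //.
- by exists A; rewrite ridge_sub_hyper // -cA.
- by move=> I IH iI; rewrite -ltnS -rr; apply: hyper_card IH iI.
- move=> s sH; have sE : {subset s <= E} by move=> x /sH /(subsetP HE).
  rewrite (chi_cons O) // {1}rr eqSS; have [sr|//] := eqVneq (size s) r.-1.
  have es : e0 \notin s by apply: contra eH => /sH.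
  rewrite es /=; have [us|_] /= := boolP (uniq s); last by [].
  have [iss|iss] := boolP (ind [set x in s]); last first.
    by apply/negbTE; apply: contra iss; apply: (indS mat); apply: subsetUr.
  have ie : ind (e0 |: A).
    by have := eH; rewrite hyper_out // (chi_cons_enum O) // => /and3P[].
  have eA : e0 \notin A by apply: contra eH; apply: subsetP (ridge_sub_hyper rA) _.
  have css : #|[set x in s]| = size s by rewrite cardsE (card_uniqP us).
  (* The exchange has to add [e0]: any other element is in [hyper A] and would give [r] independent
     elements there. *)
  have [|x] := indA mat iss ie; first by rewrite cardsU1 eA css sr add1n cA {2}rr.
  rewrite !inE => /andP[xs /predU1P[->|xA]] ix; first by rewrite ix.
  have : x |: [set x in s] \subset hyper A.
    rewrite subUset sub1set (subsetP (ridge_sub_hyper rA)) //=.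
    by apply/subsetP=> y; rewrite inE => /sH.
  by move/(hyper_card rA)/(_ ix); rewrite cardsU1 inE xs css sr add1n -rr ltnn.
- by have := @alternating_cons _ _ sopp chi e0 (o_alt O).
- exact: (o_opp O).
- move=> C s cC CH sH sr nn e; have sE : {subset e0 :: s <= E}.
    by move=> x; rewrite inE => /predU1P[->|/sH/(subsetP HE)].
  have eq g : cocirc chi true (e0 :: s) g = chi (e0 :: g :: s).
    by rewrite /cocirc (o_alt O [::] g e0 s) soppK.
  rewrite -eq; apply: (orth_cocirc O cC) => //=; first exact: subset_trans CH HE.
    by rewrite sr -rr.
  by move=> g; rewrite -/(cocirc chi true (e0 :: s) g) eq.
- move=> I h IH hH; apply: (o_circ O); first exact: subset_trans IH HE.
  exact: (subsetP HE).
Qed.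

(** * The triangulation induced on a facet *)

Section Triangulation.
Variable D : {set {set T}}.
Hypothesis tD : triang E r ind circ chi D.

Lemma fibreP A b : reflect (b \notin A /\ b |: A \in D) (b \in fibre D A).
Proof. by rewrite inE; apply: andP. Qed.

Lemma fibre_opp A b b' : b \in fibre D A -> b' \in fibre D A -> b != b' ->
  chi (b :: enum A) = sopp (chi (b' :: enum A)).
Proof. by move=> /fibreP[bA bD] /fibreP[b'A b'D] bb'; apply: (ridge_opp O tD). Qed.

Lemma fibre_ridge A b : b \in fibre D A -> ridge A.
Proof.
case/fibreP=> bA /(t_base tD)[]; rewrite subUset => /andP[_ AE] ib cb.
apply/and3P; split=> //; first by apply: (indS mat) ib; apply: subsetUr.
by rewrite -cb cardsU1 bA.
Qed.

Lemma fibre_chi A b : b \in fibre D A -> b \in E /\ chi (b :: enum A) != Zero.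
Proof.
move=> bF; have /and3P[AE _ rA] := fibre_ridge bF.
case/fibreP: bF => bA /(t_base tD)[]; rewrite subUset sub1set => /andP[bE _] ib cb.
by rewrite (chi_cons_enum O) // rA bA.
Qed.

(** Two simplices on a ridge are on opposite sides of it, so a boundary ridge has only one;
    conversely a ridge of a single simplex has no neighbour, and [t_ridge] puts it in the
    boundary. *)
Lemma fibre_onesided A b : b \in fibre D A -> onesided A = (fibre D A == [set b]).
Proof.
move=> bF; have [bE yb] := fibre_chi bF; apply/idP/eqP.
  move=> /onesidedP os; apply/setP=> c; rewrite in_set1.
  apply/idP/eqP=> [cF|->//]; apply/eqP/negPn/negP => cb.
  have [cE yc] := fibre_chi cF; have := os b c bE cE yb yc.
  rewrite (fibre_opp cF bF cb) in yc *.
  by move: yb; case: (chi _).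
move=> F1; have /fibreP[bA bD] := bF; apply/onesidedP=> e f eE fE ye yf.
have [|H|[c [cB cb cD]]] := t_ridge tD (b := b) bD; first exact: setU11.
  by rewrite setU1K // in H; rewrite (H e eE ye) (H f fE yf).
rewrite setU1K // in cD; move: cB; rewrite !inE negb_or => /andP[_ cA].
have : c \in fibre D A by apply/fibreP.
by rewrite F1 in_set1 (negPf cb).
Qed.

(** Distinct apices have opposite signs, which leaves no room for a third one. *)
Lemma fibre_two A b : b \in fibre D A -> ~~ onesided A ->
  exists c, [/\ c != b, chi (c :: enum A) = sopp (chi (b :: enum A))
              & fibre D A = [set b; c]].
Proof.
move=> bF; rewrite (fibre_onesided bF) => nF.
have [c cF cb] : exists2 c, c \in fibre D A & c != b.
  case: (set_0Vmem (fibre D A :\ b)) => [e0|[c]]; last by rewrite !inE => /andP[cb cF]; exists c => //; rewrite inE.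
  by move: nF; rewrite -(setD1K bF) e0 setU0 eqxx.
exists c; split=> //; first exact: fibre_opp.
apply/setP=> d; rewrite in_set2; apply/idP/orP=> [dF|[]/eqP->//].
have [->|db] := eqVneq d b; first by left.
right; apply/eqP/eqP/negPn/negP => dc.
have [_ yb] := fibre_chi bF.
have := fibre_opp dF bF db; rewrite (fibre_opp dF cF dc) (fibre_opp cF bF cb).
by move: yb; case: (chi _).
Qed.

Lemma facet_ridgesP A H : reflect
  (exists b, [/\ b \in fibre D A, ridge A, onesided A & hyper A = H])
  (A \in facet_ridges D H).
Proof.
rewrite inE; apply: (iffP and3P) => [[os /set0Pn[b bF] /eqP eH]|[b [bF rA os eH]]].
  by exists b; split=> //; apply: fibre_ridge bF.
by split=> //; [apply/set0Pn; exists b | rewrite eH].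
Qed.

(** The number of boundary ridges containing a given codimension two face is even,
    since each simplex containing that face has exactly two ridges doing so. *)
Lemma next_boundary_ridge A c : c \in A -> fibre D A != set0 -> onesided A ->
  exists2 A', A' != A & [/\ A :\ c \subset A', fibre D A' != set0 & onesided A'].
Proof.
move=> cA /set0Pn[b0 b0F] osA.
have rA := fibre_ridge b0F; have /and3P[AE iA /eqP cAr] := rA.
suff /existsP[A' /and4P[A'A SA' nF osA']] : [exists A' : {set T},
    [&& A' != A, A :\ c \subset A', fibre D A' != set0 & onesided A']].
  by exists A'.
apply: contraT; rewrite negb_exists => /forallP none.
pose S := A :\ c; have cS : #|S|.+2 = r by rewrite -cAr (cardsD1 c A) cA.
(* Pairs of a simplex and a ridge of it containing [S] are counted twice: by simplices the number is
   even, while by ridges it is [1] for [A] plus an even number if no other boundary ridge contains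
   [S]. *)
have := @sum_fibre _ _ addn D (fun A' _ => nat_of_bool (S \subset A')).
rewrite [RHS](bigD1 A) //=.
have -> : \sum_(b in fibre D A) (S \subset A) = 1.
  move: osA; rewrite (fibre_onesided b0F) => /eqP->.
  by rewrite big_set1 /S subD1set.
move/(congr1 odd); rewrite oddD /=.
suff ev (I : finType) (P : pred I) (F : I -> nat) :
    (forall i, P i -> ~~ odd (F i)) -> ~~ odd (\sum_(i | P i) F i).
  rewrite (negPf (ev _ _ _ _)) => [|B BD].
    rewrite (negPf (ev _ _ _ _)) // => A' A'A.
    have [SA'|] := boolP (S \subset A'); last by rewrite big1.
    rewrite sum1_card; have [->|/set0Pn[b bF]] := eqVneq (fibre D A') set0.
      by rewrite cards0.
    have := none A'; rewrite A'A SA' /=.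
    case: (eqVneq (fibre D A') set0) => [e|_ /=]; first by rewrite e inE in bF.
    move=> nos; have [d [db _ ->]] := fibre_two bF nos.
    by rewrite cards2 eq_sym db.
  have [BE iB cB] := t_base tD BD.
  have [SB|SB] := boolP (S \subset B); last first.
    rewrite big1 // => b _; apply/eqP; rewrite eqb0.
    by apply: contra SB => SB; apply: subset_trans SB _; apply: subsetDl.
  rewrite (bigID (mem S)) /= big1 ?add0n => [|b /andP[bB bS]]; last first.
    by apply/eqP; rewrite eqb0; apply/negP=> /subsetP/(_ _ bS); rewrite !inE eqxx.
  rewrite (eq_bigr (fun _ => 1)) => [|b /andP[bB bS]]; last first.
    by rewrite subsetD1 SB bS.
  rewrite sum1dep_card.
  have -> : [set b | (b \in B) && (b \notin S)] = B :\: S.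
    by apply/setP=> x; rewrite !inE andbC.
  by have := cardsD B S; rewrite (setIidPr SB) cB -cS => ->; rewrite -addn2 addnC addnK.
move=> evF; apply: (big_ind (fun n => ~~ odd n)) => // m n mo no.
by rewrite oddD (negPf mo).
Qed.

(** Nonemptiness is [all_ridge_in] for the empty face. For the ridge [A :\ c] of [A] the parity
    count provides a second boundary ridge [A'] of [D] through it: if [A'] spans the same facet it
    is the neighbour, otherwise the hyperplane of [A'] cuts the facet along [A :\ c] and shows that
    this ridge is in its boundary. *)
Lemma facet_triang A0 e0 : ridge A0 -> onesided A0 -> e0 \in E -> e0 \notin hyper A0 ->
  triang (hyper A0) r.-1 ind circ (fun s => chi (e0 :: s)) (facet_ridges D (hyper A0)).
Proof.
move=> r0 os0 eE eH; split.
- have /and3P[A0E iA0 /eqP cA0] := r0.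
  have sE := ridge_sE r0; have sr := ridge_size r0.
  (* The sign is chosen so that the one-sided cocircuit has no negative value, as [ridge_in]
     demands. *)
  have [b Hb] : exists b, cocirc chi b (enum A0) e0 = Pos.
    rewrite hyper_out // in eH; rewrite /cocirc.
    by case: (chi _) eH => // _; [exists true | exists false].
  have DE : exists2 B, B \in D & set0 \subset B.
    by have /set0Pn[B BD] := t_ne tD; exists B => //; apply: sub0set.
  have ri := all_ridge_in O tD DE (used_sub tD set0) (subxx E).
  have [||||B [BD _ [x xB Bx]]] := ri b (enum A0) sE sr.
  + by rewrite set_in_enum.
  + exact: enum_uniq.
  + by move=> v; rewrite inE.
  + move=> v vE; have [->//|yv] := eqVneq (cocirc chi b (enum A0) v) Zero.
    have /onesidedP := os0 => /(_ v e0 vE eE).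
    rewrite cocirc_eq0 -hyper_out // in yv; rewrite -!hyper_out // eH => /(_ yv isT).
    by move: Hb; rewrite /cocirc => + ->; case: (b); case: (chi _).
  apply/set0Pn; exists (B :\ x).
  have xF : x \in fibre D (B :\ x) by rewrite inE setD1K // !inE eqxx.
  have rB := fibre_ridge xF.
  have eqH : hyper (B :\ x) = hyper A0.
    apply: hyper_ridge => //; apply/subsetP=> v vB; rewrite inE.
    have /and3P[/subsetP BE _ _] := rB.
    by rewrite BE // -(cocirc_eq0 chi b) Bx.
  by apply/facet_ridgesP; exists x; split=> //; apply: onesided_hyper os0.
- move=> A /facet_ridgesP[b [bF rA os eqH]]; rewrite -eqH.
  by have /and3P[AE iA /eqP <-] := rA; rewrite ridge_sub_hyper.
- move=> A A' C /facet_ridgesP[b [/fibreP[_ bD] _ _ _]].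
  move=> /facet_ridgesP[b' [/fibreP[_ b'D] _ _ _]] cC CA CA'.
  by apply: (t_disj tD bD b'D cC); apply: subset_trans (subsetUr _ _).
move=> A c /facet_ridgesP[b [bF rA os eqH]] cA.
have nF : fibre D A != set0 by apply/set0Pn; exists b.
have [A' A'A [SA' /set0Pn[b' b'F] os']] := next_boundary_ridge cA nF os.
have rA' := fibre_ridge b'F.
have /and3P[AE iA /eqP cAr] := rA; have /and3P[A'E iA' /eqP cAr'] := rA'.
have cE := subsetP AE _ cA.
have cAA : #|A'| = #|A| by apply: succn_inj; rewrite cAr'.
have [c' c'A' c'S] : exists2 c', c' \in A' & c' \notin A :\ c.
  apply/subsetPn; apply/negP=> /subset_leq_card.
  by rewrite cAA [X in X <= _](cardsD1 c A) cA ltnn.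
have A'e : A' = c' |: (A :\ c).
  apply/esym/eqP; rewrite eqEcard subUset sub1set c'A' SA' cardsU1 c'S cAA.
  by rewrite /= [X in X <= _](cardsD1 c A) cA.
have c'E := subsetP A'E _ c'A'.
have c'c : c' != c by apply: contraNneq A'A => e; rewrite A'e e setD1K.
have c'A : c' \notin A by move: c'S; rewrite !inE negb_and c'c.
have [eqH'|neH] := eqVneq (hyper A') (hyper A0).
  by right; exists c'; split=> //; rewrite -A'e; apply/facet_ridgesP; exists b'.
left=> e eHA; have eE' : e \in E by move: eHA; rewrite inE => /andP[].
have cS : c \notin A :\ c by rewrite !inE eqxx.
have SE : A :\ c \subset E by apply: subset_trans AE; apply: subsetDl.
have szS : (size (enum (A :\ c))).+2 = r.
  by rewrite size_enum -cAr (cardsD1 c A) cA.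
have c'H : c' \notin hyper A0.
  apply: contra neH => c'H; apply/eqP; rewrite -eqH; apply: hyper_ridge => //.
  rewrite A'e subUset sub1set eqH c'H -eqH.
  by apply: subset_trans (ridge_sub_hyper rA); apply: subsetDl.
have cH' : c \notin hyper A'.
  apply: contra neH => cH'; rewrite -eqH; apply/eqP/esym/hyper_ridge => //.
  rewrite -(setD1K cA) subUset sub1set cH'.
  by apply: subset_trans (ridge_sub_hyper rA').
have front x y : x \in E -> y \in E -> x \notin A :\ c ->
  (chi (y :: x :: enum (A :\ c)) == Zero) = (chi (y :: enum (x |: A :\ c)) == Zero).
  move=> xE yE xS; apply: (alternating_eq0 (o_alt O)).
  by rewrite perm_cons perm_sym perm_enumU1.
move=> ye; have eS : e \notin A :\ c.
  apply: contra ye => eS; rewrite (o_alt O [::] e0 e) sopp_eq0 /=.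
  rewrite (chi_mem O) ?inE ?mem_enum ?eS ?orbT //.
  by move=> z; rewrite inE mem_enum => /predU1P[->|/(subsetP SE)].
have rE : ridge (e |: A :\ c).
  move: ye; rewrite front // (chi_cons_enum O) //; last by rewrite subUset sub1set eE'.
  case/and3P=> cr _ ie; rewrite /ridge subUset sub1set eE' SE cr /= andbT.
  by apply: (indS mat) ie; apply: subsetUr.
have rC : ridge (c |: A :\ c) by rewrite setD1K.
have Hx x : x \in hyper A0 -> ridge (x |: A :\ c) ->
    hyper (x |: A :\ c) = hyper A0 /\ onesided (x |: A :\ c).
  move=> xH rx; have eqx : hyper (x |: A :\ c) = hyper A0.
    apply: hyper_ridge => //; rewrite subUset sub1set xH -eqH.
    by apply: subset_trans (ridge_sub_hyper rA); apply: subsetDl.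
  by split=> //; apply: onesided_hyper os0.
(* Both [e0] and [c'] are off the facet, hence on the same side of it, so that [c'] may replace [e0]
   in the chirotope. *)
have swap x : x \in E -> x \notin A :\ c -> x \in hyper A0 -> ridge (x |: A :\ c) ->
    chi (e0 :: x :: enum (A :\ c)) = chi (c' :: x :: enum (A :\ c)).
  move=> xE xS xH rx; have [eqx /onesidedP osx] := Hx x xH rx.
  have [d Hd] := alternating_perm (perm_enumU1 xS).
  have Hd' z : chi (z :: enum (x |: A :\ c))
      = if d then sopp (chi (z :: x :: enum (A :\ c))) else chi (z :: x :: enum (A :\ c)).
    exact: (Hd _ _ _ soppK (o_alt O) [:: z]).
  have := osx e0 c' eE c'E; rewrite -!hyper_out // eqx => /(_ eH c'H).
  by rewrite !Hd'; case: (d) => // /(congr1 sopp); rewrite !soppK.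
have cHA : c \in hyper A0 by rewrite -eqH (subsetP (ridge_sub_hyper rA)).
(* Now [c'] and [A :\ c] combine to [A'], and it remains to see that [e] and [c] are on the same
   side of the one-sided ridge [A']. *)
rewrite !swap //; have [d Hd] := alternating_perm (perm_enumU1 c'S).
have Hd' z : chi (z :: enum A')
    = if d then sopp (chi (z :: c' :: enum (A :\ c))) else chi (z :: c' :: enum (A :\ c)).
  by rewrite A'e; apply: (Hd _ _ _ soppK (o_alt O) [:: z]).
have osw z : chi (c' :: z :: enum (A :\ c)) = sopp (chi (z :: c' :: enum (A :\ c))).
  exact: (o_alt O [::]).
have /onesidedP/(_ e c eE' cE) := os'.
rewrite -!hyper_out // cH'.
have -> : e \notin hyper A'.
  rewrite hyper_out // Hd'; have := ye; rewrite swap // osw.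
  by case: (d); rewrite !sopp_eq0.
move=> /(_ isT isT); rewrite !Hd' !osw.
by case: (d) => // ->.
Qed.

End Triangulation.
End Facets.

(** * Volumes *)

Section Volume.
Variables (T : finType) (W : zmodType).
Implicit Types (A B H : {set T}) (s : seq T) (D : {set {set T}}) (e : seq T -> W).
Local Open Scope ring_scope.

(** The properties of the products [e_s] in degree [r] of the Orlik-Solomon algebra;
    they pass from [e] to [e_p /\ _], in degree [r - 1] on a hyperplane. *)
Record os_like (E : {set T}) (r : nat) (ind : pred {set T}) e : Prop := OsLike {
  os_alt : alternating (@GRing.opp W) e;
  os_dep : forall s, {subset s <= E} -> size s = r ->
    ~~ (uniq s && ind [set x in s]) -> e s = 0;
  os_rel : forall s, {subset s <= E} -> size s = r.+1 -> delete_sum e s = 0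
}.

Definition volume (chi : seq T -> sign) D e : W :=
  \sum_(B in D) sact (chi (enum B)) (e (enum B)).

Lemma eq_volume chi chi' D e : (forall B, B \in D -> chi (enum B) = chi' (enum B)) ->
  volume chi D e = volume chi' D e.
Proof. by move=> eq; apply: eq_bigr => B BD; rewrite eq. Qed.

Definition cone p e s : W := e (p :: s).

Section Step.
Variables (E : {set T}) (r : nat) (ind : pred {set T}).
Variables (circ : pred (signvec T)) (chi : seq T -> sign) (e : seq T -> W).
Hypotheses (O : oriented E r ind circ chi) (OS : os_like E r ind e).

(** In the relation for [p :: s] the term [e s] is zero, because [r] elements of a hyperplane are
    dependent; what is left is the relation for [cone p e]. *)
Lemma os_like_hyper A p : ridge E r ind A -> p \in E ->
  os_like (hyper E chi A) r.-1 ind (cone p e).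
Proof.
move=> rA pE; have HE : hyper E chi A \subset E by apply/subsetP=> x; rewrite inE => /andP[].
have rr : r = r.-1.+1 by case/and3P: rA => _ _ /eqP <-.
have psE s : {subset s <= hyper E chi A} -> {subset p :: s <= E}.
  by move=> sH x; rewrite inE => /predU1P[->|/sH/(subsetP HE)].
split.
- by have := @alternating_cons _ _ -%R e p (os_alt OS).
- move=> s sH sr nds; apply: (os_dep OS); [exact: psE | by rewrite /= sr -rr |].
  apply: contra nds => /= /andP[/andP[_ ->] ips] /=.
  by apply: (indS (o_mat O)) ips; apply/subsetP=> x; rewrite !inE => ->; rewrite orbT.
move=> s sH sr; have := os_rel OS (psE s sH); rewrite /= sr -rr => /(_ erefl).
rewrite (os_dep OS) ?sub0r; first by move/eqP; rewrite oppr_eq0 => /eqP.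
- by move=> x /sH /(subsetP HE).
- by rewrite sr -rr.
apply/negP=> /andP[us iss].
have sA : [set x in s] \subset hyper E chi A by apply/subsetP=> x; rewrite inE => /sH.
by have := hyper_card O rA sA iss; rewrite cardsE (card_uniqP us) sr -rr ltnn.
Qed.

(** The orientation of a facet is read off at an element [e0 H] outside it, so the choice is part of
    the conclusion. Facets through [p] occur in the sum with terms equal to zero. *)
Lemma volume_cone D p : triang E r ind circ chi D -> p \in E ->
  exists e0 : {set T} -> T,
    (forall H, is_facet E r ind chi H -> e0 H \in E :\: H) /\
    volume chi D e = \sum_(H | is_facet E r ind chi H)
      volume (fun s => chi (e0 H :: s)) (facet_ridges E chi D H) (cone p e).
Proof.
(* The default [p] is not reached for a facet: a hyperplane cannot contain a base. *)
move=> tD pE; pose e0 H := odflt p [pick x in E :\: H].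
have e0P H : is_facet E r ind chi H -> e0 H \in E :\: H.
  case/existsP=> A /and3P[rA _ /eqP <-]; rewrite /e0; case: pickP => //= none.
  have [B [BE iB cB]] := o_base O.
  suff BH : B \subset hyper E chi A by have := hyper_card O rA BH iB; rewrite cB ltnn.
  apply/subsetP=> x xB; have := none x.
  by rewrite in_setD (subsetP BE) // andbT => /negbFE.
exists e0; split=> //.
have -> : volume chi D e
    = \sum_(B in D) \sum_(b in B) sact (chi (b :: enum (B :\ b))) (cone p e (enum (B :\ b))).
  apply: eq_bigr => B BD; have [BE iB cB] := t_base tD BD.
  have pBE : {subset p :: enum B <= E}.
    by move=> x; rewrite inE mem_enum => /predU1P[->|/(subsetP BE)].
  have := os_rel OS pBE; rewrite /= size_enum cB => /(_ erefl) /eqP.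
  rewrite subr_eq0 => /eqP ->.
  rewrite sact_delete_sum ?enum_uniq //; last exact: (o_alt O).
  by rewrite big_enum; apply: eq_bigr => b _; rewrite rem_enum.
rewrite (sum_fibre _ D (fun A b => sact (chi (b :: enum A)) (cone p e (enum A)))) /=.
(* A set failing this condition has no apex or is an interior ridge, whose two apices have opposite
   signs and cancel. The other ridges are grouped by the facet they span. *)
rewrite (bigID (fun A => onesided E chi A && (fibre D A != set0))) /=.
rewrite addrC big1 ?add0r => [|A nA]; last first.
  have [->|/set0Pn[b bF]] := eqVneq (fibre D A) set0; first by rewrite big_set0.
  have [|c [cb cbo ->]] := fibre_two O tD bF.
    by apply: contra nA => ->; apply/set0Pn; exists b.
  by rewrite big_setU1 ?inE 1?eq_sym // big_set1 cbo sact_sopp /= addrN.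
rewrite (partition_big (hyper E chi) (is_facet E r ind chi)) => [|A /andP[os /set0Pn[b bF]]].
  apply: eq_bigr => H fH; apply: eq_big => [A|A /andP[/andP[os /set0Pn[b bF]] /eqP eH]].
    by rewrite inE andbA.
  have := e0P H fH; rewrite -eH inE => /andP[e0H e0E].
  have := os; rewrite (fibre_onesided O tD bF) => /eqP ->; rewrite big_set1.
  have [bE yb] := fibre_chi O tD bF; rewrite hyper_out // in e0H.
  by move/onesidedP: os => /(_ _ _ e0E bE e0H yb) ->.
by apply/existsP; exists A; rewrite (fibre_ridge O tD bF) os eqxx.
Qed.

(** Each boundary ridge lies with [p] in one hyperplane, so all coned products are zero by
    [os_dep]. *)
Lemma volume_eq0 D p : triang E r ind circ chi D -> p \in E ->
  (forall H, is_facet E r ind chi H -> p \in H) -> volume chi D e = 0.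
Proof.
move=> tD pE pH; have [e0 [_ ->]] := volume_cone tD pE.
apply: big1 => H fH; apply: big1 => A /(facet_ridgesP O tD) [b [bF rA os eH]].
rewrite /cone (os_dep OS) ?sact0 //.
- by move=> x; rewrite inE => /predU1P[->//|/(ridge_sE rA)].
- exact: (ridge_size rA).
have := pH H fH; rewrite -eH inE pE /= => /eqP y0.
have := o_chi O (s := p :: enum A); rewrite y0 /= (ridge_size rA) !eqxx /= => <- //.
by move=> x; rewrite inE => /predU1P[->//|/(ridge_sE rA)].
Qed.
End Step.

Theorem volume_indep (E : {set T}) r (ind : pred {set T}) circ chi e D D' :
  oriented E r ind circ chi -> os_like E r ind e ->
  triang E r ind circ chi D -> triang E r ind circ chi D' ->
  volume chi D e = volume chi D' e.
Proof.
elim: r E chi e D D' => [|r IH] E chi e D D' O OS tD tD'.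
  suff uniqD D0 : triang E 0 ind circ chi D0 -> D0 = [set set0].
    by rewrite (uniqD _ tD) (uniqD _ tD').
  move=> tD0; have [/set0Pn[B BD] tB _ _] := tD0.
  apply/eqP; rewrite eqEsubset sub1set; apply/andP; split.
    by apply/subsetP=> C /tB[_ _ /cards0_eq->]; rewrite inE.
  by have [_ _ /cards0_eq e0] := tB B BD; rewrite -e0.
have [B [BE _ cB]] := o_base O.
have [p pB] : exists p, p \in B by apply/set0Pn; rewrite -card_gt0 cB.
have pE := subsetP BE _ pB.
have [e0 [e0P ->]] := volume_cone O OS tD pE.
have [e1 [e1P ->]] := volume_cone O OS tD' pE.
apply: eq_bigr => H /existsP[A /and3P[rA osA /eqP eH]].
have fH : is_facet E r.+1 ind chi H by apply/existsP; exists A; rewrite rA osA eH eqxx.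
have := e0P H fH; have := e1P H fH; rewrite -eH !in_setD => /andP[n1 E1] /andP[n0 E0].
(* The two triangulations come with their own elements [e0 H] and [e1 H] off the facet; its
   cocircuit has the same sign at both. *)
have eq01 : volume (fun s => chi (e1 (hyper E chi A) :: s))
    (facet_ridges E chi D' (hyper E chi A)) (cone p e)
  = volume (fun s => chi (e0 (hyper E chi A) :: s))
    (facet_ridges E chi D' (hyper E chi A)) (cone p e).
  apply: eq_bigr => A' /(facet_ridgesP O tD') [b [bF rA' os' eH']]; congr sact.
  by move/onesidedP: os' => /(_ _ _ E1 E0); rewrite -(hyper_out chi A' E1) -(hyper_out chi A' E0) eH' => /(_ n1 n0) ->.
rewrite eq01; apply: IH.
- exact: (facet_oriented O rA).
- exact: (os_like_hyper O OS rA).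
- exact: (facet_triang O tD rA).
- exact: (facet_triang O tD' rA).
Qed.
End Volume.

(** * The exterior algebra *)

Section Exterior.
Variables (R : comPzRingType) (X : finType).
Implicit Types (S U V : {set X}) (u v : ext R X) (x y : X) (s : seq X).
Local Open Scope ring_scope.

Lemma wedgeBl u v w : wedge (u - v) w = wedge u w - wedge v w.
Proof.
apply/ffunP=> S; rewrite !ffunE -sumrB; apply: eq_bigr => U _.
by rewrite !ffunE mulrBr mulrBl.
Qed.

Lemma wedgeBr u v w : wedge u (v - w) = wedge u v - wedge u w.
Proof.
apply/ffunP=> S; rewrite !ffunE -sumrB; apply: eq_bigr => U _.
by rewrite !ffunE mulrBr.
Qed.

Lemma wedgeZl c u v : wedge (c *: u) v = c *: wedge u v.
Proof.
apply/ffunP=> S; rewrite !ffunE scaler_sumr; apply: eq_bigr => U _.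
by rewrite !ffunE /GRing.scale /= mulrCA !mulrA.
Qed.

Lemma wedgeZr c u v : wedge u (c *: v) = c *: wedge u v.
Proof.
apply/ffunP=> S; rewrite !ffunE scaler_sumr; apply: eq_bigr => U _.
by rewrite !ffunE /GRing.scale /= mulrCA.
Qed.

Lemma wedge0l v : wedge 0 v = 0.
Proof. by have := wedgeBl 0 0 v; rewrite !subrr. Qed.

Lemma wedge0r v : wedge v 0 = 0.
Proof. by have := wedgeBr v 0 0; rewrite !subrr. Qed.

Lemma wedgeNr u v : wedge u (- v) = - wedge u v.
Proof. by rewrite -sub0r wedgeBr wedge0r sub0r. Qed.

Lemma wedgeNl u v : wedge (- u) v = - wedge u v.
Proof. by rewrite -sub0r wedgeBl wedge0l sub0r. Qed.

Lemma wedgeDl u v w : wedge (u + v) w = wedge u w + wedge v w.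
Proof. by rewrite -[v in LHS]opprK wedgeBl wedgeNl opprK. Qed.

Lemma wedgeDr u v w : wedge u (v + w) = wedge u v + wedge u w.
Proof. by rewrite -[w in LHS]opprK wedgeBr wedgeNr opprK. Qed.

Lemma wedge_mono U v S : wedge (mono R U) v S
  = if U \subset S then (-1) ^+ inversions U (S :\: U) * (v (S :\: U) : R) else 0.
Proof.
rewrite ffunE; case: ifPn => US.
  rewrite (bigD1 U) //= ffunE eqxx mulr1 big1 ?addr0 // => V /andP[_ VU].
  by rewrite ffunE (negPf VU) mulr0 mul0r.
apply: big1 => V VS; rewrite ffunE; case: eqVneq => [e|_]; last by rewrite mulr0 mul0r.
by rewrite -e VS in US.
Qed.

Lemma wedge_mono_r U v S : wedge v (mono R U) S
  = if U \subset S then (-1) ^+ inversions (S :\: U) U * (v (S :\: U) : R) else 0.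
Proof.
rewrite ffunE; case: ifPn => US.
  have SU : S :\: (S :\: U) = U by rewrite setDDr setDv set0U; apply/setIidPr.
  rewrite (bigD1 (S :\: U)) ?subsetDl //= ffunE SU eqxx mulr1.
  rewrite big1 ?addr0 // => V /andP[VS VU]; rewrite ffunE.
  case: eqVneq => [e|_]; last by rewrite mulr0.
  by move: VU; rewrite -e setDDr setDv set0U (setIidPr VS) eqxx.
apply: big1 => V VS; rewrite ffunE; case: eqVneq => [e|_]; last by rewrite mulr0.
by rewrite -e subsetDl in US.
Qed.

Lemma ext_sum_mono u : u = \sum_S u S *: mono R S.
Proof.
apply/ffunP=> S; rewrite sum_ffunE (bigD1 S) //= !ffunE eqxx big1 => [|V VS].
  by rewrite addr0 /GRing.scale /= mulr1.
by rewrite !ffunE eq_sym (negPf VS) /GRing.scale /= mulr0.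
Qed.

Definition below x S : nat := #|[set y in S | xlt y x]|.

Lemma inversions1 x V : inversions [set x] V = below x V.
Proof.
rewrite /inversions /below -(card_imset _ (_ : injective (fun y : X => (x, y)))); last first.
  by move=> y z [].
congr #|pred_of_set _|; apply/setP=> -[a b]; rewrite !inE; apply/idP/imsetP => /=.
  by case/and3P=> /eqP-> bV ba; exists b => //; rewrite inE bV.
by case=> y; rewrite inE => /andP[yV yx] [-> ->]; rewrite eqxx yV yx.
Qed.

Lemma xlt_total x y : x != y -> xlt x y = ~~ xlt y x.
Proof.
move=> xy; rewrite /xlt -leqNgt ltn_neqAle; case: eqP => //= e.
by case/eqP: xy; apply: enum_rank_inj; apply: val_inj.
Qed.

Lemma xlt_irr x : xlt x x = false. Proof. exact: ltnn. Qed.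

Lemma below_D1 x y S : x \in S -> below y S = (xlt x y + below y (S :\ x))%N.
Proof.
move=> xS; rewrite /below (cardsD1 x) inE xS /=; congr (_ + _)%N.
by congr #|pred_of_set _|; apply/setP=> z; rewrite !inE andbA.
Qed.

Definition lmul x u : ext R X := wedge (mono R [set x]) u.

Lemma lmulE x u S :
  lmul x u S = if x \in S then (-1) ^+ below x S * (u (S :\ x) : R) else 0.
Proof.
rewrite wedge_mono sub1set; case: ifP => // xS.
by rewrite inversions1 (below_D1 x xS) xlt_irr.
Qed.

Lemma lmul_anti x y u : lmul x (lmul y u) = - lmul y (lmul x u).
Proof.
apply/ffunP=> S; rewrite [RHS]ffunE !lmulE !inE.
have [<-|xy] /= := eqVneq x y; first by case: ifP; rewrite ?mulr0 oppr0.
case xS: (x \in S); case yS: (y \in S); rewrite ?mulr0 ?oppr0 //=.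
have -> : S :\ x :\ y = S :\ y :\ x by apply/setP=> z; rewrite !inE andbCA.
rewrite (below_D1 x yS) (below_D1 y xS) (xlt_total xy) !exprD.
case: (xlt y x); rewrite ?expr0 ?expr1 ?mul1r ?mulN1r.
  by rewrite mulNr mulrCA.
by rewrite mulNr opprK mulrCA.
Qed.

Lemma lmul_sq x u : lmul x (lmul x u) = 0.
Proof. by apply/ffunP=> S; rewrite !lmulE !inE eqxx mulr0 ffunE; case: ifP. Qed.

Lemma lmul_mono x U : (forall y, y \in U -> xlt x y) ->
  lmul x (mono R U) = mono R (x |: U).
Proof.
move=> xU; have nxU : x \notin U by apply/negP=> /xU; rewrite xlt_irr.
apply/ffunP=> S; rewrite lmulE !ffunE; case: ifPn => xS; last first.
  by case: eqVneq => // e; rewrite e setU11 in xS.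
have -> : (S :\ x == U) = (S == x |: U).
  by apply/eqP/eqP=> [<-|->]; rewrite ?setD1K ?setU1K.
case: eqVneq => [->|]; last by rewrite mulr0.
suff -> : below x (x |: U) = 0%N by rewrite mul1r.
rewrite /below; apply/eqP; rewrite cards_eq0; apply/eqP/setP=> y; rewrite !inE.
apply/negbTE; rewrite negb_and negb_or; have [->|yx] := eqVneq y x; first by rewrite xlt_irr orbT.
by case yU: (y \in U) => //=; rewrite -xlt_total ?xU // eq_sym.
Qed.

(** The case of associativity in which the new index is the least; it reduces products with a
    monomial to iterated [lmul]. The inversions of [x |: U] split into those of [x] and those of
    [U], and [x] forms none with [U]. *)
Lemma wedge_mono_cons x U v : (forall y, y \in U -> xlt x y) ->
  wedge (mono R (x |: U)) v = lmul x (wedge (mono R U) v).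
Proof.
move=> xU; have nxU : x \notin U by apply/negP=> /xU; rewrite xlt_irr.
apply/ffunP=> S; rewrite lmulE !wedge_mono subUset sub1set subsetD1 nxU andbT.
case xS: (x \in S) => //=; case US: (U \subset S); last by rewrite mulr0.
have -> : S :\ x :\: U = S :\: (x |: U) by apply/setP=> z; rewrite !inE negb_or -andbA andbCA.
rewrite mulrA -exprD; congr (_ ^+ _ * _).
have -> : below x S = below x (S :\: (x |: U)).
  congr #|pred_of_set _|; apply/setP=> z; rewrite !inE.
  have [->|zx] := eqVneq z x; first by rewrite xlt_irr !andbF.
  by case zU: (z \in U) => //=; rewrite xlt_total // xU //= andbF.
rewrite -inversions1 /inversions -cardsUI addnC.
rewrite (_ : _ :&: _ = set0) ?cards0 ?add0n; last first.
  apply/setP=> -[a b]; rewrite !inE /=; apply/negbTE/negP.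
  by case/andP=> /and3P[/eqP-> _ _] /and3P[aU]; rewrite aU in nxU.
by congr #|pred_of_set _|; apply/setP=> -[a b]; rewrite !inE andb_orl.
Qed.

Lemma enum_sorted S : sorted (@xlt X) (enum S).
Proof.
apply: sorted_filter; first by move=> y x z; apply: ltn_trans.
rewrite -enumT; case E: (enum X) => [//|x0 s0]; rewrite -{s0}E.
apply/(sortedP x0) => i; rewrite -cardE => lti.
have lti' := ltnW lti.
have rk j (ltj : (j < #|X|)%N) : enum_rank (nth x0 (enum X) j) = j :> nat.
  by rewrite -(enum_val_nth x0 (Ordinal ltj)) enum_valK.
by rewrite /xlt !rk.
Qed.
End Exterior.

Section MorphB.
Variables (U V : zmodType) (f : U -> V).
Hypothesis fB : {morph f : u v / (u - v)%R}.
Local Open Scope ring_scope.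

Lemma morphB0 : f 0 = 0.
Proof. by have := fB 0 0; rewrite !subrr. Qed.

Lemma morphBN : {morph f : u / - u}.
Proof. by move=> u; rewrite -[- u]sub0r fB morphB0 sub0r. Qed.

Lemma morphBD : {morph f : u v / u + v}.
Proof. by move=> u v; rewrite -[v in LHS]opprK fB morphBN opprK. Qed.

Lemma morphB_sum (I : finType) (P : pred I) (F : I -> U) :
  f (\sum_(i | P i) F i) = \sum_(i | P i) f (F i).
Proof. exact: (big_morph f morphBD morphB0). Qed.

Lemma delete_sum_morph (T : eqType) (g : seq T -> U) s :
  f (delete_sum g s) = delete_sum (fun u => f (g u)) s.
Proof. by elim: s g => [|x s IH] g /=; rewrite ?morphB0 // fB IH. Qed.

End MorphB.

Section DeleteSum.
Variables (T : eqType) (V : zmodType).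
Implicit Types (s : seq T) (f : seq T -> V).
Local Open Scope ring_scope.

Lemma eq_delete_sum_in f g s : (forall u, {subset u <= s} -> f u = g u) ->
  delete_sum f s = delete_sum g s.
Proof.
elim: s f g => //= x s IH f g fg; congr (_ - _).
  by apply: fg => y; rewrite inE orbC => ->.
apply: IH => u us; apply: fg => y; rewrite !inE.
by case/predU1P=> [->|/us ->]; rewrite ?eqxx ?orbT.
Qed.

Lemma delete_sum_map (Y : eqType) (h : Y -> T) f (s : seq Y) :
  delete_sum f (map h s) = delete_sum (fun u => f (map h u)) s.
Proof. by elim: s f => //= x s IH f; rewrite IH. Qed.

Lemma delete_sum0 f s : (forall u, f u = 0) -> delete_sum f s = 0.
Proof. by elim: s f => //= x s IH f f0; rewrite f0 IH ?subrr. Qed.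

(** Deleting either of the two exchanged entries produces the same two sequences with their signs
    interchanged; every other term changes sign with [f]. *)
Lemma delete_sum_alt f : alternating -%R f -> alternating -%R (delete_sum f).
Proof.
move=> fA s1 x y s2; elim: s1 f fA => [|z s1 IH] f fA /=.
  rewrite (@eq_delete_sum _ _ _ (fun u => - f (y :: x :: u))); last first.
    by move=> u; apply: (fA [::]).
  rewrite -(delete_sum_morph (f := -%R)) => [|u v]; last by rewrite opprD.
  by rewrite opprK opprB opprD addrA addrAC.
rewrite fA (IH (fun u => f (z :: u))); last by have := @alternating_cons _ _ -%R f z fA.
by rewrite opprB opprK addrC.
Qed.

Lemma dup_perm s : ~~ uniq s -> exists x w, perm_eq s (x :: x :: w).
Proof.
elim: s => //= y s IH; rewrite negb_and negbK => /orP[ys|/IH[x [w xw]]].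
  by exists y, (rem y s); rewrite perm_cons; apply: perm_to_rem.
exists x, (y :: w); apply: (perm_trans (y := y :: x :: x :: w)); first by rewrite perm_cons.
by rewrite (perm_catCA [:: y] [:: x; x] w).
Qed.

Lemma alternating_perm_eq0 f s s' : alternating -%R f -> perm_eq s s' -> f s' = 0 -> f s = 0.
Proof.
move=> fA /alternating_perm[b Hb] f0.
rewrite (Hb _ _ _ (@opprK V) fA [::]) /=.
by rewrite f0 oppr0; case: (b).
Qed.

(** With the equal entries moved to the front, their two deletions cancel and every other term still
    contains the repetition. *)
Lemma delete_sum_dup f s : alternating -%R f -> (forall x w, f (x :: x :: w) = 0) ->
  ~~ uniq s -> delete_sum f s = 0.
Proof.
move=> fA f0 /dup_perm[x [w xw]]; apply: alternating_perm_eq0 xw _; first exact: delete_sum_alt.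
by rewrite /= opprB addrC subrK delete_sum0.
Qed.

End DeleteSum.

Section ExteriorProducts.
Variables (R : comPzRingType) (X : finType).
Implicit Types (S U V : {set X}) (u v : ext R X) (x y : X) (s : seq X).
Local Open Scope ring_scope.

Definition ext_prod s : ext R X := foldr (@lmul R X) (ext1 R X) s.

Lemma lmulN x u : lmul x (- u) = - lmul x u.
Proof. exact: wedgeNr. Qed.

Lemma lmulB x u v : lmul x (u - v) = lmul x u - lmul x v.
Proof. exact: wedgeBr. Qed.

Lemma lmul0 x : lmul x (0 : ext R X) = 0.
Proof. exact: wedge0r. Qed.

Lemma ext_prod_alt : alternating -%R ext_prod.
Proof.
move=> s1 x y s2; elim: s1 => [|z s1 IH] /=; first exact: lmul_anti.
by rewrite IH lmulN.
Qed.

Lemma ext_prod_dup x s : ext_prod (x :: x :: s) = 0.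
Proof. exact: lmul_sq. Qed.

Lemma ext_prod_nuniq s : ~~ uniq s -> ext_prod s = 0.
Proof.
move/dup_perm=> [x [w xw]]; apply: alternating_perm_eq0 xw (ext_prod_dup x w).
exact: ext_prod_alt.
Qed.

Lemma ext_prod_sorted s : sorted (@xlt X) s -> ext_prod s = mono R [set x in s].
Proof.
elim: s => [_|x s IH] /=.
  by rewrite /ext1; congr mono; apply/setP=> x; rewrite !inE.
have tr : transitive (@xlt X) by move=> a b c; apply: ltn_trans.
rewrite (path_sortedE tr) => /andP[/allP xs ss].
rewrite -/(ext_prod s) IH // lmul_mono => [|y]; last by rewrite inE => /xs.
by congr mono; apply/setP=> y; rewrite !inE.
Qed.

Lemma mono_prod S : mono R S = ext_prod (enum S).
Proof. by rewrite (ext_prod_sorted (enum_sorted S)) set_in_enum. Qed.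

(** The boundary counts positions from the last entry and [delete_sum] from the first, whence the
    global sign. *)
Lemma bdry_sorted s : sorted (@xlt X) s ->
  bdry R [set x in s] = - ((-1) ^+ size s *: delete_sum ext_prod s).
Proof.
elim: s => [_|x s IH].
  rewrite /= scaler0 oppr0 /bdry big_pred0 // => y; by rewrite inE.
have tr : transitive (@xlt X) by move=> a b c; apply: ltn_trans.
rewrite [sorted _ _](path_sortedE tr) => /andP[/allP xs ss].
have nxs : x \notin s by apply/negP=> /xs; rewrite xlt_irr.
have us : uniq s by apply: sorted_uniq ss => // y; apply: xlt_irr.
have -> : [set y in x :: s] = x |: [set y in s] by apply/setP=> y; rewrite !inE.
rewrite /bdry big_setU1 ?inE //= setU1K ?inE //.
have -> : sgn_last R x (x |: [set y in s]) = (-1) ^+ size s.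
  rewrite /sgn_last; have -> : size s = #|[set y in s]| by rewrite cardsE (card_uniqP us).
  congr (_ ^+ _).
  congr #|pred_of_set _|; apply/setP=> y; rewrite !inE.
  have [->|_] /= := eqVneq y x; first by rewrite xlt_irr (negPf nxs).
  by apply/andP/idP=> [[]|ys] //; split=> //; apply: xs.
have -> : \sum_(y in [set y in s]) sgn_last R y (x |: [set y in s])
      *: mono R ((x |: [set y in s]) :\ y) = lmul x (bdry R [set y in s]).
  rewrite /bdry (big_morph (lmul x) (wedgeDr _) (lmul0 x)); apply: eq_bigr => y.
  rewrite inE => ys; have xy := xs y ys.
  have nxy : x != y by apply: contraNneq nxs => ->.
  rewrite /lmul wedgeZr -/(lmul x _) lmul_mono => [|z]; last first.
    by rewrite !inE => /andP[_ /xs].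
  congr (_ *: mono _ _).
    rewrite /sgn_last; congr (_ ^+ _); congr #|pred_of_set _|; apply/setP=> z; rewrite !inE.
    by have [->|//] := eqVneq z x; rewrite xlt_total 1?eq_sym // xy andbF (negPf nxs).
  apply/setP=> z; rewrite !inE; have [->|//] := eqVneq z x.
  by rewrite nxy.
rewrite IH // -(ext_prod_sorted ss) lmulN /lmul wedgeZr -/(lmul x _).
rewrite (delete_sum_morph (lmulB x)) exprS mulN1r scaleNr opprK.
by rewrite scalerBr.
Qed.

Lemma bdry_prod S : bdry R S = - ((-1) ^+ #|S| *: delete_sum ext_prod (enum S)).
Proof. by rewrite -{1}(set_in_enum S) (bdry_sorted (enum_sorted S)) size_enum. Qed.

(** The grading involution. *)
Definition bar u : ext R X := [ffun S : {set X} => (-1) ^+ #|S| * (u S : R)].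

Lemma barE u S : bar u S = (-1) ^+ #|S| * (u S : R).
Proof. by rewrite ffunE. Qed.

Lemma barK u : bar (bar u) = u.
Proof. by apply/ffunP=> S; rewrite !ffunE signrMK. Qed.

Lemma barB u v : bar (u - v) = bar u - bar v.
Proof. by apply/ffunP=> S; rewrite !ffunE mulrBr. Qed.

Lemma bar0 : bar 0 = 0.
Proof. by apply/ffunP=> S; rewrite !ffunE mulr0. Qed.

Lemma barZ c u : bar (c *: u) = c *: bar u.
Proof. by apply/ffunP=> S; rewrite !ffunE /GRing.scale /= mulrCA. Qed.

Lemma bar_lmul x u : bar (lmul x u) = - lmul x (bar u).
Proof.
apply/ffunP=> S; rewrite [RHS]ffunE barE !lmulE; case: ifP => xS; last first.
  by rewrite mulr0 oppr0.
by rewrite barE (cardsD1 x S) xS exprS mulN1r mulNr mulrCA.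
Qed.

Lemma bar_prod s : bar (ext_prod s) = (-1) ^+ size s *: ext_prod s.
Proof.
elim: s => [|x s IH] /=.
  rewrite scale1r; apply/ffunP=> S; rewrite !ffunE.
  by case: eqVneq => [->|]; rewrite ?cards0 ?mul1r ?mulr0.
by rewrite bar_lmul IH /lmul wedgeZr exprS mulN1r scaleNr.
Qed.

Lemma bar_bdry S : exists c : R, bar (bdry R S) = c *: bdry R S.
Proof.
exists (- (-1) ^+ #|S|); apply/ffunP=> U; rewrite ffunE [RHS]ffunE.
rewrite /bdry !sum_ffunE scaler_sumr mulr_sumr; apply: eq_bigr => x xS.
rewrite !ffunE; case: eqVneq => [->|_]; last by rewrite /GRing.scale /= !mulr0.
by rewrite (cardsD1 x S) xS exprS mulN1r opprK.
Qed.

(** Monomials are built from generators by [lmul], which settles left multiplication. A right factor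
    [mono R U] moves to the left at the cost of [bar] when [#|U|] is odd, so closure under [bar]
    settles the other side. *)
Lemma ideal_of_lmul (J : ext R X -> Prop) :
  J 0 -> (forall u v, J u -> J v -> J (u - v)) -> (forall c u, J u -> J (c *: u)) ->
  (forall u, J u -> J (bar u)) -> (forall x u, J u -> J (lmul x u)) ->
  [/\ J 0, forall u v, J u -> J v -> J (u - v),
      forall u v, J v -> J (wedge u v) & forall u v, J u -> J (wedge u v)].
Proof.
move=> J0 JB JZ Jb JL.
have JD u v : J u -> J v -> J (u + v).
  by move=> Ju Jv; rewrite -[v]opprK -(sub0r v); exact: (JB _ _ Ju (JB _ _ J0 Jv)).
have Jm s v : sorted (@xlt X) s -> J v -> J (wedge (mono R [set x in s]) v).
  move=> ss Jv; elim: s ss => [_|x s IH].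
    suff -> : wedge (mono R [set x in [::]]) v = v by [].
    apply/ffunP=> S; rewrite wedge_mono; have -> : [set x in [::]] = set0 :> {set X}.
      by apply/setP=> x; rewrite !inE.
    rewrite sub0set setD0 /inversions (_ : finset _ = set0) ?cards0 ?mul1r //.
    by apply/setP=> -[a b]; rewrite !inE.
  have tr : transitive (@xlt X) by move=> a b c; apply: ltn_trans.
  rewrite [sorted _ _](path_sortedE tr) => /andP[/allP xs ss].
  have -> : [set y in x :: s] = x |: [set y in s] by apply/setP=> y; rewrite !inE.
  by rewrite wedge_mono_cons ?IH // => [|y]; [apply/JL/IH | rewrite inE => /xs].
have {}Jm U v : J v -> J (wedge (mono R U) v).
  by move=> Jv; rewrite -(set_in_enum U); apply: Jm => //; apply: enum_sorted.
split=> // u v Ju.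
  rewrite (ext_sum_mono u) (big_morph (fun w => wedge w v) (fun a b => wedgeDl a b v) (wedge0l v)).
  by apply: big_ind => // U _; rewrite wedgeZl; apply/JZ/Jm.
rewrite (ext_sum_mono v) (big_morph (wedge u) (wedgeDr u) (wedge0r u)).
apply: big_ind => // U _; rewrite wedgeZr; apply: JZ.
suff -> : wedge u (mono R U) = wedge (mono R U) (if odd #|U| then bar u else u).
  by apply: Jm; case: ifP => // _; apply: Jb.
apply/ffunP=> S; rewrite wedge_mono wedge_mono_r; case: ifP => // US.
(* Each pair in [U] times [V] is an inversion in exactly one of the two orders. *)
pose V := S :\: U; have inv : (inversions V U + inversions U V = #|U| * #|V|)%N.
  rewrite -cardsX -(cardsID [set p | xlt p.1 p.2] (setX U V)); congr (_ + _)%N.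
    rewrite /inversions -(card_imset _ (_ : injective (fun p : X * X => (p.2, p.1)))); last first.
      by move=> [a b] [c d] [-> ->].
    congr #|pred_of_set _|; apply/setP=> -[a b]; rewrite !inE /=.
    apply/imsetP/idP=> [[[c d]]|/andP[/andP[aU bV] ab]].
      by rewrite !inE /= => /and3P[cV dU dc] [-> ->]; rewrite dU cV dc.
    by exists (b, a) => //; rewrite inE /= aU ab !andbT !inE.
  rewrite /inversions; congr #|pred_of_set _|; apply/setP=> -[a b]; rewrite !inE /=.
  case aU: (a \in U) => //=; last by rewrite andbF.
  have [bU|bU] := boolP (b \in U); first by rewrite andbF.
  case: (b \in S); rewrite ?andbF //= andbT; apply: xlt_total.
  by apply: contraNneq bU => ->.
have sg : (-1) ^+ inversions V U = (-1) ^+ inversions U V * (-1) ^+ (#|U| * #|V|) :> R.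
  by rewrite -inv addnC exprD signrMK.
rewrite -/V sg -mulrA; congr (_ * _); case: ifP => oU; last first.
  by rewrite -signr_odd oddM oU mul1r.
by rewrite ffunE -signr_odd oddM oU /= signr_odd.
Qed.

End ExteriorProducts.

(** * The Orlik-Solomon ideal *)

Section Atoms.
Variables (T : finType) (M : om T).
Hypotheses (mat : matroid (indep M)) (ll : loopless M).
Local Notation E := (ground M).
Implicit Types (A B I J K S : {set T}) (x y : T) (a b : atom M).

Lemma indep_sub I : indep M I -> I \subset E.
Proof. by case/andP. Qed.

Lemma rank_ge I S : indep M I -> I \subset S -> #|I| <= rank M S.
Proof.
move=> iI IS; rewrite /rank.
by apply: (@leq_bigmax_cond _ _ (fun J : {set T} => #|J|)); rewrite iI.
Qed.

Lemma rank_le S k : (forall I, indep M I -> I \subset S -> #|I| <= k) -> rank M S <= k.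
Proof. by move=> H; apply/bigmax_leqP => I /andP[iI IS]; apply: H. Qed.

(** The parallel class of [x]. The element itself is added separately, since [[set x; x]] is
    independent when [x] is not a loop. *)
Definition par x : {set T} := [set y in E | (y == x) || ~~ indep M [set x; y]].

Lemma par_refl x : x \in E -> x \in par x.
Proof. by move=> xE; rewrite inE xE eqxx. Qed.

(** If [y |: I] were independent, extending [[set x]] from it to the same size would have to avoid
    the parallel element [y], and would thus produce [x |: I]. *)
Lemma par_dep x y I : x \in E -> y \in par x -> y \notin I -> x \notin I ->
  ~~ indep M (x |: I) -> ~~ indep M (y |: I).
Proof.
move=> xE; rewrite inE => /andP[yE /predU1P[->//|dxy]] yI xI; apply: contra => iy.
have [J [xJ JU iJ le]] := ind_extend mat (ll xE) iy.
rewrite sub1set in xJ.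
have yJ : y \notin J.
  apply: contra dxy => yJ; apply: (indS mat) iJ.
  by rewrite subUset !sub1set xJ yJ.
suff <- : J = x |: I by [].
apply/eqP; rewrite eqEcard cardsU1 xI; move: le; rewrite cardsU1 yI => ->; rewrite andbT.
apply/subsetP=> z zJ; have := subsetP JU _ zJ; rewrite !inE.
by case/or3P=> [->//|/eqP zy|->]; rewrite ?orbT //; rewrite -zy zJ in yJ.
Qed.

Lemma atom_flat a : [/\ val a \subset E, rank M (val a) = 1
  & forall y, y \in E -> y \notin val a -> 1 < rank M (y |: val a)].
Proof.
case/andP: (valP a) => /andP[aE /forall_inP fl] /eqP r1; split=> // y yE ya.
by have := fl y; rewrite inE ya yE r1; apply.
Qed.

Lemma atom_par a x : x \in val a -> val a = par x.
Proof.
move=> xa; have [aE r1 fl] := atom_flat a; have xE := subsetP aE _ xa.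
apply/setP=> y; rewrite inE; apply/idP/andP=> [ya|[yE]].
  split; first exact: (subsetP aE).
  have [//|yx] /= := eqVneq y x; apply/negP => ixy.
  have := rank_ge ixy (S := val a); rewrite subUset !sub1set xa ya r1 cards2 eq_sym yx.
  by move/(_ isT).
case/predU1P=> [->//|dxy]; apply: contraT => ya.
have := fl y yE ya; rewrite ltnNge; apply: contraNT => _.
apply: rank_le => I iI IS; rewrite leqNgt; apply/negP => ltI.
have [|z /setDP[zI]] := indA mat (ll xE) iI; first by rewrite cards1.
rewrite inE => zx ixz; have := subsetP IS _ zI; rewrite !inE => /predU1P[zy|za].
  by move: dxy; rewrite -zy setUC ixz.
have := rank_ge ixz (S := val a); rewrite subUset !sub1set xa za r1 cardsU1 cards1 inE zx.
by move/(_ isT).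
Qed.

Lemma par_is_atom x : x \in E -> is_atom M (par x).
Proof.
move=> xE; have xp := par_refl xE.
have two I : indep M I -> 1 < #|I| -> exists z, [/\ z \in I, z != x & indep M [set x; z]].
  move=> iI ltI; have [|z /setDP[zI]] := indA mat (ll xE) iI; first by rewrite cards1.
  by rewrite inE => zx ixz; exists z; rewrite setUC.
have r1 : rank M (par x) = 1.
  apply/eqP; rewrite eqn_leq -{2}(cards1 x) rank_ge ?sub1set ?ll // andbT.
  apply: rank_le => I iI IS; rewrite leqNgt; apply/negP => /(two I iI)[z [zI zx ixz]].
  by have := subsetP IS _ zI; rewrite inE (negPf zx) ixz andbF.
rewrite /is_atom r1 eqxx andbT; apply/andP; split; first by apply/subsetP=> y; rewrite inE => /andP[].
apply/forall_inP=> y; rewrite in_setD => /andP[yp yE]; rewrite r1.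
have ixy : indep M [set x; y].
  by move: yp; rewrite inE yE /= negb_or negbK => /andP[].
have yx : x != y by apply: contraNneq yp => <-.
have := rank_ge ixy (S := y |: par x); rewrite cards2 yx; apply.
by rewrite subUset !sub1set !inE eqxx xE eqxx orbT.
Qed.

Lemma atom_eq a b x : x \in val a -> x \in val b -> a = b.
Proof. by move=> xa xb; apply: val_inj; rewrite (atom_par xa) (atom_par xb). Qed.

Lemma atom_neq0 a : val a != set0.
Proof.
have [_ r1 _] := atom_flat a; apply: contra_eq_neq r1 => ->.
suff: rank M set0 <= 0 by rewrite leqn0 => /eqP->.
by apply: rank_le => I _; rewrite subset0 => /eqP->; rewrite cards0.
Qed.

Definition rep a : T := xchoose (elimT (set0Pn _) (atom_neq0 a)).

Lemma rep_mem a : rep a \in val a.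
Proof. exact: xchooseP. Qed.

Lemma rep_in a : rep a \in E.
Proof. by have [aE _ _] := atom_flat a; apply: (subsetP aE); apply: rep_mem. Qed.

Lemma rep_inj : injective rep.
Proof. by move=> a b e; apply: (@atom_eq a b (rep a)); rewrite ?rep_mem // e rep_mem. Qed.

(** [a0] is a default for elements outside [E], where [par x] need not be an atom. *)
Definition atom_at a0 x : atom M := insubd a0 (par x).

Lemma mem_atom_at a0 x : x \in E -> x \in val (atom_at a0 x).
Proof. by move=> xE; rewrite /atom_at insubdK ?par_refl //; apply: par_is_atom. Qed.

(** If [t] lists distinct atoms, its union has rank less than [size t] as soon as
    representatives of these atoms are dependent. *)
Lemma dependent_atoms_at a0 s : {subset s <= E} -> uniq (map (atom_at a0) s) ->
  ~~ indep M [set x in s] -> dependent_atoms [set a in map (atom_at a0) s].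
Proof.
move=> sE ut nis; have us := map_uniq ut.
rewrite /dependent_atoms cardsE (card_uniqP ut) size_map.
have [I [_ Is iI maxI]] := ind_max (sub0set [set x in s]) (ind0 mat).
have css : #|[set x in s]| = size s by rewrite cardsE (card_uniqP us).
have ltI : #|I| < size s.
  rewrite -css; apply: proper_card; rewrite properEneq Is andbT.
  by apply: contraNneq nis => <-.
apply: leq_trans ltI; rewrite ltnS; apply: rank_le => K iK KS.
apply: (ind_max_card mat _ iI KS iK) => y /bigcupP[a].
rewrite inE => /mapP[x xs ->] ya yI; have xE := sE x xs.
have xa := mem_atom_at a0 xE; rewrite (atom_par xa) in ya.
have [xI|xI] := boolP (x \in I).
  have yx : y != x by apply: contraNneq yI => ->.
  move: ya; rewrite inE (negPf yx) /= => /andP[_]; apply: contra => iy.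
  by apply: (indS mat) iy; rewrite subUset !sub1set !inE xI eqxx orbT.
by apply: (@par_dep x) => //; apply: maxI; rewrite ?inE.
Qed.

Lemma dependent_rep (S : {set atom M}) :
  dependent_atoms S -> ~~ indep M [set x in map rep (enum S)].
Proof.
rewrite /dependent_atoms ltnNge; apply: contra => iS.
have ur : uniq (map rep (enum S)) by rewrite (map_inj_uniq rep_inj) enum_uniq.
have -> : #|S| = #|[set x in map rep (enum S)]|.
  by rewrite cardsE (card_uniqP ur) size_map size_enum.
apply: rank_ge => //; apply/subsetP=> x; rewrite inE => /mapP[a].
by rewrite mem_enum => aS ->; apply/bigcupP; exists a => //; apply: rep_mem.
Qed.

(** * The ideal in terms of sequences of elements *)

Section Algebra.
Variable R : comPzRingType.
Local Open Scope ring_scope.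
Local Notation Lam := (ext R (atom M)).
Implicit Types u v : Lam.

Lemma atom_gen_mono A a : A \subset val a -> A != set0 -> atom_gen R M A = mono R [set a].
Proof.
move=> Aa /set0Pn[x xA]; rewrite /atom_gen (big_pred1 a) // => b /=.
apply/idP/eqP=> [Ab|->//]; apply: (@atom_eq _ _ x); exact: subsetP xA.
Qed.

Lemma atom_gen_eq0 A : (forall a, ~~ (A \subset val a)) -> atom_gen R M A = 0.
Proof. by move=> nA; rewrite /atom_gen big_pred0 // => a; apply/negbTE. Qed.

Definition atom_mul A u : Lam := wedge (atom_gen R M A) u.

(** Sets contained in an atom and sets contained in none can then be treated alike; the second kind
    occurs in the contraction for the contracted atom. *)
Lemma atom_mulP A : A != set0 ->
  (forall u, atom_mul A u = 0) \/ exists a, forall u, atom_mul A u = lmul a u.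
Proof.
move=> A0; have [a Aa|nA] := pickP (fun a : atom M => A \subset val a).
  by right; exists a => u; rewrite /atom_mul (atom_gen_mono Aa).
by left=> u; rewrite /atom_mul atom_gen_eq0 ?wedge0l // => a; rewrite nA.
Qed.

Lemma atom_mul0r A : atom_mul A 0 = 0. Proof. exact: wedge0r. Qed.
Lemma atom_mulN A u : atom_mul A (- u) = - atom_mul A u. Proof. exact: wedgeNr. Qed.

Lemma atom_mul_anti A B u : A != set0 -> B != set0 ->
  atom_mul A (atom_mul B u) = - atom_mul B (atom_mul A u).
Proof.
move=> /atom_mulP[A0|[a Aa]] /atom_mulP[B0|[b Bb]]; rewrite ?A0 ?B0 ?A0 ?B0.
- by rewrite oppr0.
- by rewrite atom_mul0r oppr0.
- by rewrite atom_mul0r oppr0.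
by rewrite !(Aa, Bb) lmul_anti.
Qed.

Lemma atom_mul_sq A u : A != set0 -> atom_mul A (atom_mul A u) = 0.
Proof. by case/atom_mulP=> [A0|[a Aa]]; rewrite ?A0 // !Aa lmul_sq. Qed.

Lemma in_OS_ideal_is_ideal : is_ideal (@in_OS_ideal R T M).
Proof.
split=> [J [] //|u v Iu Iv J idJ dJ|u v Iv J idJ dJ|u v Iu J idJ dJ];
  by case: (idJ) => _ JB Jl Jr; do [apply: JB; [apply: Iu | apply: Iv] | apply: Jl; apply: Iv | apply: Jr; apply: Iu].
Qed.

Lemma OS_ideal0 : in_OS_ideal (0 : Lam).
Proof. by case: in_OS_ideal_is_ideal. Qed.

Lemma OS_idealB u v : in_OS_ideal u -> in_OS_ideal v -> in_OS_ideal (u - v).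
Proof. by case: in_OS_ideal_is_ideal => _ H _ _; apply: H. Qed.

Lemma OS_ideal_wedge u v : in_OS_ideal v -> in_OS_ideal (wedge u v).
Proof. by case: in_OS_ideal_is_ideal => _ _ H _; apply: H. Qed.

Lemma OS_idealN u : in_OS_ideal u -> in_OS_ideal (- u).
Proof. by rewrite -sub0r; apply: OS_idealB; apply: OS_ideal0. Qed.

Lemma wedge1 u : wedge (ext1 R (atom M)) u = u.
Proof.
apply/ffunP=> S; rewrite wedge_mono sub0set setD0 /inversions (_ : finset _ = set0).
  by rewrite cards0 mul1r.
by apply/setP=> -[a b]; rewrite !inE.
Qed.

Lemma OS_idealZ c u : in_OS_ideal u -> in_OS_ideal (c *: u).
Proof. by move=> Iu; rewrite -[u]wedge1 -wedgeZl; apply: OS_ideal_wedge. Qed.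

Lemma OS_ideal_bdry (S : {set atom M}) : dependent_atoms S -> in_OS_ideal (bdry R S).
Proof. by move=> dS J _; apply. Qed.

Lemma OS_ideal_delete (S : {set atom M}) : dependent_atoms S ->
  in_OS_ideal (delete_sum (@ext_prod R (atom M)) (enum S)).
Proof.
move=> /OS_ideal_bdry /OS_idealN /(OS_idealZ ((-1) ^+ #|S|)).
by rewrite bdry_prod opprK scalerA -expr2 sqrr_sign scale1r.
Qed.

(** The boundary relation is multiplied by the first generator [e_x] of [S]: the term without [x]
    becomes [e_S], and all others contain [x] twice. *)
Lemma OS_ideal_mono (S : {set atom M}) : dependent_atoms S -> in_OS_ideal (mono R S).
Proof.
move=> dS; have := OS_ideal_delete dS; rewrite mono_prod.
case: (enum S) (size_enum S) => [|x s] /= cS.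
  by move: dS; rewrite /dependent_atoms -cS.
move/(OS_ideal_wedge (mono R [set x])); rewrite -/(lmul x _) lmulB.
rewrite (delete_sum_morph (lmulB x)).
by rewrite (delete_sum0 _ (fun w => ext_prod_dup R x w)) subr0.
Qed.

Lemma ext_seq_alt : alternating -%R (ext_seq R M).
Proof.
move=> s1 x y s2; elim: s1 => [|z s1 IH] /=; last by rewrite IH wedgeNr.
by apply: atom_mul_anti; apply/set0Pn; [exists x | exists y]; rewrite inE.
Qed.

Lemma ext_seq_at a0 s : {subset s <= E} -> ext_seq R M s = ext_prod R (map (atom_at a0) s).
Proof.
elim: s => //= x s IH sE; rewrite IH => [|y ys]; last by apply: sE; rewrite inE ys orbT.
rewrite (@atom_gen_mono _ (atom_at a0 x)) //; first by rewrite sub1set mem_atom_at ?sE ?mem_head.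
by apply/set0Pn; exists x; rewrite inE.
Qed.

Lemma delete_seq_at a0 s : {subset s <= E} ->
  delete_sum (ext_seq R M) s = delete_sum (@ext_prod R (atom M)) (map (atom_at a0) s).
Proof.
move=> sE; rewrite delete_sum_map; apply: eq_delete_sum_in => u us.
by apply: ext_seq_at => x /us/sE.
Qed.

(** If two entries share an atom, the sequence of atoms has a repetition and both elements are zero.
    Otherwise the atoms form a dependent set, and the relations for this set apply up to the sign of
    sorting. *)
Lemma OS_ideal_seq s : {subset s <= E} -> ~~ (uniq s && indep M [set x in s]) ->
  in_OS_ideal (ext_seq R M s) /\ in_OS_ideal (delete_sum (ext_seq R M) s).
Proof.
case: s => [|x0 s0]; first by rewrite /= (_ : finset _ = set0) ?(ind0 mat) //; apply/setP=> x; rewrite !inE.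
move=> sE; have x0E : x0 \in E by apply: sE; rewrite mem_head.
have [a0 _] : exists a0 : atom M, True by exists (Sub (par x0) (par_is_atom x0E)).
move: (x0 :: s0) sE => {x0 s0 x0E} s sE nds.
rewrite (ext_seq_at a0 sE) (delete_seq_at a0 sE).
have [ut|nut] := boolP (uniq (map (atom_at a0) s)); last first.
  rewrite ext_prod_nuniq // delete_sum_dup //.
  - by split; apply: OS_ideal0.
  - exact: ext_prod_alt.
  exact: ext_prod_dup.
have us := map_uniq ut; rewrite us /= in nds.
have dS := dependent_atoms_at sE ut nds.
have pS : perm_eq (map (atom_at a0) s) (enum [set a in map (atom_at a0) s]).
  by apply: uniq_perm; rewrite ?enum_uniq // => a; rewrite mem_enum inE.
have sgn f : alternating -%R f -> in_OS_ideal (f (enum [set a in map (atom_at a0) s]))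
    -> in_OS_ideal (f (map (atom_at a0) s) : Lam).
  move=> fA If; have [b Hb] := alternating_perm pS.
  rewrite (Hb _ _ _ (@opprK _) fA [::]) /=.
  by case: (b) => //; apply: OS_idealN.
split; apply: sgn.
- exact: ext_prod_alt.
- by rewrite -mono_prod; apply: OS_ideal_mono.
- by apply: delete_sum_alt; apply: ext_prod_alt.
exact: OS_ideal_delete.
Qed.

Lemma OSpiB : {morph @OSpi R T M : u v / u - v}.
Proof. exact: pi_is_zmod_morphism. Qed.

Lemma OSpi_eq u v : in_OS_ideal (u - v) <-> OSpi u = OSpi v.
Proof.
have e := Quotient.idealrBE (@OS_ideal R T M) u v.
split=> [Iu|uv]; first by apply/eqP; rewrite -[_ == _]e; apply/asboolP.
by apply/asboolP; rewrite -[asbool _]/(_ \in @OS_ideal R T M) e; apply/eqP.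
Qed.

Lemma OSpi_eq0 u : in_OS_ideal u -> OSpi u = 0.
Proof. by move=> Iu; rewrite -(morphB0 OSpiB); apply/OSpi_eq; rewrite subr0. Qed.

Lemma OSe_os_like r : rank M E = r -> os_like E r (indep M) (OSe R M).
Proof.
move=> rE; split.
- by move=> s1 x y s2; rewrite /OSe ext_seq_alt (morphBN OSpiB).
- by move=> s sE _ nds; apply: OSpi_eq0; have [] := OS_ideal_seq sE nds.
move=> s sE ss; have -> : delete_sum (OSe R M) s = OSpi (delete_sum (ext_seq R M) s).
  by rewrite (delete_sum_morph OSpiB).
apply: OSpi_eq0; have [|_ I] := OS_ideal_seq sE; last exact: I.
apply/negP=> /andP[us iss]; have := rank_ge iss (S := E).
by rewrite rE cardsE (card_uniqP us) ss ltnn => /(_ (indep_sub iss)).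
Qed.
End Algebra.
End Atoms.

(** * Residues *)

Section Residue.
Variables (T : finType) (M : om T) (a : atom M).
Hypotheses (mat : matroid (indep M)) (ll : loopless M).
Local Notation M' := (contract M (val a)).
(** An assumption here, so that residues concern matroids only; for oriented matroids it is proved
    by means of the chirotope. *)
Hypothesis indep_contract : forall v (I : {set T}), v \in val a -> I \subset ground M' ->
  indep M' I = indep M (v |: I).
Implicit Types (I J : {set T}) (x y : T) (b c : atom M).

Lemma contract_indep_rep I : I \subset ground M' -> indep M' I = indep M (rep a |: I).
Proof. exact: indep_contract (rep_mem a). Qed.

Lemma contract_matroid : matroid (indep M').
Proof.
have sub I : indep M' I -> I \subset ground M' by case/andP.
have notin I : I \subset ground M' -> rep a \notin I.
  by move/subsetP=> IE; apply/negP=> /IE; rewrite inE rep_mem.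
split=> [|I J IJ iJ|I J iI iJ lt].
- by rewrite contract_indep_rep ?sub0set // setU0 ll // rep_in.
- have JE := sub J iJ; rewrite contract_indep_rep ?(subset_trans IJ) //.
  by apply: (indS mat) (_ : indep M (rep a |: J)); rewrite ?setUS -?contract_indep_rep.
have IE := sub I iI; have JE := sub J iJ.
rewrite (contract_indep_rep IE) in iI; rewrite (contract_indep_rep JE) in iJ.
have [|x] := indA mat iI iJ; first by rewrite !cardsU1 !notin.
rewrite !inE negb_or => /andP[/andP[xa xI]]; rewrite (negPf xa) /= => xJ ix.
exists x; first by rewrite inE xI.
by rewrite contract_indep_rep ?subUset ?sub1set ?(subsetP JE) // setUCA.
Qed.

Lemma contract_loopless : loopless M'.
Proof.
move=> x; rewrite inE => /andP[xa xE].
rewrite contract_indep_rep ?sub1set ?inE ?xa //.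
have := xa; rewrite (atom_par mat ll (rep_mem a)) inE xE /=.
by rewrite negb_or negbK => /andP[].
Qed.

Let mat' := contract_matroid.
Let ll' := contract_loopless.

Section Algebra.
Variable R : comPzRingType.
Local Open Scope ring_scope.
Local Notation Lam := (ext R (atom M)).
Local Notation Lam' := (ext R (atom M')).
Implicit Types (u v w : Lam) (s : seq (atom M)).

Definition img s : Lam' := foldr (fun b => atom_mul (M := M') (val b)) (ext1 R (atom M')) s.

(** The algebra map that sends [e_b] to the generator of the atom of the contraction containing [b],
    and [e_a] to zero. It describes the residue once a factor [e_a] is split off. *)
Definition proj u : Lam' := \sum_I (u I : R) *: img (enum I).

Lemma projB : {morph proj : u v / u - v}.
Proof. by move=> u v; rewrite /proj -sumrB; apply: eq_bigr => I _; rewrite !ffunE scalerBl. Qed.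

Lemma projZ k u : proj (k *: u) = k *: proj u.
Proof. by rewrite /proj scaler_sumr; apply: eq_bigr => I _; rewrite !ffunE scalerA. Qed.

Lemma resB : {morph (@ext_res R T M a) : u v / u - v}.
Proof. by move=> u v; rewrite /ext_res -sumrB; apply: eq_bigr => I _; rewrite !ffunE mulrBl scalerBl. Qed.

Lemma resZ k u : ext_res a (k *: u) = k *: ext_res a u.
Proof. by rewrite /ext_res scaler_sumr; apply: eq_bigr => I _; rewrite !ffunE scalerA mulrA. Qed.

Lemma linear_ext (V : lmodType R) (f g : Lam -> V) :
  {morph f : u v / u - v} -> (forall k u, f (k *: u) = k *: f u) ->
  {morph g : u v / u - v} -> (forall k u, g (k *: u) = k *: g u) ->
  (forall S, f (mono R S) = g (mono R S)) -> f =1 g.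
Proof.
move=> fB fZ gB gZ fg u.
rewrite (ext_sum_mono u) (morphB_sum fB) (morphB_sum gB).
by apply: eq_bigr => S _; rewrite fZ gZ fg.
Qed.

Lemma atom_mulB (A : {set T}) (u v : Lam') : atom_mul A (u - v) = atom_mul A u - atom_mul A v.
Proof. exact: wedgeBr. Qed.

Lemma atom_mulZ (A : {set T}) k (u : Lam') : atom_mul A (k *: u) = k *: atom_mul A u.
Proof. exact: wedgeZr. Qed.

Lemma atom_mul_a (u : Lam') : atom_mul (val a) u = 0.
Proof.
rewrite /atom_mul atom_gen_eq0 ?wedge0l // => c; apply/negP=> ac.
have [cE _ _] := atom_flat c; have := subsetP cE _ (subsetP ac _ (rep_mem a)).
by rewrite inE rep_mem.
Qed.

Lemma img_alt : alternating -%R img.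
Proof.
move=> s1 x y s2; elim: s1 => [|z s1 IH] /=; last by rewrite IH atom_mulN.
by apply: (atom_mul_anti mat' ll'); apply: atom_neq0.
Qed.

Lemma img_dup b s : img (b :: b :: s) = 0.
Proof. by apply: (atom_mul_sq mat' ll'); apply: atom_neq0. Qed.

Lemma img_a s : a \in s -> img s = 0.
Proof.
elim: s => //= b s IH; rewrite inE => /predU1P[<-|/IH->]; first exact: atom_mul_a.
exact: atom_mul0r.
Qed.

Lemma proj_mono S : proj (mono R S) = img (enum S).
Proof.
rewrite /proj (bigD1 S) //= ffunE eqxx scale1r big1 ?addr0 // => I IS.
by rewrite ffunE (negPf IS) scale0r.
Qed.

Lemma proj_prod s : proj (ext_prod R s) = img s.
Proof.
have [us|nus] := boolP (uniq s); last first.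
  rewrite ext_prod_nuniq //; have [x [w xw]] := dup_perm nus.
  rewrite (alternating_perm_eq0 img_alt xw (img_dup x w)).
  exact: morphB0 projB.
have ps : perm_eq s (enum [set b in s]).
  by apply: uniq_perm; rewrite ?enum_uniq // => b; rewrite mem_enum inE.
have [b Hb] := alternating_perm ps.
rewrite (Hb _ _ _ (@opprK _) (@ext_prod_alt R (atom M)) [::]).
rewrite (Hb _ _ _ (@opprK _) img_alt [::]) /=.
by rewrite -mono_prod -proj_mono; case: (b) => //; rewrite (morphBN projB).
Qed.

Lemma proj_lmul b u : proj (lmul b u) = atom_mul (val b) (proj u).
Proof.
move: u; apply: linear_ext => [u v|k u|u v|k u|S].
- by rewrite lmulB projB.
- by rewrite /lmul wedgeZr projZ.
- by rewrite projB atom_mulB.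
- by rewrite projZ atom_mulZ.
by rewrite mono_prod -[lmul _ _]/(ext_prod R (b :: enum S)) !proj_prod.
Qed.

Lemma res_mono S : ext_res a (mono R S)
  = if a \in S then sgn_last R a S *: img (enum (S :\ a)) else 0.
Proof.
rewrite /ext_res; case: ifPn => aS; last first.
  apply: big1 => I aI; rewrite ffunE; case: eqVneq => [e|_]; last by rewrite mul0r scale0r.
  by rewrite -e aI in aS.
rewrite (bigD1 S) //= ffunE eqxx mul1r big1 ?addr0 // => I /andP[_ IS].
by rewrite ffunE (negPf IS) mul0r scale0r.
Qed.

Lemma lmul_mono_sgn (S : {set atom M}) : a \notin S ->
  lmul a (mono R S) = (-1) ^+ below a S *: mono R (a |: S).
Proof.
move=> aS; apply/ffunP=> I; rewrite lmulE !ffunE.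
have [->|ne] := eqVneq I (a |: S).
  rewrite setU11 setU1K // eqxx; congr (_ ^+ _ * _).
  rewrite /below; congr #|pred_of_set _|; apply/setP=> z; rewrite !inE.
  by have [->|//] := eqVneq z a; rewrite xlt_irr !andbF.
rewrite /GRing.scale /= mulr0; case: ifP => // aI; case: eqVneq => [e|_]; last by rewrite mulr0.
by rewrite -e setD1K // eqxx in ne.
Qed.

(** The residue expects [e_a] in the last place and [lmul a] puts it first; moving it past [u] costs
    the sign of the degree, which is [bar]. On monomials containing [e_a] both sides vanish. *)
Lemma res_lmul_a u : ext_res a (lmul a u) = proj (bar u).
Proof.
move: u; apply: linear_ext => [u v|k u|u v|k u|S].
- by rewrite lmulB resB.
- by rewrite /lmul wedgeZr resZ.
- by rewrite barB projB.
- by rewrite barZ projZ.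
have [aS|aS] := boolP (a \in S).
  rewrite mono_prod bar_prod projZ proj_prod img_a ?mem_enum // scaler0.
  rewrite -[lmul _ _]/(ext_prod R (a :: enum S)) ext_prod_nuniq /= ?mem_enum ?aS //.
  exact: morphB0 resB.
rewrite lmul_mono_sgn // resZ res_mono setU11 setU1K // scalerA.
rewrite mono_prod bar_prod projZ proj_prod size_enum; congr (_ *: _).
rewrite /sgn_last -exprD; congr (_ ^+ _).
rewrite -(cardsID [set y | xlt y a] S); congr addn.
  by rewrite /below; congr #|pred_of_set _|; apply/setP=> y; rewrite !inE.
congr #|pred_of_set _|; apply/setP=> y; rewrite !inE.
have [->|ya] /= := eqVneq y a; first by rewrite (negPf aS) xlt_irr andbF.
by rewrite andbC xlt_total // eq_sym.
Qed.

(** No sign appears, because the residue removes [e_a] from the last place while the new factor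
    enters in front. *)
Lemma res_lmul b u : b != a -> ext_res a (lmul b u) = atom_mul (val b) (ext_res a u).
Proof.
move=> ba; move: u; apply: linear_ext => [u v|k u|u v|k u|S].
- by rewrite lmulB resB.
- by rewrite /lmul wedgeZr resZ.
- by rewrite resB atom_mulB.
- by rewrite resZ atom_mulZ.
have [aS|aS] := boolP (a \in S).
  have -> : mono R S = (-1) ^+ below a (S :\ a) *: lmul a (mono R (S :\ a)).
    by rewrite lmul_mono_sgn ?inE ?eqxx // setD1K // scalerA -expr2 sqrr_sign scale1r.
  rewrite {1}/lmul wedgeZr -/(lmul b _) resZ lmul_anti.
  rewrite resZ res_lmul_a atom_mulZ -proj_lmul; congr (_ *: _).
  by rewrite (morphBN resB) res_lmul_a bar_lmul (morphBN projB) opprK.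
rewrite res_mono (negPf aS) atom_mul0r /ext_res; apply: big1 => I aI.
rewrite lmulE ffunE; case: ifP => bI; last by rewrite mul0r scale0r.
case: eqVneq => [e|_]; last by rewrite mulr0 mul0r scale0r.
by move: aS; rewrite -e !inE aI eq_sym ba.
Qed.

Lemma res_notin s : a \notin s -> ext_res a (ext_prod R s) = 0.
Proof.
elim: s => [_|b s IH]; first by rewrite /= res_mono inE.
rewrite inE negb_or eq_sym => /andP[ba /IH e].
by rewrite /= res_lmul // e atom_mul0r.
Qed.

Lemma atom_gen_rep b x : b != a -> x \in val b ->
  atom_gen R M' (val b) = atom_gen R M' [set x].
Proof.
move=> ba xb; rewrite /atom_gen; apply: eq_bigl => c.
apply/idP/idP=> [bc|]; first by rewrite sub1set (subsetP bc).
rewrite sub1set => xc; apply/subsetP=> y yb.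
have [bE _ _] := atom_flat b; have [cE _ _] := atom_flat c.
have yE : y \in ground M'.
  rewrite inE (subsetP bE) // andbT; apply: contra ba => ya.
  by apply/eqP; apply: (atom_eq mat ll yb ya).
have xE := subsetP cE _ xc.
rewrite (atom_par mat' ll' xc) !inE /= -in_setD yE /=.
move: yb; rewrite (atom_par mat ll xb) inE => /andP[_ /predU1P[->|dxy]]; first by rewrite eqxx.
apply/orP; right; apply: contra dxy; rewrite contract_indep_rep; last first.
  by rewrite subUset !sub1set xE.
by apply: (indS mat); apply: subsetUr.
Qed.

Lemma img_rep s : a \notin s -> img s = ext_seq R M' (map (@rep T M) s).
Proof.
elim: s => //= b s IH; rewrite inE negb_or eq_sym => /andP[ba /IH e].
by rewrite e /atom_mul (atom_gen_rep ba (rep_mem b)).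
Qed.

Lemma rep_contract s : a \notin s -> {subset map (@rep T M) s <= ground M'}.
Proof.
move=> as_ x /mapP[b bs ->]; rewrite inE rep_in andbT.
by apply: contra as_ => ra; rewrite (atom_eq mat ll ra (rep_mem b)).
Qed.

Lemma img_ideal s : a \notin s -> ~~ indep M (rep a |: [set x in map (@rep T M) s]) ->
  in_OS_ideal (img s) /\ in_OS_ideal (delete_sum img s).
Proof.
move=> as_ nind; have sE := rep_contract as_.
have nds : ~~ (uniq (map (@rep T M) s) && indep M' [set x in map (@rep T M) s]).
  rewrite negb_and contract_indep_rep ?nind ?orbT //.
  by apply/subsetP=> x; rewrite inE => /sE.
have [I1 I2] := OS_ideal_seq mat' ll' R sE nds; rewrite img_rep //; split=> //.
rewrite (@eq_delete_sum_in _ _ _ (fun t => ext_seq R M' (map (@rep T M) t))).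
  by rewrite -delete_sum_map.
by move=> t ts; apply: img_rep; apply: contra as_; apply: ts.
Qed.

Lemma bar_delete (S : {set atom M}) : exists k : R,
  bar (delete_sum (@ext_prod R (atom M)) (enum S))
    = k *: delete_sum (@ext_prod R (atom M)) (enum S).
Proof.
have [k Hk] := bar_bdry R S; exists k; move: Hk.
rewrite bdry_prod -scaleNr barZ scalerA [k * _]mulrC -scalerA.
move/(congr1 (fun w => - (-1) ^+ #|S| *: w)).
have sq : - (-1) ^+ #|S| * - (-1) ^+ #|S| = 1 :> R.
  by rewrite mulrNN -expr2 sqrr_sign.
by rewrite ![- _ *: (- _ *: _)]scalerA sq !scale1r.
Qed.

(** Multiplication by [e_a] turns the residue into [proj] of [bar], so membership of the residue
    alone is not inherited. The predicate [J] follows [proj] and the residue, before and after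
    [bar], and is an ideal. *)
Lemma res_ideal u : in_OS_ideal u -> in_OS_ideal (ext_res a u).
Proof.
pose J w := [/\ in_OS_ideal (proj w), in_OS_ideal (ext_res a w),
  in_OS_ideal (proj (bar w)) & in_OS_ideal (ext_res a (bar w))].
have JZ k w : J w -> J (k *: w).
  by case=> *; split; rewrite ?barZ ?projZ ?resZ; apply: OS_idealZ.
move=> Iu; suff [] : J u by [].
apply: Iu => [|S dS].
  apply: ideal_of_lmul => //.
  - by rewrite /J bar0 (morphB0 projB) (morphB0 resB); split; apply: OS_ideal0.
  - move=> v w [v1 v2 v3 v4] [w1 w2 w3 w4].
    by split; rewrite ?barB ?projB ?resB; apply: OS_idealB.
  - by move=> w [w1 w2 w3 w4]; split; rewrite ?barK.
  move=> b w [w1 w2 w3 w4]; rewrite /J bar_lmul (morphBN projB) (morphBN resB) !proj_lmul.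
  have [->|ba] := eqVneq b a.
    rewrite !res_lmul_a barK !atom_mul_a oppr0.
    by split=> //; [apply: OS_ideal0 | apply: OS_ideal0 | apply: OS_idealN].
  by rewrite !res_lmul //; split; try apply: OS_idealN; apply: OS_ideal_wedge.
pose ds := delete_sum (@ext_prod R (atom M)).
(* On a generator of the ideal [bar] acts by a scalar, so two of the four conditions suffice. *)
suff [I1 I2] : in_OS_ideal (proj (ds (enum S))) /\ in_OS_ideal (ext_res a (ds (enum S))).
  rewrite bdry_prod -scaleNr; apply: JZ; have [k Hk] := bar_delete S.
  by split=> //; rewrite Hk ?projZ ?resZ; apply: OS_idealZ.
have nrep := dependent_rep mat ll dS.
have [aS|aS] := boolP (a \in S); last first.
  have aS' : a \notin enum S by rewrite mem_enum.
  split.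
    rewrite /ds (delete_sum_morph projB).
    rewrite (eq_delete_sum _ proj_prod); have [|//] := img_ideal aS'.
    by apply: contra nrep; apply: (indS mat); apply: subsetUr.
  rewrite /ds (delete_sum_morph resB).
  rewrite (@eq_delete_sum_in _ _ _ (fun=> 0)) => [|t ts].
    by rewrite delete_sum0 //; apply: OS_ideal0.
  by apply: res_notin; apply: contra aS'; apply: ts.
have aS' : a \notin enum (S :\ a) by rewrite mem_enum !inE eqxx.
have [|I1 I2] := img_ideal aS'.
  apply: contra nrep; apply: (indS mat); apply/subsetP=> x.
  rewrite !inE => /mapP[b]; rewrite mem_enum => bS ->.
  have [->|ba] := eqVneq b a; first by rewrite eqxx.
  by apply/orP; right; apply/mapP; exists b; rewrite // mem_enum !inE ba.
have [p Hp] := alternating_perm (perm_enumD1 aS).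
have := Hp _ _ ds (@opprK _) (delete_sum_alt (@ext_prod_alt R (atom M))) [::].
move=> /= ->.
suff [H1 H2] : in_OS_ideal (proj (ds (a :: enum (S :\ a))))
    /\ in_OS_ideal (ext_res a (ds (a :: enum (S :\ a)))).
  by case: (p); rewrite ?(morphBN projB) ?(morphBN resB); split=> //; apply: OS_idealN.
(* With [a] in front and [t] listing [S :\ a], the sum is [e_t] minus [e_a] times the sum for [t]:
   [proj] kills the second term and the residue the first. *)
rewrite /ds /= -(delete_sum_morph (lmulB a)).
rewrite projB resB proj_prod proj_lmul atom_mul_a subr0 res_notin // sub0r res_lmul_a.
split=> //; apply: OS_idealN; have [k ->] := bar_delete (S :\ a); rewrite projZ; apply: OS_idealZ.
by rewrite (delete_sum_morph projB) (eq_delete_sum _ proj_prod).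
Qed.

Lemma Res_pi u : Res a (OSpi u) = OSpi (ext_res a u).
Proof.
apply/OSpi_eq; rewrite -resB; apply: res_ideal; apply/OSpi_eq.
by rewrite /OSrepr /OSpi reprK.
Qed.

Lemma ResB : {morph @Res R T M a : w1 w2 / w1 - w2}.
Proof.
move=> w1 w2.
have e (w : OS R M) : w = OSpi (OSrepr w) by rewrite /OSrepr /OSpi reprK.
by rewrite (e w1) (e w2) -OSpiB !Res_pi resB OSpiB.
Qed.

Lemma Res_sact e (w : OS R M) : Res a (sact e w) = sact e (Res a w).
Proof. by case: e; rewrite //= ?(morphB0 ResB) ?(morphBN ResB). Qed.

Lemma Res_seq (s : seq T) x : {subset s <= ground M'} -> x \in val a ->
  Res a (OSe R M (rcons s x)) = OSe R M' s.
Proof.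
move=> sE xa; rewrite Res_pi; congr OSpi; elim: s sE => [|y s IH] sE /=.
  rewrite (@atom_gen_mono _ _ mat ll _ _ a) ?sub1set //; last first.
    by apply/set0Pn; exists x; rewrite inE.
  rewrite -/(lmul a _) res_lmul_a -[ext1 _ _]/(ext_prod R [::]) bar_prod scale1r.
  exact: proj_prod.
have := sE y (mem_head _ _); rewrite inE => /andP[ya yE].
pose b := atom_at a y; have yb : y \in val b by apply: mem_atom_at.
have ba : b != a by apply: contraNneq ya => <-.
rewrite (@atom_gen_mono _ _ mat ll _ _ b) ?sub1set //; last first.
  by apply/set0Pn; exists y; rewrite inE.
rewrite -/(lmul b _) res_lmul // IH => [|z zs]; last by apply: sE; rewrite inE zs orbT.
by rewrite /atom_mul (atom_gen_rep ba yb).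
Qed.

Lemma Res_seq0 (s : seq T) : {subset s <= ground M'} -> Res a (OSe R M s) = 0.
Proof.
move=> sE'; have sE : {subset s <= ground M} by move=> x /sE'; rewrite inE => /andP[].
rewrite Res_pi (ext_seq_at mat ll R a sE) res_notin ?(morphB0 (@OSpiB _ _ _)) //.
apply/negP=> /mapP[x xs e]; have := sE' x xs; rewrite inE e mem_atom_at ?sE //.
Qed.
End Algebra.
End Residue.

(** * From circuits and chirotopes to oriented matroids *)

Notation om_oriented N r chi :=
  (oriented (ground N) r (indep N) (fun C => C \in circuits N) chi).

Section Circuits.
Variables (T : finType) (M : om T).
Hypothesis omM : oriented_matroid M.
Local Notation E := (ground M).
Implicit Types (A B I J S : {set T}) (X Y Z C : signvec T) (s : seq T).

Let suppE X : X \in circuits M -> supp X \subset E.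
Proof. by case: omM => H _ _ _ _; apply: H. Qed.

Let circ_opp X : X \in circuits M -> svopp X \in circuits M.
Proof. by case: omM => _ _ H _ _; apply: H. Qed.

Let circ_incl X Y : X \in circuits M -> Y \in circuits M -> supp X \subset supp Y ->
  X = Y \/ X = svopp Y.
Proof. by case: omM => _ _ _ H _; apply: H. Qed.

Lemma svoppK X : svopp (svopp X) = X.
Proof. by apply/ffunP=> i; rewrite !ffunE soppK. Qed.

Lemma circ_sign X e x : X \in circuits M -> e \in supp X -> x != Zero ->
  exists Y, [/\ Y \in circuits M, supp Y = supp X & Y e = x].
Proof.
move=> XC; rewrite inE => Xe x0; have [Xx|Xx] := eqVneq (X e) x; first by exists X.
exists (svopp X); rewrite supp_opp ffunE; split=> //; first exact: circ_opp.
by case: (X e) x Xe x0 Xx => [] [].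
Qed.

(** The axiom eliminates where [X] is [Pos] and [Y] is [Neg]; exchanging the two circuits covers the
    other case. *)
Lemma signed_elim X Y e : X \in circuits M -> Y \in circuits M -> X <> svopp Y ->
  X e != Zero -> Y e = sopp (X e) ->
  exists Z, [/\ Z \in circuits M, Z e = Zero
    & forall g, Z g != Zero -> Z g = X g \/ Z g = Y g].
Proof.
have main X' Y' : X' \in circuits M -> Y' \in circuits M -> X' <> svopp Y' ->
    X' e = Pos -> Y' e = Neg -> exists Z, [/\ Z \in circuits M, Z e = Zero
      & forall g, Z g != Zero -> Z g = X' g \/ Z g = Y' g].
  move=> X'C Y'C nXY Xe Ye; case: omM => _ _ _ _ /(_ _ _ e X'C Y'C nXY).
  rewrite !inE Xe Ye => /(_ isT)[Z ZC [/subsetP Zp /subsetP Zn]].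
  exists Z; split=> // [|g].
    by have := Zp e; have := Zn e; rewrite !inE eqxx; case: (Z e) => // [/(_ isT)|_ /(_ isT)].
  case Zg: (Z g) => // _.
    by have := Zn g; rewrite !inE Zg => /(_ isT)/andP[_ /orP[]/eqP->]; [left|right].
  by have := Zp g; rewrite !inE Zg => /(_ isT)/andP[_ /orP[]/eqP->]; [left|right].
move=> XC YC nXY; case Xe: (X e) => // _ Ye.
  have [|Z [ZC Ze Zg]] := main Y X YC XC _ Ye Xe.
    by move=> e'; apply: nXY; rewrite e' svoppK.
  by exists Z; split=> // g /Zg []; [right|left].
exact: main.
Qed.

Lemma weak_elim X Y e : X \in circuits M -> Y \in circuits M -> supp X != supp Y ->
  e \in supp X -> e \in supp Y ->
  exists2 Z, Z \in circuits M & supp Z \subset (supp X :|: supp Y) :\ e.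
Proof.
move=> XC YC nXY Xe Ye; have Xe0 : X e != Zero by rewrite inE in Xe.
have [|Y' [Y'C sY Y'e]] := circ_sign (x := sopp (X e)) YC Ye; first by rewrite sopp_eq0.
have [|Z [ZC Ze Zg]] := signed_elim XC Y'C _ Xe0 Y'e.
  by move=> e'; move: nXY; rewrite e' supp_opp sY eqxx.
exists Z => //; apply/subsetP=> g; rewrite -sY !inE => nz.
have -> : g != e by apply: contraNneq nz => ->; rewrite Ze.
by case: (Zg g nz) => <-; rewrite nz ?orbT.
Qed.

Lemma indepP I : reflect (I \subset E /\ forall X, X \in circuits M -> ~~ (supp X \subset I))
  (indep M I).
Proof. by apply: (iffP andP) => -[IE /forall_inP]. Qed.

Lemma dep_circ I : I \subset E -> ~~ indep M I ->
  exists2 X, X \in circuits M & supp X \subset I.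
Proof.
by move=> IE; rewrite /indep IE /= => /forall_inPn[X XC]; rewrite negbK; exists X.
Qed.

Lemma indep_subset I J : I \subset J -> indep M J -> indep M I.
Proof.
move=> IJ /indepP[JE nJ]; apply/indepP; split; first exact: subset_trans IJ JE.
by move=> X /nJ; apply: contra => XI; apply: subset_trans XI IJ.
Qed.

Lemma circ_uniq I e X Y : indep M I -> X \in circuits M -> Y \in circuits M ->
  supp X \subset e |: I -> supp Y \subset e |: I -> supp X = supp Y.
Proof.
move=> iI XC YC XI YI; apply/eqP/negPn/negP => nXY.
have mem Z : Z \in circuits M -> supp Z \subset e |: I -> e \in supp Z.
  move=> ZC ZI; apply: contraT => eZ; have /indepP[_ /(_ Z ZC)] := iI.
  suff -> : supp Z \subset I by [].
  apply/subsetP=> x xZ; have := subsetP ZI _ xZ; rewrite !inE => /predU1P[xe|//].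
  by rewrite -xe xZ in eZ.
have [Z ZC ZS] := weak_elim XC YC nXY (mem X XC XI) (mem Y YC YI).
have /indepP[_ /(_ Z ZC) /negP] := iI; apply; apply: (subset_trans ZS).
by rewrite subDset subUset XI.
Qed.

Lemma indep_exchange I e X f : indep M I -> e \in E -> X \in circuits M ->
  supp X \subset e |: I -> f \in supp X -> indep M ((e |: I) :\ f).
Proof.
move=> iI eE XC XI fX; have /indepP[IE _] := iI; apply/indepP; split.
  by apply: subset_trans (subsetDl _ _) _; rewrite subUset sub1set eE.
move=> Z ZC; apply/negP=> ZI.
have ZI' : supp Z \subset e |: I by apply: subset_trans ZI (subsetDl _ _).
have eZX := circ_uniq iI ZC XC ZI' XI.
by have := subsetP ZI f; rewrite eZX in_setD1 eqxx => /(_ fX).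
Qed.

(** Augmentation is proved by induction on [#|I :\: J|]: an element [e] of [I :\: J] is added to
    [J], and if this creates a circuit, an element of it outside [I] is removed. Since [e] is in
    [I], whatever augments [I] from the new set comes from [J]. *)
Lemma circuits_matroid : matroid (indep M).
Proof.
split.
- apply/indepP; split=> [|X XC]; first exact: sub0set.
  rewrite subset0; apply: contraTneq XC => X0; case: omM => _ H _ _ _.
  suff -> : X = svzero T by [].
  by apply/ffunP=> i; rewrite ffunE; apply: notin_supp; rewrite X0 inE.
- exact: indep_subset.
move=> I J; have [n] := ubnP #|I :\: J|; elim: n J => // n IH J ltn iI iJ lt.
case: (set_0Vmem (I :\: J)) => [IJ|[e]].
  have IsJ : I \subset J by rewrite -setD_eq0 IJ.
  have : I \proper J by rewrite properEcard IsJ.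
  case/properP=> _ [x xJ xI]; exists x; first by rewrite inE xI.
  by apply: indep_subset iJ; rewrite subUset sub1set xJ.
rewrite inE => /andP[eJ eI].
have /indepP[IE _] := iI; have /indepP[JE nJ] := iJ; have eE := subsetP IE _ eI.
have small J' : J' \subset e |: J -> e \in J' -> I :&: J \subset J' -> #|I :\: J'| < n.
  move=> J'S eJ' IJJ'; apply: leq_trans (_ : #|I :\: J| <= n); last by [].
  apply/proper_card/properP; split; last by exists e; rewrite !inE ?eJ ?eJ'.
  apply/subsetP=> x; rewrite !inE => /andP[xJ' xI]; rewrite xI andbT.
  by apply: contra xJ' => xJ; apply: (subsetP IJJ'); rewrite inE xI.
have back x J' : J' \subset e |: J -> x \in J' :\: I -> x \in J :\: I.
  move=> J'S; rewrite !inE => /andP[xI xJ']; rewrite xI.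
  have := subsetP J'S _ xJ'; rewrite !inE => /predU1P[xe|//].
  by rewrite xe eI in xI.
have [ieJ|/dep_circ] := boolP (indep M (e |: J)).
  have [||x xS ix] := IH (e |: J) _ iI ieJ.
  - by apply: small; rewrite ?subxx ?setU11 // subIset ?subsetUr ?orbT.
  - by rewrite cardsU1 eJ; apply: leq_trans lt _; rewrite leq_addl.
  by exists x => //; apply: back xS.
rewrite subUset sub1set eE JE => /(_ isT)[X XC XJ].
have [f fX fI] : exists2 f, f \in supp X & f \notin I.
  by apply/subsetPn; have /indepP[_ /(_ X XC)] := iI.
have fe : f != e by apply: contraNneq fI => ->.
have fJ : f \in J by have := subsetP XJ _ fX; rewrite !inE (negPf fe).
have iJ' := indep_exchange iJ eE XC XJ fX.
have [||x xS ix] := IH ((e |: J) :\ f) _ iI iJ'.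
- apply: small; first exact: subsetDl.
    by rewrite !inE eqxx eq_sym fe.
  apply/subsetP=> x; rewrite !inE => /andP[xI ->]; rewrite orbT andbT.
  by apply: contraNneq fI => <-.
- by have := cardsD1 f (e |: J); rewrite !inE fJ orbT cardsU1 eJ !add1n => -[<-].
by exists x => //; apply: back xS; apply: subsetDl.
Qed.

Let mat := circuits_matroid.

(** * Orthogonality of circuits and cocircuits from the pivoting property *)

Section Chirotope.
Variables (chi0 : seq T -> sign).
Hypothesis chiM : chirotope M chi0.
Local Notation r := (rank M E).

(** [chi0] is only meaningful on sequences of length [r] in [E]. *)
Definition normalize s := if (size s == r) && all (mem E) s then chi0 s else Zero.
Local Notation chi := normalize.

Lemma normalizeE s : size s = r -> {subset s <= E} -> chi s = chi0 s.
Proof. by move=> sr /allP sE; rewrite /chi sr eqxx /= sE. Qed.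

(** The axiom speaks of permutations of tuples; the exchange of neighbours is the transposition of
    the positions [size s1] and [(size s1).+1]. *)
Lemma normalize_alt : alternating sopp chi.
Proof.
move=> s1 x y s2; rewrite /chi !size_cat !all_cat /= [mem E x && _]andbCA.
case: ifP => // /andP[/eqP sr /and4P[s1E yE xE s2E]].
case: chiM => _ H _.
have szt : size (s1 ++ y :: x :: s2) == r by rewrite size_cat sr.
have lti : size s1 < r by rewrite -sr -addn1 leq_add2l.
have ltj : (size s1).+1 < r by rewrite -sr -addn1 ltn_add2l.
have := H (Tuple szt) (tperm (Ordinal lti) (Ordinal ltj)).
rewrite odd_tperm => /(_ _) e.
have {}e := e _; rewrite -val_eqE /= (ltn_eqF (ltnSn _)) /= in e.
rewrite -e => [|z]; last first.
  by rewrite mem_cat !inE => /or4P[/(allP s1E)|/eqP->|/eqP->|/(allP s2E)].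
congr chi0; apply: (@eq_from_nth _ x).
  by rewrite size_map size_enum_ord size_cat /= sr.
move=> k ltk; have ltkr : k < r by rewrite -sr -[X in _ < X](size_cat s1 [:: x, y & s2]).
rewrite (_ : k = Ordinal ltkr) // nth_mktuple (tnth_nth x) /=.
case: tpermP => [/(congr1 val)/=->|/(congr1 val)/=->|nki nkj] /=.
- by rewrite !nth_cat ltnn subnn ltnNge leqnSn /= subSnn.
- by rewrite !nth_cat ltnn subnn ltnNge leqnSn /= subSnn.
have {}nki : k <> size s1 by move=> e'; apply: nki; apply: val_inj.
have {}nkj : k <> (size s1).+1 by move=> e'; apply: nkj; apply: val_inj.
rewrite !nth_cat; case: ltnP => // le.
case: (k - size s1) (subnKC le) => [|[|m]] //= e'; exfalso.
  by apply: nki; rewrite -e' addn0.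
by apply: nkj; rewrite -e' addn1.
Qed.
Lemma rank_base : exists B, [/\ B \subset E, indep M B & #|B| = r].
Proof.
have nonempty : 0 < #|[pred I : {set T} | indep M I && (I \subset E)]|.
  by apply/card_gt0P; exists set0; rewrite inE sub0set (ind0 mat).
have [B] := eq_bigmax_cond (fun I : {set T} => #|I|) nonempty.
by rewrite inE => /andP[iB BE] rB; exists B; split.
Qed.

Lemma rank_max I : indep M I -> #|I| <= r.
Proof. by move=> iI; apply: rank_ge => //; case/indepP: iI. Qed.

Lemma normalize_neq0 s : {subset s <= E} ->
  (chi s != Zero) = [&& size s == r, uniq s & indep M [set x in s]].
Proof.
move=> sE; have [sr|] := eqVneq (size s) r; last by rewrite /chi => /negPf->.
rewrite normalizeE //; case: chiM => -> // _ _; rewrite /ordered_basis /basis.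
by have [us|//] := boolP (uniq s); rewrite cardsE (card_uniqP us) sr eqxx andbT.
Qed.

Lemma normalize_cons e A : e \in E -> A \subset E ->
  (chi (e :: enum A) != Zero) = [&& #|A|.+1 == r, e \notin A & indep M (e |: A)].
Proof.
move=> eE AE; rewrite normalize_neq0 => [|x]; last first.
  by rewrite inE mem_enum => /predU1P[->|/(subsetP AE)].
rewrite /= size_enum mem_enum enum_uniq andbT; congr [&& _, _ & indep M _].
by apply/setP=> x; rewrite !inE mem_enum.
Qed.

Lemma pivot e f s C : e != f -> {subset [:: e, f & s] <= E} ->
  chi (e :: s) != Zero -> chi (f :: s) != Zero -> C \in circuits M ->
  supp C \subset [set x in [:: e, f & s]] ->
  chi (f :: s) = sopp (smul (smul (C e) (C f)) (chi (e :: s))).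
Proof.
move=> ef sE ye yf CC CS.
have eE : {subset e :: s <= E}.
  by move=> x; rewrite inE => xs; apply: sE; rewrite !inE; case/predU1P: xs => ->; rewrite ?eqxx ?orbT.
have fE : {subset f :: s <= E} by move=> x xs; apply: sE; rewrite inE xs orbT.
move: (ye) (yf); rewrite !normalize_neq0 //.
move=> /and3P[/eqP er eu ei] /and3P[/eqP fr fu fi].
rewrite !normalizeE //; case: chiM => _ _; apply=> //.
  by rewrite /ordered_basis eu /basis ei cardsE (card_uniqP eu) er eqxx.
by rewrite /ordered_basis fu /basis fi cardsE (card_uniqP fu) fr eqxx.
Qed.

Lemma exchange_neq0 A c d D e : A \subset E -> c \in E -> c \notin A -> D \in circuits M ->
  supp D \subset c |: A -> d \in supp D -> d \in A -> e \in E ->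
  chi (e :: enum A) != Zero -> chi (e :: enum (c |: (A :\ d))) != Zero.
Proof.
move=> AE cE cA DC DA dD dA eE.
have cAd : c \notin A :\ d by rewrite !inE negb_and cA orbT.
have A1E : c |: (A :\ d) \subset E.
  by rewrite subUset sub1set cE; apply: subset_trans AE; apply: subsetDl.
rewrite !normalize_cons // => /and3P[cr eA ie]; rewrite cardsU1 cAd.
have -> : (~~ false + #|A :\ d|)%N = #|A| by rewrite (cardsD1 d A) dA.
have DB : supp D \subset c |: (e |: A).
  by apply: subset_trans DA _; apply: setUS; apply: subsetUr.
have ed : e != d by apply: contraNneq eA => ->.
have ec : e != c.
  apply/negP=> /eqP ec; case/indepP: ie => _ /(_ D DC) /negP; apply.
  by rewrite ec.
rewrite cr !inE negb_or ec ed eA /=.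
have := indep_exchange ie cE DC DB dD.
suff -> : (c |: (e |: A)) :\ d = e |: (c |: A :\ d) by [].
apply/setP=> x; rewrite !inE; have [->|xd] := eqVneq x d.
  have dc : d != c by apply: contraNneq cA => <-.
  by rewrite /= eq_sym (negPf ed) (negPf dc).
by rewrite /= orbCA.
Qed.

(** Pivoting compares the chirotope at [d], [e], [S] and at [c], [e], [S] through the signs of [D]
    at [c] and [d], which do not involve [e]. The bits [b1] and [b2] account for the orders of
    enumeration. *)
Lemma exchange_sign A c d D : A \subset E -> c \in E -> c \notin A -> D \in circuits M ->
  supp D \subset c |: A -> c \in supp D -> d \in supp D -> d \in A ->
  exists b : bool, forall e, e \in E -> chi (e :: enum (c |: (A :\ d)))
    = if b then sopp (chi (e :: enum A)) else chi (e :: enum A).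
Proof.
move=> AE cE cA DC DA cD dD dA; pose S := A :\ d.
have cS : c \notin S by rewrite !inE negb_and cA orbT.
have cd : c != d by apply: contraNneq cA => ->.
have dE := subsetP AE _ dA; have SE : S \subset E := subset_trans (subsetDl _ _) AE.
have back : d |: ((c |: S) :\ c) = A by rewrite setU1K // setD1K.
have [b1 H1] := alternating_perm (perm_enumD1 dA).
have [b2 H2] := alternating_perm (perm_enumU1 cS).
have {}H1 e : chi (e :: enum A) = if b1 then chi (d :: e :: enum S) else sopp (chi (d :: e :: enum S)).
  rewrite (H1 _ _ _ soppK normalize_alt [:: e]).
  by rewrite (normalize_alt [::] e) /= soppK.
have {}H2 e : chi (e :: enum (c |: S)) = if b2 then chi (c :: e :: enum S) else sopp (chi (c :: e :: enum S)).
  rewrite (H2 _ _ _ soppK normalize_alt [:: e]).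
  by rewrite (normalize_alt [::] e) /= soppK.
suff piv e : e \in E -> chi (c :: e :: enum S)
    = if D d == D c then sopp (chi (d :: e :: enum S)) else chi (d :: e :: enum S).
  exists (b1 (+) b2 (+) (D d == D c)) => e eE; rewrite -/S H1 H2 piv //.
  by case: (b1); case: (b2); case: (_ == _); rewrite /= ?soppK.
move=> eE; have fwd := @exchange_neq0 A c d D e AE cE cA DC DA dD dA eE.
have bwd : chi (e :: enum (c |: S)) != Zero -> chi (e :: enum A) != Zero.
  rewrite -{1}back; apply: (@exchange_neq0 _ _ _ D) => //.
  - by rewrite subUset sub1set cE.
  - by rewrite !inE eqxx eq_sym (negPf cd).
  - by rewrite setUCA setD1K.
  - exact: setU11.
rewrite -/S H1 H2 in fwd; rewrite H1 H2 in bwd.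
have [z|nz] := eqVneq (chi (d :: e :: enum S)) Zero.
  rewrite z /=; have [->|nz'] := eqVneq (chi (c :: e :: enum S)) Zero; first by case: ifP.
  move: bwd; rewrite z; have -> : (if b1 then Zero else sopp Zero) = Zero by case: (b1).
  by move=> /(_ _)/eqP; case; case: (b2); rewrite ?sopp_eq0.
have nz' : chi (c :: e :: enum S) != Zero.
  by move: fwd; case: (b1); case: (b2); rewrite ?sopp_eq0; apply.
have dc : d != c by rewrite eq_sym.
rewrite (@pivot d c (e :: enum S) D) //.
- by move: cD dD; rewrite !inE; case: (D c) => // _; case: (D d) => // _; case: (chi _).
- move=> x; rewrite !inE mem_enum => /or4P[/eqP->|/eqP->|/eqP->|/(subsetP SE)] //.
apply: subset_trans DA _; rewrite -(setD1K dA); apply/subsetP=> x; rewrite !inE mem_enum !inE.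
by case/or3P=> ->; rewrite ?orbT.
Qed.

(** One element at a time is exchanged towards [A']: the circuit in [c |: A] has an element [d]
    outside the independent set [A'], and [d] gives way to [c]. *)
Lemma hyper_sign A A' : A \subset E -> A' \subset E -> indep M A -> indep M A' ->
  #|A|.+1 = r -> #|A'|.+1 = r -> (forall x, x \in A' -> chi (x :: enum A) = Zero) ->
  exists b : bool, forall e, e \in E ->
    chi (e :: enum A') = if b then sopp (chi (e :: enum A)) else chi (e :: enum A).
Proof.
have [n] := ubnP #|A' :\: A|; elim: n A => // n IH A ltn AE A'E iA iA' cA cA' z.
case: (set_0Vmem (A' :\: A)) => [AA|[c]].
  have -> : A' = A; last by exists false.
  by apply/eqP; rewrite eqEcard -setD_eq0 AA eqxx -ltnS cA cA' /=.
rewrite inE => /andP[cA0 cA'0]; have cE := subsetP A'E _ cA'0.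
have dep : ~~ indep M (c |: A).
  by apply/negP=> ic; have /eqP := z c cA'0; apply/negP; rewrite normalize_cons // cA eqxx cA0.
have [|D DC DA] := dep_circ _ dep; first by rewrite subUset sub1set cE.
have [d dD dA'] : exists2 d, d \in supp D & d \notin A'.
  by apply/subsetPn; case/indepP: iA' => _ /(_ D DC).
have dA : d \in A.
  have := subsetP DA _ dD; rewrite in_setU1 => /predU1P[dc|//].
  by rewrite dc cA'0 in dA'.
have cD : c \in supp D.
  apply: contraT => cD; case/indepP: iA => _ /(_ D DC) /negP; case.
  apply/subsetP=> x xD; have := subsetP DA _ xD; rewrite in_setU1 => /predU1P[xc|//].
  by rewrite -xc xD in cD.
have [b1 H1] := exchange_sign AE cE cA0 DC DA cD dD dA.
have iA1 := indep_exchange iA cE DC DA dD.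
have cd : c != d by apply: contraNneq dA' => <-.
have eA1 : (c |: A) :\ d = c |: (A :\ d).
  apply/setP=> x; rewrite !inE; have [->|//] := eqVneq x d.
  by rewrite eq_sym (negPf cd).
rewrite eA1 in iA1.
have [||||b2 H2] := IH (c |: (A :\ d)) _ _ A'E iA1 iA' _ cA'.
- apply: leq_trans (_ : #|A' :\: A| <= n); last by [].
  apply/proper_card/properP; split.
    apply/subsetP=> x; rewrite !inE !negb_or !negb_and negbK => /andP[/andP[xc xdA] xA'].
    rewrite xA' andbT; case/orP: xdA => // /eqP xd.
    by rewrite -xd xA' in dA'.
  by exists c; rewrite !inE ?eqxx ?cA0.
- by rewrite subUset sub1set cE; apply: subset_trans AE; apply: subsetDl.
- have cAd : c \notin A :\ d by rewrite !inE negb_and cA0 orbT.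
  by rewrite cardsU1 cAd -cA (cardsD1 d A) dA.
- by move=> x xA'; rewrite H1 ?(subsetP A'E) // z //; case: (b1).
exists (b1 (+) b2) => e eE; rewrite H2 // H1 //.
by case: (b1); case: (b2); rewrite /= ?soppK.
Qed.

(** Induction on the number of elements of [C] off the hyperplane [H]. If [e] is one, there is
    another one [f], and a circuit [D] through both, otherwise in [H], with [D e] opposite to [C e];
    pivoting gives [D f = C f]. Eliminating [e] creates no new sign off [H], so by induction the
    resulting circuit lies in [H], and in fact in a basis [J] of [H] chosen to contain
    [supp C :&: H], which is absurd. *)
Lemma circuit_orth C A : C \in circuits M -> A \subset E -> indep M A -> #|A|.+1 = r ->
  (forall e, smul (C e) (chi (e :: enum A)) != Neg) ->
  forall e, smul (C e) (chi (e :: enum A)) = Zero.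
Proof.
move=> CC AE iA cA; pose H := [set x in E | chi (x :: enum A) == Zero].
have AH : A \subset H.
  apply/subsetP=> x xA; rewrite inE (subsetP AE) //=; apply/negPn.
  by rewrite normalize_cons ?(subsetP AE) // xA andbF.
have maxA x : x \in H -> x \notin A -> ~~ indep M (x |: A).
  rewrite inE => /andP[xE /eqP z] xA; apply/negP => ix; move/eqP: z; apply/negP.
  by rewrite normalize_cons // cA xA ix eqxx.
have HE : H \subset E by apply/subsetP=> x; rewrite inE => /andP[].
have [n] := ubnP #|supp C :\: H|; elim: n C CC => // n IH C CC ltn nn.
case: (set_0Vmem (supp C :\: H)) => [C0 e|[e]].
  have [->//|Ce] := eqVneq (C e) Zero.
  have eC : e \in supp C by rewrite inE.
  have : supp C \subset H by rewrite -setD_eq0 C0.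
  move/subsetP/(_ e eC); rewrite inE => /andP[_ /eqP->].
  by case: (C e).
rewrite in_setD => /andP[eH eC]; have CE := suppE CC; have eE := subsetP CE _ eC.
have iI0 : indep M (supp C :&: H).
  apply/indepP; split; first by apply: subset_trans CE; apply: subsetIl.
  move=> Z ZC; apply/negP=> ZI; have ZsC := subset_trans ZI (subsetIl _ _).
  have eZ : supp Z = supp C.
    by case: (circ_incl ZC CC ZsC) => ->; rewrite ?supp_opp.
  by move: eC; rewrite -eZ => /(subsetP ZI); rewrite inE (negPf eH) andbF.
have [J [IJ JH iJ maxJ]] := ind_max (subsetIr _ _) iI0.
have cJA : #|J| = #|A|.
  apply/eqP; rewrite eqn_leq (ind_max_card mat maxA iA JH iJ) /=.
  exact: (ind_max_card mat maxJ iJ AH iA).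
have JE := subset_trans JH HE.
have cJ : #|J|.+1 = r by rewrite cJA.
have [b Hb] : exists b : bool, forall e, e \in E ->
    chi (e :: enum J) = if b then sopp (chi (e :: enum A)) else chi (e :: enum A).
  by apply: hyper_sign => // x /(subsetP JH); rewrite inE => /andP[_ /eqP].
have nzJ x : x \in E -> x \notin H -> chi (x :: enum J) != Zero.
  move=> xE; rewrite inE xE Hb //=.
  by case: (b); rewrite ?sopp_eq0.
have iout x : x \in E -> x \notin H -> x \notin J /\ indep M (x |: J).
  by move=> xE /(nzJ x xE); rewrite normalize_cons // => /and3P[].
have [eJ ieJ] := iout e eE eH.
have /subsetPn[f] : ~~ (supp C :\: H \subset [set e]).
  apply/negP=> sub; case/indepP: ieJ => _ /(_ C CC) /negP; apply.
  apply/subsetP=> x xC; rewrite in_setU1; have [xH|xH] := boolP (x \in H).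
    by rewrite (subsetP IJ) ?orbT // in_setI xC.
  by have := subsetP sub x; rewrite in_setD xH xC in_set1 => ->.
rewrite in_setD in_set1 => /andP[fH fC] fe.
have fE := subsetP CE _ fC; have [fJ ifJ] := iout f fE fH.
have dep : ~~ indep M (f |: (e |: J)).
  apply/negP=> /rank_max; rewrite !cardsU1 !inE negb_or fe fJ eJ !add1n cJ.
  by rewrite ltnn.
have eJE : e |: J \subset E by rewrite subUset sub1set eE.
have [|D0 D0C D0S] := dep_circ _ dep; first by rewrite subUset sub1set fE eJE.
have memD x y : x \notin H -> supp D0 \subset x |: (y |: J) ->
    indep M (y |: J) -> x \in supp D0.
  move=> xH DS iy; apply: contraT => xD; case/indepP: iy => _ /(_ D0 D0C) /negP; case.
  apply/subsetP=> z zD; have := subsetP DS _ zD; rewrite in_setU1 => /predU1P[zx|//].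
  by rewrite -zx zD in xD.
have fD0 : f \in supp D0 by apply: (memD f e).
have eD0 : e \in supp D0 by apply: (memD e f) => //; rewrite setUCA.
have [|D [DC sD De]] := circ_sign (x := sopp (C e)) D0C eD0; first by rewrite sopp_eq0; rewrite inE in eC.
have DS : supp D \subset f |: (e |: J) by rewrite sD.
have Df : D f != Zero by rewrite -sD inE in fD0.
have ye : chi (e :: enum A) != Zero by move: eH; rewrite inE eE.
have yf : chi (f :: enum A) != Zero by move: fH; rewrite inE fE.
(* The products at [e] and [f] are neither [Neg] nor [Zero], so [C] agrees with the cocircuit
   there. *)
have Ce : C e = chi (e :: enum A).
  by move: eC ye (nn e); rewrite inE; case: (C e); case: (chi _).
have Cf : C f = chi (f :: enum A).
  by move: fC yf (nn f); rewrite inE; case: (C f); case: (chi _).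
have DfE : D f = C f.
  have ef : e != f by rewrite eq_sym.
  have := @pivot e f (enum J) D ef _ (nzJ e eE eH) (nzJ f fE fH) DC.
  rewrite !Hb // Cf => H'; have {H'} : (if b then sopp (chi (f :: enum A)) else chi (f :: enum A)) =
       sopp (smul (smul (D e) (D f)) (if b then sopp (chi (e :: enum A)) else chi (e :: enum A))).
    apply: H'.
      move=> x; rewrite !inE mem_enum => /or3P[/eqP->|/eqP->|/(subsetP JE)] //.
    apply: subset_trans DS _; apply/subsetP=> x; rewrite !inE mem_enum.
    by rewrite orbCA.
  rewrite De Ce; move: ye yf Df; case: (b); case: (chi (e :: _)) => //;
  by case: (chi (f :: _)) => //; case: (D f).
have nCD : C <> svopp D.
  move/(congr1 (fun X : signvec T => X f)); rewrite ffunE DfE.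
  by move: fC; rewrite inE; case: (C f).
have [||Z [ZC Ze Zg]] := signed_elim CC DC nCD (e := e).
- by rewrite inE in eC.
- by [].
have ZS g : g \in supp Z -> (g \in supp C) || (g \in supp D).
  by rewrite !inE => nz; case: (Zg g nz) => <-; rewrite nz ?orbT.
have Dout g : g \in supp D -> g \notin H -> g != e -> g = f.
  move=> gD gH ge; have := subsetP DS _ gD; rewrite !in_setU1 (negPf ge) /=.
  by case/predU1P=> // /(subsetP JH); rewrite (negPf gH).
have zero : forall g, smul (Z g) (chi (g :: enum A)) = Zero.
  apply: (IH Z ZC).
    apply: leq_trans (_ : #|supp C :\: H| <= n); last by [].
    apply/proper_card/properP; split; last first.
      by exists e; rewrite !in_setD ?eH ?eC // inE Ze eqxx andbF.
    apply/subsetP=> g; rewrite !in_setD => /andP[gH gZ]; rewrite gH /=.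
    case/orP: (ZS g gZ) => // gD; rewrite (Dout g gD gH) //.
    by apply/negP=> /eqP ge; move: gZ; rewrite inE ge Ze.
  move=> g; have [gH|gH] := boolP (g \in H).
    by move: gH; rewrite inE => /andP[_ /eqP->]; case: (Z g).
  have [ge|ge] := eqVneq g e; first by rewrite ge Ze.
  have ZC' : Z g != Zero -> Z g = C g.
    move=> nz; have Dg : D g != Zero -> D g = C g.
      by move=> Dg; rewrite (Dout g _ gH ge) // inE.
    by case: (Zg g nz) => // ZD; rewrite ZD Dg // -ZD.
  by have [->//|/ZC'->] := eqVneq (Z g) Zero; apply: nn.
case/indepP: iJ => _ /(_ Z ZC) /negP; case; apply/subsetP=> g gZ.
have gE := subsetP (suppE ZC) _ gZ.
have gH : g \in H.
  apply: contraT; rewrite inE gE /= => yg; have := zero g; move: gZ yg; rewrite inE.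
  by case: (Z g); case: (chi _).
case/orP: (ZS g gZ) => [gC|gD]; first by apply: (subsetP IJ); rewrite inE gC.
have := subsetP DS _ gD; rewrite !in_setU1 => /or3P[/eqP gf|/eqP ge|//].
  by rewrite gf (negPf fH) in gH.
by rewrite ge (negPf eH) in gH.
Qed.

Theorem chirotope_oriented : om_oriented M r chi.
Proof.
split=> //.
- exact: rank_base.
- by move=> I _; apply: rank_max.
- exact: normalize_neq0.
- exact: normalize_alt.
- move=> C s CC CE sE sr nn e.
  have [/andP[us iss]|nds] := boolP (uniq s && indep M [set x in s]); last first.
    have [->//|Ce] := eqVneq (C e) Zero.
    suff -> : chi (e :: s) = Zero by case: (C e).
    apply/eqP; apply: contraNT nds; rewrite normalize_neq0 => [/= /and3P[_ /andP[_ ->] ie]|x].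
      by apply: indep_subset ie; apply/subsetP=> x; rewrite !inE => ->; rewrite orbT.
    rewrite inE => /predU1P[->|/sE//].
    by apply: (subsetP CE); rewrite inE.
  have ps : perm_eq s (enum [set x in s]).
    by apply: uniq_perm; rewrite ?enum_uniq // => x; rewrite mem_enum inE.
  have [b Hb] := alternating_perm ps.
  have {}Hb g : chi (g :: s) = if b then sopp (chi (g :: enum [set x in s]))
      else chi (g :: enum [set x in s]).
    exact: (Hb _ _ _ soppK normalize_alt [:: g]).
  have ssE : [set x in s] \subset E by apply/subsetP=> x; rewrite inE => /sE.
  have css : #|[set x in s]|.+1 = r by rewrite cardsE (card_uniqP us).
  case: b Hb => Hb; last first.
    by rewrite Hb; apply: circuit_orth => // g; rewrite -Hb.
  have eq g : smul (C g) (chi (g :: s)) = smul (svopp C g) (chi (g :: enum [set x in s])).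
    by rewrite Hb ffunE; case: (C g); case: (chi _).
  by rewrite eq; apply: circuit_orth; [exact: circ_opp|..] => // g; rewrite -eq.
move=> I h IE hE iI hI dep.
have [|X XC XS] := dep_circ _ dep; first by rewrite subUset sub1set hE.
suff hX : h \in supp X.
  by have [//|Y [YC sY Yh]] := circ_sign (x := Neg) XC hX; exists Y; rewrite sY.
apply: contraT => hX; case/indepP: iI => _ /(_ X XC) /negP; case.
apply/subsetP=> x xX; have := subsetP XS _ xX; rewrite in_setU1 => /predU1P[xh|//].
by rewrite -xh xX in hX.
Qed.
End Chirotope.
End Circuits.

(** * Reorientations, cocircuits and covectors *)

Section Generic.
Variable T : finType.
Implicit Types (A B I J S : {set T}) (X Y Z C P : signvec T) (s : seq T).

Lemma smul_opp x y : smul (sopp x) y = sopp (smul x y).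
Proof. by case: x; case: y. Qed.

Lemma reorient_vecK P : involutive (reorient_vec P).
Proof. by move=> C; apply/ffunP=> i; rewrite !ffunE; case: (i \in _); rewrite ?soppK. Qed.

Lemma supp_reorient P C : supp (reorient_vec P C) = supp C.
Proof. by apply/setP=> i; rewrite !inE ffunE; case: ifP; rewrite ?sopp_eq0. Qed.

Lemma circuits_reorient P (M : om T) C :
  (C \in circuits (reorient P M)) = (reorient_vec P C \in circuits M).
Proof.
apply/imsetP/idP=> [[X XM ->]|CM]; first by rewrite reorient_vecK.
by exists (reorient_vec P C); rewrite ?reorient_vecK.
Qed.

Lemma indep_reorient P (M : om T) : indep (reorient P M) = indep M.
Proof.
apply/funext=> I; rewrite /indep; congr andb; apply/forall_inP/forall_inP=> H C CM.
  by rewrite -(supp_reorient P); apply: H; rewrite circuits_reorient reorient_vecK.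
by rewrite -(supp_reorient P); apply: H; rewrite -circuits_reorient.
Qed.

Lemma rank_reorient P (M : om T) : rank (reorient P M) = rank M.
Proof. by rewrite /rank indep_reorient. Qed.

Lemma reorient_chi_cons P chi e s : e \notin s ->
  reorient_chi P chi (e :: s) = (if e \in negpart P then sopp else id)
    (if odd #|[set i in s] :&: negpart P| then sopp (chi (e :: s)) else chi (e :: s)).
Proof.
move=> es; rewrite /reorient_chi.
have -> : [set i in e :: s] :&: negpart P
    = (if e \in negpart P then [set e] else set0) :|: ([set i in s] :&: negpart P).
  apply/setP=> x; rewrite !inE; case: ifP => eP; rewrite !inE.
    by rewrite andb_orl; congr orb; case: eqVneq => // ->; rewrite eP.
  by rewrite andb_orl; case: eqVneq => // ->; rewrite eP.
have [eP|eP] := boolP (e \in negpart P); last by rewrite set0U.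
by rewrite cardsU1 !inE (negPf es) /=; case: (odd _); rewrite //= soppK.
Qed.

(** For fixed [s] the new cocircuit is the old one reoriented, up to the parity [b] of the entries
    of [s] in [negpart P]; [cocirc] absorbs this global sign. *)
Lemma oriented_reorient E r (ind : pred {set T}) (circ : pred (signvec T)) chi P :
  oriented E r ind circ chi ->
  oriented E r ind (fun C => circ (reorient_vec P C)) (reorient_chi P chi).
Proof.
move=> O; split; try by case: O.
- move=> s sE; rewrite -(o_chi O sE) /reorient_chi; case: ifP => _ //.
  by rewrite sopp_eq0.
- move=> s1 x y s2; rewrite /reorient_chi (o_alt O).
  have -> : [set i in s1 ++ x :: y :: s2] = [set i in s1 ++ y :: x :: s2].
    by apply/setP=> z; rewrite !inE !mem_cat !inE [(z == x) || _]orbCA.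
  by case: ifP.
- move=> C cC; rewrite (_ : reorient_vec P _ = svopp (reorient_vec P C)) ?(o_opp O) //.
  by apply/ffunP=> i; rewrite !ffunE; case: ifP.
- move=> C s cC CE sE sr; pose b := odd #|[set i in s] :&: negpart P|.
  have eq e : smul (C e) (reorient_chi P chi (e :: s))
      = smul (reorient_vec P C e) (cocirc chi b s e).
    have [es|es] := boolP (e \in s).
      have z : chi (e :: s) = Zero by apply: (chi_mem O).
      by rewrite /reorient_chi /cocirc z; do 2!case: ifP => _; case: (C e); case: (reorient_vec _ _ _).
    rewrite reorient_chi_cons // /cocirc -/b ffunE; case: (_ \in _); case: (b);
      by case: (C e); case: (chi _).
  move=> nn e; rewrite eq; apply: (orth_cocirc O) => // [|g]; first by rewrite supp_reorient.
  by rewrite -eq.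
move=> I h IE hE iI hI dep; have [C [cC CI Ch]] := o_circ O IE hE iI hI dep.
have oC : circ (svopp C) := o_opp O cC.
exists (if h \in negpart P then svopp (reorient_vec P C) else reorient_vec P C).
case: ifP => hP; rewrite ?supp_opp supp_reorient !ffunE hP Ch; split=> //; last by rewrite reorient_vecK.
rewrite (_ : reorient_vec P _ = svopp C) //.
by apply/ffunP=> i; rewrite !ffunE; case: (i \in _); rewrite ?soppK.
Qed.

Lemma orthogonalP C Y : reflect
  ((forall e, smul (C e) (Y e) = Zero) \/
   (exists e f, smul (C e) (Y e) = Pos /\ smul (C f) (Y f) = Neg))
  (Defs.orthogonal C Y).
Proof.
have memE e : (e \in supp C) && (e \in supp Y) = (smul (C e) (Y e) != Zero).
  by rewrite !inE; case: (C e); case: (Y e).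
apply: (iffP orP) => [[/pred0P d|/existsP[x /andP[xS /existsP[y /andP[_ /eqP xy]]]]]|].
- by left=> e; apply/eqP/negPn; rewrite -memE; apply/negbT/d.
- right; rewrite inE memE in xS; move: xS xy.
  case px: (smul (C x) (Y x)) => // _; case py: (smul (C y) (Y y)) => // _.
    by exists y, x.
  by exists x, y.
case=> [z|[e [f [pe pf]]]]; [left|right].
  by apply/pred0P=> e; apply/negbTE; rewrite /= memE z.
apply/existsP; exists e; rewrite inE memE pe /=; apply/existsP; exists f.
by rewrite inE memE pf.
Qed.

Lemma orthogonal_two C Y e f : e != f -> Defs.orthogonal C Y ->
  (forall g, g != e -> g != f -> C g = Zero \/ Y g = Zero) ->
  smul (C e) (Y e) = sopp (smul (C f) (Y f)).
Proof.
move=> ef /orthogonalP CY oth; have ef' g : smul (C g) (Y g) <> Zero -> g = e \/ g = f.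
  move=> nz; have [->|ge] := eqVneq g e; first by left.
  have [->|gf] := eqVneq g f; first by right.
  by case: nz; case: (oth g ge gf) => ->; case: (C g).
case: CY => [z|[x [y [px py]]]]; first by rewrite !z.
have [|xe|xf] := ef' x; rewrite ?px //; have [|ye|yf] := ef' y; rewrite ?py //.
- by move: py; rewrite ye -xe px.
- by rewrite -xe -yf px py.
- by rewrite -xf -ye px py.
by move: py; rewrite yf -xf px.
Qed.

Lemma oriented_rank (N : om T) r circ chi :
  oriented (ground N) r (indep N) circ chi -> rank N (ground N) = r.
Proof.
move=> O; apply/eqP; rewrite eqn_leq; apply/andP; split.
  by apply: rank_le => I iI IE; apply: (o_max O).
by have [B [BE iB <-]] := o_base O; apply: rank_ge.
Qed.

(** A positive cocircuit [Y] vanishing on [B :\ b] and the cocircuit spanned by this ridge both meet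
    the fundamental circuit of [e] over [B] only in [e] and [b]. So their signs at [e] and [b]
    compare in the same way, and [Y] is [Pos] at both. *)
Lemma triangulation_triang (N : om T) r chi Delta :
  om_oriented N r chi ->
  triangulation N Delta ->
  triang (ground N) r (indep N) (fun C => C \in circuits N) chi Delta.
Proof.
move=> O [ne tB tD tR]; have rk := oriented_rank O.
have bas B : B \in Delta -> [/\ B \subset ground N, indep N B & #|B| = r].
  by move=> /tB /andP[iB /eqP cB]; rewrite cB rk; split=> //; case/andP: iB.
split=> // [B B' C BD B'D CC Cp Cn|B b BD bB].
  by apply: (tD B B' BD B'D); exists C.
have [BE iB cB] := bas B BD.
have bE := subsetP BE _ bB; have AE : B :\ b \subset ground N := subset_trans (subsetDl _ _) BE.
have cA : #|B :\ b|.+1 = r by rewrite -cB (cardsD1 b B) bB.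
case: (tR B b BD bB) => [[Y /andP[/andP[/minsetp/andP[YE /forallP Ytr] /forall_inP Yorth] Yp]] BY|].
  left=> e eE ye; have [->//|eb] := eqVneq e b.
  have Ypos x : Y x != Zero -> Y x = Pos.
    move: Yp => /eqP/setP/(_ x); rewrite !inE; by case: (Y x).
  have YA x : x \in B :\ b -> Y x = Zero.
    by move=> /(subsetP BY); rewrite inE => /andP[xY _]; apply: notin_supp.
  (* The support of [Y] meets the basis [x |: B :\ b], and can only do so in [x]. *)
  have Ybas x : x \in ground N -> indep N (x |: (B :\ b)) -> #|x |: B :\ b| = r -> Y x = Pos.
    move=> xE ix cx; apply: Ypos; apply: contraTneq (Ytr (x |: B :\ b)) => Yx.
    rewrite /basis ix cx rk eqxx /= negbK; apply/eqP/setP=> z; rewrite in_setI in_set0 in_setU1.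
    apply/negbTE/negP => /andP[/predU1P[->|/YA zY]]; rewrite inE ?Yx ?zY //.
  have eA : e \notin B by move: ye; rewrite (chi_cons_enum O) // !inE eb /= => /and3P[].
  have Ye : Y e = Pos.
    move: ye; rewrite (chi_cons_enum O) // => /and3P[_ eA' ie].
    by apply: Ybas; rewrite // cardsU1 eA' add1n cA.
  have Yb : Y b = Pos by apply: Ybas; rewrite ?setD1K.
  have [C [CC CS Ce]] := fund_circ O BE iB cB eE eA.
  have CE : supp C \subset ground N by apply: subset_trans CS _; rewrite subUset sub1set eE.
  have CA g : g != e -> g != b -> C g != Zero -> g \in B :\ b.
    by move=> ge gb /eqP/suppP/(subsetP CS); rewrite !inE (negPf ge) gb.
  have sr : (size (enum (B :\ b))).+1 = r by rewrite size_enum.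
  have o1 : smul (C e) (Y e) = sopp (smul (C b) (Y b)).
    apply: orthogonal_two => //; first exact: Yorth.
    move=> g ge gb; have [->|Cg] := eqVneq (C g) Zero; first by left.
    by right; apply/YA/CA.
  have o2 := orth2 O CC CE (subset_enum AE) sr eb.
  have {}o2 : smul (C e) (chi (e :: enum (B :\ b))) = sopp (smul (C b) (chi (b :: enum (B :\ b)))).
    apply: o2 => g ge gb Cg; apply: (chi_mem O); last exact: subset_enum.
    by rewrite mem_enum; apply: CA.
  move: o1 o2; rewrite Ce Ye Yb; case: (C b) => //= _.
  by do 2!case: (chi _).
case=> B' [B'D B'B BB']; right.
have [B'E iB' cB'] := bas B' B'D.
have [b' b'B' b'B] : exists2 b', b' \in B' & b' \notin B.
  by apply/subsetPn; apply: contra B'B => B'B; rewrite eqEcard B'B cB cB' leqnn.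
exists b'; split=> //; first by apply: contraNneq b'B => ->.
suff -> : b' |: B :\ b = B' by [].
apply/eqP; rewrite eqEcard subUset sub1set b'B' BB' cardsU1 !inE (negPf b'B) andbF.
by rewrite cB' -cA /= add1n leqnn.
Qed.

Definition ridge_cocircuit (E : {set T}) (k : sign) (chi : seq T -> sign) s : signvec T :=
  [ffun e => if e \in E then smul k (chi (e :: s)) else Zero].

(** Minimality: each element of the support completes [s] to a basis that the support meets in this
    element only. *)
Lemma ridge_cocircuitP (N : om T) r chi k s :
  om_oriented N r chi ->
  (forall C, C \in circuits N -> supp C \subset ground N) ->
  {subset s <= ground N} -> (size s).+1 = r -> uniq s -> indep N [set x in s] -> k != Zero ->
  cocircuit N (ridge_cocircuit (ground N) k chi s).
Proof.
move=> O cE sE sr us iss k0; have rk := oriented_rank O.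
set Y := ridge_cocircuit _ _ _ _.
have css : #|[set x in s]|.+1 = r by rewrite cardsE (card_uniqP us).
have ssE : [set x in s] \subset ground N by apply/subsetP=> x; rewrite inE => /sE.
have YE e : e \in ground N -> (e \in supp Y) = (chi (e :: s) != Zero).
  by move=> eE; rewrite inE ffunE eE; case: (k) k0 => // _; case: (chi _).
have Ysub : supp Y \subset ground N.
  by apply/subsetP=> x; rewrite inE ffunE; case: ifP.
have tr B : basis N B -> B :&: supp Y != set0.
  case/andP=> iB /eqP cB; apply/negP=> /eqP/setP d.
  have BE : B \subset ground N by case/andP: iB.
  have [|x /setDP[xB xs] ix] := indA (o_mat O) iss iB; first by rewrite cB rk -css.
  have xE := subsetP BE _ xB; have := d x; rewrite inE xB YE // in_set0 /=.
  rewrite (chi_cons O) // sr us ix eqxx /= ?andbT; rewrite inE in xs.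
  by rewrite xs.
apply/andP; split.
  apply/minsetP; split.
    by rewrite Ysub; apply/forallP=> B; apply/implyP/tr.
  move=> D /andP[DE /forallP Dtr] DY; apply/eqP; rewrite eqEsubset DY /=.
  apply/subsetP=> e eY; have eE := subsetP Ysub _ eY; have := eY; rewrite YE //.
  rewrite (chi_cons O) // => /and4P[_ es _ ie].
  have := Dtr (e |: [set x in s]); rewrite /basis ie rk cardsU1 inE es add1n css eqxx /=.
  case/set0Pn=> x; rewrite !inE => /andP[/predU1P[->//|xs] xD].
  have := subsetP DY _ xD; rewrite YE ?sE // (chi_mem O) //.
apply/forall_inP=> C CC; have CE := cE C CC; apply/orthogonalP.
have prodE e : smul (C e) (Y e) = smul k (smul (C e) (chi (e :: s))).
  have [eE|eE] := boolP (e \in supp C); last by rewrite (notin_supp eE); case: (k).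
  by rewrite ffunE (subsetP CE) //; case: (k); case: (C e); case: (chi _).
(* For each sign of the cocircuit, either all products vanish or one is [Neg]; the two negative ones
   together are products of both signs. *)
have ex b : (forall e, smul (C e) (Y e) = Zero) \/
    (exists e, smul (C e) (cocirc chi b s e) = Neg).
  have [/existsP[e /eqP He]|none] := boolP [exists e, smul (C e) (cocirc chi b s e) == Neg].
    by right; exists e.
  left=> e; have : smul (C e) (cocirc chi b s e) = Zero.
    apply: (orth_cocirc O) => // g; apply: contra none => Hg.
    by apply/existsP; exists g.
  by rewrite prodE /cocirc; case: (b); case: (C e); case: (chi _); case: (k).
have [z|[f Hf]] := ex false; first by left.
have [z|[e He]] := ex true; first by left.
have {}He : smul (C e) (chi (e :: s)) = Pos.
  by move: He; rewrite /cocirc; case: (C e); case: (chi _).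
right; case: (k) k0 prodE => // _ prodE; [exists f, e | exists e, f];
  by rewrite !prodE He; move: Hf; rewrite /cocirc => ->.
Qed.

Lemma orthogonal_ext X C Y : (forall i, Y i != Zero -> X i = C i) ->
  Defs.orthogonal C Y -> Defs.orthogonal X Y.
Proof.
move=> XC /orthogonalP CY; have eq i : smul (X i) (Y i) = smul (C i) (Y i).
  by have [->|/XC->//] := eqVneq (Y i) Zero; case: (X i); case: (C i).
apply/orthogonalP; case: CY => [z|[e [f [pe pf]]]]; first by left=> e; rewrite eq.
by right; exists e, f; rewrite !eq.
Qed.

(** If the first cocircuit has products of both signs with [C], they survive composition; otherwise
    its products all vanish and the remaining composition decides. *)
Lemma covector_orth (N : om T) X C : covector N X -> C \in circuits N -> Defs.orthogonal C X.
Proof.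
case=> t [+ ->] CC; elim: t => [_|Y t IH] /=.
  by apply/orthogonalP; left=> e; rewrite ffunE; case: (C e).
case/andP=> /andP[_ /forall_inP/(_ C CC)/orthogonalP CY] /IH {IH}/orthogonalP CX.
set Z := foldr _ _ _ in CX *; apply/orthogonalP.
case: CY => [z|[e [f [pe pf]]]].
  have eq g : smul (C g) (svcomp Y Z g) = smul (C g) (Z g).
    by rewrite ffunE; case: eqP => // Yg; move: (z g); case: (C g) => //; case: (Y g) Yg.
  case: CX => [z'|[e [f [pe pf]]]]; first by left=> g; rewrite eq.
  by right; exists e, f; rewrite !eq.
have YZ g : smul (C g) (Y g) <> Zero -> svcomp Y Z g = Y g.
  by rewrite ffunE; case: eqP => // ->; case: (C g).
by right; exists e, f; rewrite !YZ ?pe ?pf.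
Qed.

Lemma svcomp_foldr (Z : signvec T) (t : seq (signvec T)) :
  foldr (@svcomp T) Z t = svcomp (foldr (@svcomp T) (svzero T) t) Z.
Proof.
elim: t => [|Y t IH] /=; first by apply/ffunP=> i; rewrite !ffunE eqxx.
rewrite IH; apply/ffunP=> i; rewrite !ffunE; have [//|Yi] := eqVneq (Y i) Zero.
by rewrite (negPf Yi).
Qed.

Lemma foldr_conform (Q : signvec T) (t : seq (signvec T)) :
  (forall Y e, Y \in t -> Y e = Zero \/ Y e = Q e) ->
  forall e, foldr (@svcomp T) (svzero T) t e = if has (fun Y => Y e != Zero) t then Q e else Zero.
Proof.
move=> conf e; elim: t conf => [|Y t IH] conf /=; first by rewrite ffunE.
rewrite ffunE; case: (conf Y e (mem_head _ _)) => ->; rewrite ?eqxx /=.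
  by apply: IH => Z g Zt; apply: conf; rewrite inE Zt orbT.
have [z|//] := eqVneq (Q e) Zero; rewrite IH => [|Z g Zt]; last by apply: conf; rewrite inE Zt orbT.
by rewrite z; case: ifP.
Qed.

Lemma covector_comp (N : om T) X Y : covector N X -> cocircuit N Y -> covector N (svcomp X Y).
Proof.
case=> t [tC ->] cY; exists (rcons t Y); split; first by rewrite all_rcons cY.
rewrite foldr_rcons [RHS]svcomp_foldr; congr (svcomp _ _).
by apply/ffunP=> i; rewrite !ffunE; case: ifP => // /eqP.
Qed.

(** At a zero [i] of [P], composition with the cocircuit spanned by [J :\ i], for a base [J]
    containing the nonloop [i], would give a larger covector. *)
Lemma tope_support (N : om T) r chi P :
  om_oriented N r chi ->
  (forall C, C \in circuits N -> supp C \subset ground N) -> loopless N ->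
  tope N P -> forall i, i \in ground N -> P i != Zero.
Proof.
move=> O cE ll [cP maxP] i iE; apply/negP=> /eqP Pi.
have iE1 : [set i] \subset ground N by rewrite sub1set.
have [J [iJ JE indJ cJ]] := base_extend O iE1 (ll i iE).
rewrite sub1set in iJ.
have cA : #|J :\ i|.+1 = r by rewrite -cJ (cardsD1 i J) iJ.
have AE : J :\ i \subset ground N := subset_trans (subsetDl _ _) JE.
pose Y := ridge_cocircuit (ground N) Pos chi (enum (J :\ i)).
have cY : cocircuit N Y.
  apply: (ridge_cocircuitP O) => //; rewrite ?size_enum ?enum_uniq ?set_in_enum //.
    exact: subset_enum.
  by apply: (indS (o_mat O)) indJ; apply: subsetDl.
have Yi : Y i != Zero.
  by rewrite ffunE iE /= (chi_cons_enum O) // cA !inE !eqxx /= setD1K.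
have := maxP _ (covector_comp cP cY); move=> H.
have /(congr1 (fun Z : signvec T => Z i)) : svcomp P Y = P.
  by apply: H; apply/forall_inP=> j; rewrite inE ffunE => /negPf->.
by rewrite ffunE Pi eqxx => /eqP; rewrite (negPf Yi).
Qed.

End Generic.

(** * Contractions and links *)

Section Contraction.
Variables (T : finType) (M : om T) (a : atom M) (r : nat) (chi : seq T -> sign).
Hypotheses (omM : oriented_matroid M) (ll : loopless M).
Local Notation E := (ground M).
Local Notation M' := (contract M (val a)).
Hypothesis O : om_oriented M r chi.
Implicit Types (A B I J S : {set T}) (X Y Z C D P : signvec T) (s : seq T) (v y : T).
Let mat := o_mat O.

Lemma circuits_sub C : C \in circuits M -> supp C \subset E.
Proof. by case: omM => H _ _ _ _; apply: H. Qed.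

Lemma atom_sub : val a \subset E.
Proof. by have [] := atom_flat a. Qed.

Lemma atom_dep v y I : v \in val a -> y \in val a -> y != v -> v \in I -> y \in I ->
  ~~ indep M I.
Proof.
move=> va ya yv vI yI; move: ya; rewrite (atom_par mat ll va) inE (negPf yv) /=.
case/andP=> _; apply: contra => iI; apply: (indS mat) iI.
by rewrite subUset !sub1set vI.
Qed.

Lemma chi_atom v y s : v \in val a -> y \in val a -> v \in s -> {subset s <= E} ->
  chi (y :: s) = Zero.
Proof.
move=> va ya vs sE; have yE := subsetP atom_sub _ ya.
apply/eqP/negPn; rewrite (chi_cons O) //; apply/negP=> /and4P[_ ys _].
apply/negP; apply: (atom_dep va ya); rewrite ?inE ?eqxx ?vs ?orbT //.
by apply: contraNneq ys => ->.
Qed.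

Lemma contract_vecsP X : reflect
  (exists C, [/\ C \in circuits M, X = svrestr C (ground M') & X != svzero T])
  (X \in contract_vecs M (val a)).
Proof.
rewrite /contract_vecs in_setD in_set1; apply: (iffP andP) => [[X0 /imsetP[C CC eX]]|].
  by exists C.
by case=> C [CC eX X0]; split=> //; apply/imsetP; exists C.
Qed.

Lemma contract_circP X : X \in circuits M' ->
  exists C, [/\ C \in circuits M, X = svrestr C (ground M') & X != svzero T].
Proof. by rewrite inE => /andP[/contract_vecsP]. Qed.

Lemma supp_svrestr C S : supp (svrestr C S) = supp C :&: S.
Proof. by apply/setP=> i; rewrite !inE ffunE; case: ifP; rewrite ?andbT ?andbF. Qed.

Lemma svzeroP X : reflect (exists i, X i != Zero) (X != svzero T).
Proof.
apply: (iffP idP) => [X0|[i]]; last by apply: contraNneq => ->; rewrite ffunE.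
apply/existsP; apply: contraR X0; rewrite negb_exists => /forallP X0.
by apply/eqP/ffunP=> i; rewrite ffunE; apply/eqP/negPn.
Qed.

Lemma contract_circ X : X \in contract_vecs M (val a) ->
  exists2 X', X' \in circuits M' & supp X' \subset supp X.
Proof.
move=> XV; pose Q D := (D \in contract_vecs M (val a)) && (supp D \subset supp X).
have QX : Q X by rewrite /Q XV subxx.
have [D /andP[DV DX] Dmin] := @arg_minnP _ X Q (fun D => #|supp D|) QX.
exists D => //; rewrite inE DV; apply/forall_inP=> D' D'V; apply/negP=> D'D.
have := Dmin D'; rewrite /Q D'V (subset_trans (proper_sub D'D) DX) => /(_ isT).
by rewrite leqNgt (proper_card D'D).
Qed.

Lemma contract_opp X : X \in circuits M' -> svopp X \in circuits M'.
Proof.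
rewrite [X \in _]inE => /andP[/contract_vecsP[C [CC eX X0]] minX].
rewrite inE supp_opp minX andbT.
apply/contract_vecsP; exists (svopp C); split; first exact: (o_opp O).
  by rewrite eX; apply/ffunP=> i; rewrite !ffunE; case: ifP.
by case/svzeroP: X0 => i Xi; apply/svzeroP; exists i; rewrite ffunE sopp_eq0.
Qed.

Lemma ground_sub : ground M' \subset E. Proof. exact: subsetDl. Qed.

Lemma ground_notin v I : v \in val a -> I \subset ground M' -> v \notin I.
Proof. by move=> va /subsetP IE; apply/negP=> /IE; rewrite inE va. Qed.

(** A lifted circuit may meet the atom in several elements and need not lie in [v |: I]. It is
    tested against the cocircuit of a base without one element [x]: this vanishes on the whole atom,
    as [v] is in the base, and leaves only the product at [x]. *)
Lemma indep_contract v I : v \in val a -> I \subset ground M' ->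
  indep M' I = indep M (v |: I).
Proof.
move=> va IE'; have vE := subsetP atom_sub _ va; have IE := subset_trans IE' ground_sub.
have vI := ground_notin va IE'.
have vIE : v |: I \subset E by rewrite subUset sub1set vE.
apply/idP/idP=> [/andP[_ /forall_inP nI]|ivI].
  apply: contraT => /(dep_circ vIE)[C CC CS].
  have X0 : svrestr C (ground M') != svzero T.
    apply/svzeroP; have [x xC xv] : exists2 x, x \in supp C & x \notin [set v].
      by apply/subsetPn; have /andP[_ /forall_inP/(_ C CC)] := ll vE.
    exists x; have := subsetP CS _ xC; rewrite in_setU1 -in_set1 (negPf xv) /= => xI.
    by rewrite ffunE (subsetP IE') //; rewrite inE in xC.
  have XV : svrestr C (ground M') \in contract_vecs M (val a) by apply/contract_vecsP; exists C.
  have [X' X'C X'S] := contract_circ XV.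
  case/negP: (nI X' X'C); apply: (subset_trans X'S); rewrite supp_svrestr.
  apply/subsetP=> x; rewrite in_setI => /andP[/(subsetP CS)]; rewrite in_setU1.
  by case/predU1P=> // ->; rewrite inE va.
rewrite /indep IE' /=; apply/forall_inP=> X /contract_circP[C [CC eX /svzeroP[x Xx]]].
apply/negP=> XI; have xX : x \in supp X by rewrite inE.
have xI := subsetP XI _ xX.
have [K [IK KE iK cK]] := base_extend O vIE ivI.
have xK : x \in K by apply: (subsetP IK); rewrite in_setU1 xI orbT.
have vK : v \in K by apply: (subsetP IK); rewrite setU11.
have cA : #|K :\ x|.+1 = r by rewrite -cK (cardsD1 x K) xK.
have AE : K :\ x \subset E := subset_trans (subsetDl _ _) KE.
have xE := subsetP IE _ xI; have xv : x != v by apply: contraNneq vI => <-.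
have yx : chi (x :: enum (K :\ x)) != Zero.
  by rewrite (chi_cons_enum O) // cA !inE !eqxx /= setD1K.
have vA : v \in enum (K :\ x) by rewrite mem_enum !inE eq_sym xv.
have sz : (size (enum (K :\ x))).+1 = r by rewrite size_enum.
have := orth2 O CC (circuits_sub CC) (subset_enum AE) sz xv.
rewrite (chi_mem O vA (subset_enum AE)) => /(_ _) H.
have Cx : C x != Zero by move: Xx; rewrite eX ffunE; case: ifP.
have : smul (C x) (chi (x :: enum (K :\ x))) = sopp (smul (C v) Zero).
  apply: H => g gx gv Cg; have gE : g \in E by apply: (subsetP (circuits_sub CC)); rewrite inE.
  have [ga|ga] := boolP (g \in val a); first exact: (chi_atom va ga vA (subset_enum AE)).
  apply: (chi_mem O); last exact: subset_enum.
  rewrite mem_enum !inE gx /=; apply: (subsetP IK); rewrite in_setU1; apply/orP; right.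
  by apply: (subsetP XI); rewrite eX supp_svrestr !inE Cg ga.
by move: Cx yx; case: (C x); case: (chi _); case: (C v).
Qed.

Let mat' := contract_matroid mat ll indep_contract.
Let ll' := contract_loopless mat ll indep_contract.

(** Entries of a lifted circuit in the atom contribute nothing, because [v] belongs to the spanning
    sequence and the cocircuit vanishes on its parallel class. The factor [k] is absorbed by passing
    to the opposite circuit. *)
Lemma oriented_contract v k : v \in val a -> k != Zero ->
  om_oriented M' r.-1
    (fun s => smul k (chi (rcons s v))).
Proof.
move=> va k0; have vE := subsetP atom_sub _ va.
have vE1 : [set v] \subset E by rewrite sub1set.
have [K [vK KE iK cK]] := base_extend O vE1 (ll vE); rewrite sub1set in vK.
have cK1 : #|K :\ v|.+1 = r by rewrite -cK (cardsD1 v K) vK.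
have rr : r = r.-1.+1 by rewrite -cK1.
have sEv s : {subset s <= ground M'} -> {subset rcons s v <= E}.
  by move=> sE x; rewrite mem_rcons inE => /predU1P[->|/sE/(subsetP ground_sub)].
have vs s : {subset s <= ground M'} -> v \notin s.
  by move=> sE; apply/negP=> /sE; rewrite inE va.
have setE s : [set x in rcons s v] = v |: [set x in s].
  by apply/setP=> x; rewrite !inE mem_rcons inE.
split=> //.
- have KE' : K :\ v \subset ground M'.
    apply/subsetP=> x; rewrite !inE => /andP[xv xK]; rewrite (subsetP KE) // andbT.
    by apply/negP=> xa; case/negP: (atom_dep va xa xv vK xK).
  exists (K :\ v); split=> //; first by rewrite (indep_contract va) // setD1K.
  by rewrite -cK1.
- move=> I IE' iI; rewrite (indep_contract va) // in iI.
  have := o_max O _ iI; rewrite subUset sub1set vE (subset_trans IE' ground_sub) => /(_ isT).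
  by rewrite cardsU1 (ground_notin va IE') add1n rr ltnS.
- move=> s sE'; have sE := sEv s sE'.
  have -> : (smul k (chi (rcons s v)) != Zero) = (chi (rcons s v) != Zero).
    by case: (k) k0 => // _; rewrite /= ?sopp_eq0.
  rewrite (o_chi O sE) size_rcons {1}rr eqSS rcons_uniq vs //= setE.
  rewrite (indep_contract va) //; apply/subsetP=> x; rewrite inE; exact: sE'.
- move=> s1 x y s2; have := @alternating_rcons _ _ sopp chi v (o_alt O) s1 x y s2.
  by move=> /= ->; case: (k); case: (chi _).
- exact: contract_opp.
- move=> C' s C'C CE' sE' sr nn e.
  have [C [CC eC C0]] := contract_circP C'C; have sE := sEv s sE'.
  have szs : (size (rcons s v)).+1 = r by rewrite size_rcons sr -rr.
  have C'E g : smul (C' g) (smul k (chi (rcons (g :: s) v)))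
      = if k == Neg then smul (svopp C g) (chi (g :: rcons s v))
        else smul (C g) (chi (g :: rcons s v)).
    rewrite eC !ffunE inE /=; have [ga|ga] /= := boolP (g \in val a).
      rewrite (chi_atom va ga _ sE); last by rewrite mem_rcons mem_head.
      by case: (k) k0 => // _; case: (C g).
    case: ifP => gE; first by case: (k) k0 => // _; case: (C g); case: (chi _).
    rewrite notin_supp; first by case: (k).
    by apply/negP=> /(subsetP (circuits_sub CC)); rewrite gE.
  have ok : exists2 Z, Z \in circuits M & forall g,
      smul (C' g) (smul k (chi (rcons (g :: s) v))) = smul (Z g) (chi (g :: rcons s v)).
    case: eqP C'E => _ C'E; last by exists C.
    by exists (svopp C) => //; apply: (o_opp O).
  have [Z ZC ZE] := ok; have := o_orth O ZC (circuits_sub ZC) sE szs.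
  move=> H; have := H _ e; rewrite -ZE; apply=> g; rewrite -ZE; exact: nn.
move=> I h IE' hE' iI hI dep.
have [|X XC XS] := dep_circ _ dep; first by rewrite subUset sub1set hE'.
have Xh : X h != Zero.
  apply/negP=> /eqP Xh; case/andP: iI => _ /forall_inP/(_ X XC)/negP; apply.
  apply/subsetP=> x xX; have := subsetP XS _ xX; rewrite in_setU1 => /predU1P[xh|//].
  by move: xX; rewrite inE xh Xh.
case Xs: (X h) Xh => // _; first by exists X.
by exists (svopp X); rewrite supp_opp ffunE Xs; split=> //; apply: contract_opp.
Qed.

Lemma alternating_rcons_cons s v :
  chi (rcons s v) = if odd (size s) then sopp (chi (v :: s)) else chi (v :: s).
Proof.
have H t u : chi (u ++ rcons t v)
    = if odd (size t) then sopp (chi (u ++ v :: t)) else chi (u ++ v :: t).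
  elim: t u => [|x t IH] u //=; rewrite -cat_rcons IH cat_rcons (o_alt O).
  by case: (odd _); rewrite //= soppK.
exact: (H s [::]).
Qed.

(** * Parallel elements and the reoriented contraction *)

Section Reorientation.
Variable P : signvec T.
Hypotheses (Psupp : forall i, i \in E -> P i != Zero)
  (Porth : forall C, C \in circuits M -> Defs.orthogonal C P).
Local Notation P_a := (svrestr P (ground M')).
Local Notation N := (reorient P M).
Local Notation N' := (reorient P_a M').

(** Elements of an atom are parallel, and [P] tells with which orientation. *)
Lemma parallel_circ v y : v \in val a -> y \in val a -> y != v ->
  exists C, [/\ C \in circuits M, supp C = [set y; v],
    smul (C y) (P y) = Pos & smul (C v) (P v) = Neg].
Proof.
move=> va ya yv; have vE := subsetP atom_sub _ va; have yE := subsetP atom_sub _ ya.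
have dep : ~~ indep M [set y; v].
  by apply: (atom_dep va ya yv); rewrite !inE eqxx ?orbT.
have [|C CC CS] := dep_circ _ dep; first by rewrite subUset !sub1set yE.
have big x : x \in E -> ~~ (supp C \subset [set x]).
  by move/ll/andP=> [_ /forall_inP]; apply.
have mem x z : [set y; v] = [set x; z] -> z \in E -> x \in supp C.
  move=> e zE; have /subsetPn[w wC wz] := big z zE.
  have := subsetP CS _ wC; rewrite e !inE; rewrite inE in wz.
  by rewrite (negPf wz) orbF => /eqP wx; rewrite -wx; rewrite inE in wC.
have yC : y \in supp C by apply: (mem y v).
have vC : v \in supp C by apply: (mem v y); rewrite 1?setUC.
have eS : supp C = [set y; v] by apply/eqP; rewrite eqEsubset CS subUset !sub1set yC.
have yv' : smul (C y) (P y) = sopp (smul (C v) (P v)).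
  apply: orthogonal_two => //; first exact: Porth.
  move=> g gy gv; left; apply: notin_supp.
  by rewrite eS !inE negb_or gy.
have nz : smul (C v) (P v) != Zero.
  by move: vC (Psupp vE); rewrite inE; case: (C v); case: (P v).
case s: (smul (C v) (P v)) nz => // _.
  by exists C; rewrite yv' s.
exists (svopp C); rewrite supp_opp !ffunE !smul_opp yv' s; split=> //.
exact: (o_opp O).
Qed.

(** So [contract_chi] does not depend on the element chosen in the atom. The circuit on [v] and [y]
    is orthogonal both to [P] and to the cocircuit of [s], which compares the two sides. *)
Lemma chi_parallel v y s : v \in val a -> y \in val a -> {subset s <= ground M'} ->
  smul (P v) (chi (rcons s v)) = smul (P y) (chi (rcons s y)).
Proof.
move=> va ya sE'; have [->//|vy] := eqVneq v y.
have vE := subsetP atom_sub _ va; have yE := subsetP atom_sub _ ya.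
have sE : {subset s <= E} by move=> x /sE' /(subsetP ground_sub).
rewrite !alternating_rcons_cons.
suff e : smul (P v) (chi (v :: s)) = smul (P y) (chi (y :: s)).
  by case: (odd _) => //; move: e; case: (P v); case: (P y); do 2!case: (chi _).
have [sr|sr] := eqVneq (size s).+1 r; last first.
  have z x : x \in E -> chi (x :: s) = Zero.
    by move=> xE; apply/eqP/negPn; rewrite (chi_cons O) // (negPf sr).
  by rewrite !z //; case: (P v); case: (P y).
have [C [CC CS Cv Cy]] := parallel_circ ya va vy.
have := orth2 O CC (circuits_sub CC) sE sr vy.
move=> H; have {H} : smul (C v) (chi (v :: s)) = sopp (smul (C y) (chi (y :: s))).
  apply: H => g gv gy Cg; have : g \in supp C by rewrite inE.
  by rewrite CS !inE (negPf gv) (negPf gy).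
by move: Cv Cy; case: (C v); case: (C y); case: (P v); case: (P y) => //= _ _; do 2!case: (chi _).
Qed.

(** The factor [P v] in [contract_chi] is exactly the sign that [v] contributes to the
    reorientation. *)
Lemma reorient_chi_contract v s : v \in val a -> {subset s <= ground M'} ->
  reorient_chi P chi (rcons s v) = reorient_chi P_a (contract_chi P chi v) s.
Proof.
move=> va sE'; have vE := subsetP atom_sub _ va; have vs : v \notin s.
  by apply/negP=> /sE'; rewrite inE va.
rewrite /reorient_chi /contract_chi.
have eS : [set i in s] :&: negpart P_a = [set i in s] :&: negpart P.
  apply/setP=> x; rewrite !in_setI 2!inE; case xs: (x \in s) => //=.
  by rewrite ffunE sE' // inE.
rewrite eS.
have -> : [set i in rcons s v] :&: negpart P
    = (if P v == Neg then [set v] else set0) :|: ([set i in s] :&: negpart P).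
  apply/setP=> x; rewrite !inE mem_rcons inE; case: ifP => vP; rewrite !inE.
    by rewrite andb_orl; congr orb; case: eqVneq => // ->; rewrite vP.
  by rewrite andb_orl; case: eqVneq => // ->; rewrite vP.
case Pv: (P v) (Psupp vE) => // _ /=; last by rewrite set0U.
by rewrite cardsU1 !inE (negPf vs) /=; case: (odd _); rewrite //= soppK.
Qed.

Lemma reorient_contract_vec C : reorient_vec P_a (svrestr C (ground M'))
  = svrestr (reorient_vec P C) (ground M').
Proof.
apply/ffunP=> i; rewrite !ffunE !inE !ffunE inE.
by case: ((i \notin _) && _) => //=; case: ifP.
Qed.

(** If a circuit contracts to a nonzero vector, its elements in [a] can be replaced by
    [v]. *)
Lemma contract_lift v C : v \in val a -> C \in circuits M ->
  svrestr C (ground M') != svzero T ->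
  exists Z, [/\ Z \in circuits M, supp Z :&: val a \subset [set v]
    & forall e, e \in ground M' -> Z e != Zero -> Z e = C e].
Proof.
move=> va CC C0; have [sv|/subsetPn[y]] := boolP (supp C :&: val a \subset [set v]).
  by exists C.
rewrite in_setI in_set1 => /andP[yC ya] yv.
have [D0 [D0C D0S _ _]] := parallel_circ va ya yv.
case/svzeroP: C0 => x; rewrite ffunE; case: ifP => // xE' Cx.
have nxa : x \notin val a by move: xE'; rewrite inE => /andP[].
have only z : z \in supp C -> z \in val a -> z = y.
  move=> zC za; apply/eqP/negPn/negP => zy.
  have [D1 [D1C D1S _ _]] := parallel_circ ya za zy.
  have DS : supp D1 \subset supp C by rewrite D1S subUset !sub1set zC.
  have : supp D1 = supp C.
    by case: omM => _ _ _ H _; case: (H _ _ D1C CC DS) => ->; rewrite ?supp_opp.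
  move/setP/(_ x); rewrite D1S !inE Cx => /orP[/eqP xz|/eqP xy].
    by rewrite xz za in nxa.
  by rewrite xy ya in nxa.
have yD : y \in supp D0 by rewrite D0S !inE eqxx.
have [|D [DC DS Dy]] := circ_sign omM (x := sopp (C y)) D0C yD.
  by rewrite sopp_eq0; rewrite inE in yC.
rewrite D0S in DS.
have xy : x != y by apply: contraNneq nxa => ->.
have xv : x != v by apply: contraNneq nxa => ->.
have Dx z : z \notin val a -> D z = Zero.
  move=> za; apply: notin_supp; rewrite DS !inE negb_or.
  by apply/andP; split; apply: contraNneq za => ->.
have nCD X Y : supp X = supp C -> supp Y = supp D -> X <> svopp Y.
  move=> XC YD e; have : x \in supp X by rewrite XC inE.
  by rewrite e supp_opp YD DS !inE (negPf xy) (negPf xv).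
have [|Z [ZC Zy Zg]] := signed_elim omM CC DC (nCD C D erefl erefl) _ Dy.
  by rewrite inE in yC.
exists Z; split=> //.
  apply/subsetP=> z; rewrite in_setI in_set1 => /andP[zZ za].
  have [//|zv] := eqVneq z v; have zy : z != y.
    by apply: contraTneq zZ => ->; rewrite inE Zy.
  have Dz : D z = Zero by apply: notin_supp; rewrite DS !inE negb_or zy.
  have Cz : C z = Zero.
    by apply: notin_supp; apply/negP=> zC; rewrite (only z zC za) eqxx in zy.
  by move: zZ; rewrite inE => nz; case: (Zg z nz) => e; rewrite e ?Dz ?Cz in nz.
move=> z; rewrite inE => /andP[za _] nz; case: (Zg z nz) => // ZD.
by rewrite ZD Dx in nz.
Qed.
End Reorientation.
End Contraction.

Lemma oriented_reorient_om (T : finType) (M : om T) r chi P :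
  om_oriented M r chi ->
  om_oriented (reorient P M) r (reorient_chi P chi).
Proof.
move=> O; have := oriented_reorient P O; rewrite indep_reorient.
suff -> : (fun C => reorient_vec P C \in circuits M)
    = (fun C => C \in circuits (reorient P M)) by [].
by apply/funext=> C; rewrite circuits_reorient.
Qed.

Definition link (T : finType) (v : T) (D : {set {set T}}) : {set {set T}} :=
  [set B :\ v | B in [set B in D | v \in B]].

Lemma linkP (T : finType) v (D : {set {set T}}) S : reflect
  (exists B, [/\ B \in D, v \in B & S = B :\ v]) (S \in link v D).
Proof.
apply: (iffP imsetP) => [[B]|[B [BD vB ->]]].
  by rewrite inE => /andP[BD vB] ->; exists B.
by exists B => //; rewrite inE BD vB.
Qed.

(** * Links as triangulations of the contraction *)

Section Link.
Variables (T : finType) (M : om T) (a : atom M) (r : nat) (chi : seq T -> sign).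
Variable P : signvec T.
Hypotheses (omM : oriented_matroid M) (ll : loopless M).
Local Notation E := (ground M).
Local Notation M' := (contract M (val a)).
Hypothesis O : om_oriented M r chi.
Hypotheses (Psupp : forall i, i \in E -> P i != Zero)
  (Porth : forall C, C \in circuits M -> Defs.orthogonal C P).
Implicit Types (A B I J S : {set T}) (X Y Z C : signvec T) (s : seq T) (v y : T).
Local Notation P_a := (svrestr P (ground M')).
Local Notation N := (reorient P M).
Local Notation N' := (reorient P_a M').
Let mat := o_mat O.
Let ON := oriented_reorient_om P O.

Let ct : forall w (I : {set T}), w \in val a -> I \subset ground M' ->
  indep M' I = indep M (w |: I).
Proof. exact: (indep_contract omM ll O). Qed.

Lemma oriented_link v : v \in val a ->
  om_oriented M' r.-1 (contract_chi P chi v).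
Proof.
move=> va; apply: (oriented_contract omM ll O va); apply: Psupp.
exact: subsetP (atom_sub a) _ va.
Qed.

Lemma oriented_link_reorient v : v \in val a ->
  om_oriented N' r.-1
    (reorient_chi P_a (contract_chi P chi v)).
Proof. by move/oriented_link/(oriented_reorient_om P_a). Qed.

Lemma rank_contract : rank M' (ground M') = r.-1.
Proof. by have /set0Pn[v va] := atom_neq0 a; apply: oriented_rank (oriented_link va). Qed.

Lemma link_sub v B : v \in val a -> indep M B -> v \in B -> B :\ v \subset ground M'.
Proof.
move=> va iB vB; apply/subsetP=> x; rewrite !inE => /andP[xv xB].
have /andP[BE _] := iB; rewrite (subsetP BE) // andbT; apply/negP=> xa.
by case/negP: (atom_dep ll O va xa xv vB xB).
Qed.

Lemma link_basis v B : v \in val a -> v \in B -> basis M B -> basis M' (B :\ v).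
Proof.
move=> va vB /andP[iB cB]; rewrite /basis rank_contract.
rewrite (indep_contract omM ll O va) ?link_sub // setD1K // iB /=.
move: cB; rewrite (oriented_rank O) (cardsD1 v B) vB => /eqP <-.
by rewrite add1n.
Qed.

Lemma basis_reorient Q (L : om T) B : basis (reorient Q L) B = basis L B.
Proof. by rewrite /basis indep_reorient rank_reorient. Qed.

Lemma contract_orth Y X : (forall C, C \in circuits N -> Defs.orthogonal C Y) ->
  supp Y \subset ground M' -> X \in circuits N' -> Defs.orthogonal X Y.
Proof.
move=> Yorth YE; rewrite circuits_reorient => /contract_circP[C [CC eX _]].
apply: (@orthogonal_ext _ _ (reorient_vec P C)); last first.
  by apply: Yorth; rewrite circuits_reorient reorient_vecK.
move=> i Yi; rewrite -[X](reorient_vecK P_a) eX reorient_contract_vec ffunE.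
by rewrite (subsetP YE) // inE.
Qed.

(** Orthogonality to the circuits on parallel pairs makes [Y] vanish on the whole atom. Minimality
    holds because each basis of [M] contains a basis of the contraction, obtained by exchanging [v]
    in and dropping it. *)
Lemma contract_cocircuit v Y : v \in val a -> positive_cocircuit N Y -> Y v = Zero ->
  positive_cocircuit N' Y.
Proof.
move=> va /andP[/andP[/minsetP[/andP[YE /forallP Ytr] Ymin] /forall_inP Yorth] Yp] Yv.
have YE' : supp Y \subset ground M'.
  apply/subsetP=> y yY; rewrite inE (subsetP YE) // andbT; apply/negP=> ya.
  have [yv|yv] := eqVneq y v; first by rewrite inE yv Yv in yY.
  have [C [CC CS _ _]] := parallel_circ ll O Psupp Porth va ya yv.
  have := Yorth (reorient_vec P C); rewrite circuits_reorient reorient_vecK => /(_ CC).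
  move=> /(orthogonal_two yv) H; rewrite inE in yY.
  have yC : y \in supp (reorient_vec P C) by rewrite supp_reorient CS !inE eqxx.
  rewrite inE in yC; have : smul (reorient_vec P C y) (Y y) = sopp (smul (reorient_vec P C v) (Y v)).
    apply: H => g gy gv; left; apply: notin_supp.
    by rewrite supp_reorient CS !inE negb_or gy.
  by rewrite Yv; move: yC yY; case: (reorient_vec P C y); case: (Y y); case: (reorient_vec P C v).
apply/andP; split=> //; apply/andP; split; last first.
  by apply/forall_inP=> X XC; apply: contract_orth.
have vE := subsetP (atom_sub a) _ va.
have lift B : basis M B -> exists B', [/\ basis M' B', B' \subset B & v \notin B'].
  move=> bB; have /andP[iB /eqP cB] := bB.
  have [K [vK KU iK le]] := ind_extend mat (ll vE) iB; rewrite sub1set in vK.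
  have cK : #|K| = rank M E by apply/eqP; rewrite eqn_leq -{2}cB le rank_ge //; case/andP: iK.
  exists (K :\ v); split; last by rewrite !inE eqxx.
    by apply: link_basis; rewrite // /basis iK cK eqxx.
  by apply/subsetP=> x; rewrite in_setD1 => /andP[xv /(subsetP KU)]; rewrite in_setU1 (negPf xv).
apply/minsetP; split.
  rewrite YE'; apply/forallP=> B; apply/implyP; rewrite basis_reorient => /andP[iB /eqP cB].
  have BE' : B \subset ground M' by case/andP: iB.
  have vB := ground_notin va BE'.
  have r0 : 0 < r.
    have v1E : [set v] \subset E by rewrite sub1set.
    by have := o_max O v1E (ll vE); rewrite cards1.
  have := Ytr (v |: B); rewrite basis_reorient /basis -(indep_contract omM ll O va) // iB.
  rewrite cardsU1 vB cB rank_contract (oriented_rank O) add1n prednK // eqxx /=.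
  case/set0Pn=> x; rewrite in_setI in_setU1 => /andP[/predU1P[->|xB] xY].
    by rewrite inE Yv eqxx in xY.
  by apply/set0Pn; exists x; rewrite in_setI xB.
move=> D /andP[DE /forallP Dtr] DY; apply: Ymin => //.
rewrite (subset_trans DY YE); apply/forallP=> B; apply/implyP; rewrite basis_reorient.
move=> /lift[B' [bB' B'B _]]; have := Dtr B'; rewrite basis_reorient bB' /=.
case/set0Pn=> x; rewrite in_setI => /andP[xB' xD].
by apply/set0Pn; exists x; rewrite in_setI (subsetP B'B).
Qed.

(** For disjointness, a circuit of the contraction is lifted to one that meets the atom in [v] at
    most, and [v] lies in both simplices. At a ridge containing [v], a positive cocircuit vanishes
    at [v] and a neighbour contains [v], so both pass to the link. *)
Lemma link_triangulation v (D : {set {set T}}) : v \in val a ->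
  (exists2 B, B \in D & v \in B) -> triangulation N D -> triangulation N' (link v D).
Proof.
move=> va [B0 B0D vB0] [ne tB tD tR]; split.
- by apply/set0Pn; exists (B0 :\ v); apply/linkP; exists B0.
- move=> S /linkP[B [BD vB ->]]; rewrite basis_reorient; apply: link_basis => //.
  by have := tB B BD; rewrite basis_reorient.
- move=> S S' /linkP[B [BD vB ->]] /linkP[B' [B'D vB' ->]] [C [CC Cp Cn]].
  move: (CC); rewrite circuits_reorient => /contract_circP[C0 [C0C eC C0n]].
  rewrite eC in C0n; have [Z [ZC Za Zg]] := contract_lift omM ll O Psupp Porth va C0C C0n.
  have Z1 x : reorient_vec P Z x != Zero -> x <> v -> C x = reorient_vec P Z x.
    move=> nz xv; have xZ : x \in supp Z by rewrite -(supp_reorient P) inE.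
    have xE' : x \in ground M'.
      rewrite inE (subsetP (circuits_sub omM ZC)) // andbT; apply/negP=> xa.
      by have := subsetP Za x; rewrite in_setI xZ xa in_set1 => /(_ isT)/eqP.
    rewrite -[C](reorient_vecK P_a) eC reorient_contract_vec ffunE xE' !ffunE.
    by rewrite (Zg x xE') //; rewrite inE in xZ.
  apply: (tD B B' BD B'D); exists (reorient_vec P Z); split.
  + by rewrite circuits_reorient reorient_vecK.
  + apply/subsetP=> x; rewrite inE => /eqP Zx; have [->//|xv] := eqVneq x v.
    have : x \in pospart C by rewrite inE Z1 ?Zx //; apply/eqP.
    by move/(subsetP Cp); rewrite in_setD1 => /andP[].
  apply/subsetP=> x; rewrite inE => /eqP Zx; have [->//|xv] := eqVneq x v.
  have : x \in negpart C by rewrite inE Z1 ?Zx //; apply/eqP.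
  by move/(subsetP Cn); rewrite in_setD1 => /andP[].
move=> S b /linkP[B [BD vB ->]]; rewrite in_setD1 => /andP[bv bB].
have vBb : v \in B :\ b by rewrite in_setD1 eq_sym bv.
case: (tR B b BD bB) => [[Y pY BY]|[B' [B'D B'B BB']]]; [left|right].
  have Yv : Y v = Zero.
    by apply: notin_supp; have := subsetP BY v vBb; rewrite in_setD => /andP[].
  exists Y; first exact: contract_cocircuit va pY Yv.
  apply/subsetP=> x; rewrite !in_setD1 => /and3P[xb xv xB]; rewrite in_setD.
  have : x \in B :\ b by rewrite in_setD1 xb.
  move/(subsetP BY); rewrite in_setD => /andP[-> _] /=.
  have := tB B BD; rewrite basis_reorient => /andP[iB _].
  by apply: (subsetP (link_sub va iB vB)); rewrite in_setD1 xv.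
have vB' := subsetP BB' _ vBb.
exists (B' :\ v); split; first by apply/linkP; exists B'.
  by apply: contraNneq B'B => e; rewrite -(setD1K vB') e setD1K.
apply/subsetP=> x; rewrite !in_setD1 => /and3P[xb -> xB] /=.
by apply: (subsetP BB'); rewrite in_setD1 xb.
Qed.

(** After reorientation the circuit on [y] and [v] is [Pos] at [y] and [Neg] at [v], so its parts
    would lie in [B'] and [B]. The residue at [a] therefore involves a single link. *)
Lemma link_unique v y (D : {set {set T}}) B B' : triangulation N D ->
  v \in val a -> y \in val a -> B \in D -> B' \in D -> v \in B -> y \in B' -> y = v.
Proof.
move=> [_ _ tD _] va ya BD B'D vB yB'; apply/eqP/negPn/negP => yv.
have [C [CC CS Cy Cv]] := parallel_circ ll O Psupp Porth va ya yv.
have sg x : x \in E -> reorient_vec P C x = smul (C x) (P x).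
  by move/Psupp; rewrite ffunE inE; case: (P x); case: (C x).
apply: (tD B' B B'D BD); exists (reorient_vec P C); split.
- by rewrite circuits_reorient reorient_vecK.
- apply/subsetP=> x; rewrite inE => /eqP Cx.
  have : x \in supp C by rewrite -(supp_reorient P) inE Cx.
  rewrite CS => /set2P[->//|xv].
  by move: Cx; rewrite xv sg ?(subsetP (atom_sub a)) // Cv.
apply/subsetP=> x; rewrite inE => /eqP Cx.
have : x \in supp C by rewrite -(supp_reorient P) inE Cx.
rewrite CS => /set2P[xy|->//].
by move: Cx; rewrite xy sg ?(subsetP (atom_sub a)) // Cy.
Qed.

(** Otherwise an element [h] of the atom is in the hull of the vertices in use, through a circuit
    positive at all its other elements. The covector of the facet is zero on the atom, so
    orthogonality leaves no other element, and [h] would be a loop. *)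
Lemma facet_used (D : {set {set T}}) : facet M P (val a) -> triangulation N D ->
  exists v, v \in val a /\ exists2 B, B \in D & v \in B.
Proof.
move=> fa tD; have tT := triangulation_triang ON tD.
have [/existsP[v /andP[va /existsP[B /andP[BD vB]]]]|none] :=
  boolP [exists v, (v \in val a) && [exists B : {set T}, (B \in D) && (v \in B)]].
  by exists v; split=> //; exists B.
have /set0Pn[h ha] := atom_neq0 a; have hE := subsetP (atom_sub a) _ ha.
have used_a x : x \in used D set0 -> x \notin val a.
  case/usedP=> B [BD _ xB]; apply: contra none => xa.
  by apply/existsP; exists x; rewrite xa; apply/existsP; exists B; rewrite BD.
have DE : exists2 B, B \in D & set0 \subset B.
  by have /set0Pn[B BD] := t_ne tT; exists B => //; apply: sub0set.
have hV : h \notin used D set0 by apply: contraL ha; apply: used_a.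
have ri := all_ridge_in ON tT DE (subxx _) (used_sub tT set0).
have [C [CC CS Ch Cp]] := in_hull ON tT DE ri hE hV.
suff Ch' : supp C \subset [set h].
  by have := circ_dep ON CC Ch' _ _ h; rewrite Ch sub1set indep_reorient => /(_ hE (ll hE)).
have pos x : x \in supp C -> x \notin val a -> smul (reorient_vec P C x) (P x) = Pos.
  move=> xC xa; have := subsetP CS _ xC; rewrite in_setU1 => /predU1P[xh|xV].
    by rewrite xh ha in xa.
  have xE := subsetP (used_sub tT set0) _ xV.
  have := Cp x xV; rewrite in_set0 => /(_ isT); move: xC (Psupp xE).
  by rewrite inE ffunE inE; case: (P x); case: (C x).
move: (CC); rewrite circuits_reorient => CC'.
have val' z : z \notin val a -> z \in supp C ->
    smul (reorient_vec P C z) (svrestr P (E :\: val a) z) = Pos.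
  move=> za zC; have zE : z \in E by apply: (subsetP (circuits_sub omM CC')); rewrite supp_reorient.
  by rewrite [svrestr _ _ z]ffunE in_setD za zE pos.
have /orthogonalP[z|[e [f [_ pf]]]] := covector_orth fa CC'.
  apply/subsetP=> x xC; have := subsetP CS _ xC; rewrite in_setU1 in_set1.
  case/predU1P=> [->//|/used_a xa]; have := val' x xa xC.
  by rewrite z.
have [fC|fC] := boolP (f \in supp C); last first.
  by move: pf; rewrite (@notin_supp _ (reorient_vec P C)) // supp_reorient.
have [xa|xa] := boolP (f \in val a); last by rewrite val' in pf.
by move: pf; rewrite [svrestr _ _ f]ffunE in_setD xa; case: (reorient_vec P C f).
Qed.

(** Otherwise every element off [a] would be off some facet through [a], and the
    cocircuits of these facets would compose to [P_a]. *)
Lemma nonfacet_common v : v \in val a -> ~ facet M P (val a) ->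
  exists2 p, p \in ground M' & forall H,
    is_facet (ground M') r.-1 (indep M') (reorient_chi P_a (contract_chi P chi v)) H -> p \in H.
Proof.
move=> va nf; set chi' := reorient_chi _ _.
have [/existsP[p /andP[pE /forallP pH]]|none] := boolP [exists p,
    (p \in ground M') && [forall H, is_facet (ground M') r.-1 (indep M') chi' H ==> (p \in H)]].
  by exists p => // H fH; have := pH H; rewrite fH.
case: nf; have vE := subsetP (atom_sub a) _ va.
(* The covector is composed of one cocircuit for each element off the atom; all of them conform to
   [P_a], so their order is immaterial. *)
suff [t [tC tconf tp]] : exists t : seq (signvec T), [/\ all (cocircuit M) t,
    forall Y e, Y \in t -> Y e = Zero \/ Y e = P_a e
    & forall p, p \in enum (ground M') -> has (fun Y => Y p != Zero) t].
  exists t; split=> //; apply/ffunP=> e; rewrite (foldr_conform tconf).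
  case: ifPn => // nh; rewrite ffunE; case: ifP => // eE.
  by case/negP: nh; apply: tp; rewrite mem_enum.
suff one p : p \in ground M' -> exists Y, [/\ cocircuit M Y,
    forall e, Y e = Zero \/ Y e = P_a e & Y p != Zero].
  have: {subset enum (ground M') <= ground M'} by move=> x; rewrite mem_enum.
  elim: (enum _) => [|p l IH] lE; first by exists [::].
  have [|t [tC tconf tp]] := IH; first by move=> x xl; apply: lE; rewrite inE xl orbT.
  have [Y [cY Yconf Yp]] := one p (lE p (mem_head _ _)).
  exists (Y :: t); split=> [|Z e|q]; first by rewrite /= cY.
    by rewrite inE => /predU1P[->|/tconf].
  by rewrite inE /= => /predU1P[->|/tp->]; rewrite ?Yp ?orbT.
move=> pE; have /existsP[H] : [exists H, is_facet (ground M') r.-1 (indep M') chi' H && (p \notin H)].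
  apply: contraR none; rewrite negb_exists => /forallP all; apply/existsP; exists p.
  by rewrite pE; apply/forallP=> H; apply/implyP=> fH; have := all H; rewrite fH negbK.
case/andP=> /existsP[A /and3P[/and3P[AE iA /eqP cA] /onesidedP os /eqP <-]].
rewrite hyper_out // => yp; pose s := rcons (enum A) v.
have sAE : {subset enum A <= ground M'} := subset_enum AE.
have sE : {subset s <= E}.
  by move=> x; rewrite mem_rcons inE => /predU1P[->|/sAE/(subsetP (@ground_sub _ _ _))].
have vA : v \notin A := ground_notin va AE.
have szs : (size s).+1 = r.
  by rewrite size_rcons size_enum cA prednK //; case: (r) cA.
have setE : [set x in s] = v |: A by apply/setP=> x; rewrite !inE mem_rcons inE mem_enum.
pose b := odd #|[set i in s] :&: negpart P|.
have chi'E e : e \in ground M' ->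
    smul (P e) (chi' (e :: enum A)) = if b then sopp (chi (e :: s)) else chi (e :: s).
  move=> eE; have eE0 := subsetP (@ground_sub _ _ _) _ eE.
  have -> : chi' (e :: enum A) = reorient_chi P chi (e :: s).
    rewrite -rcons_cons; apply/esym; apply: (reorient_chi_contract chi Psupp va) => x.
    by rewrite inE => /predU1P[->|/sAE].
  have [es|es] := boolP (e \in s).
    have z : chi (e :: s) = Zero by apply: (chi_mem O).
    by rewrite /reorient_chi z; do 2!case: ifP => _; case: (P e).
  rewrite reorient_chi_cons // -/b inE; move: (Psupp eE0).
  by case: (P e) => // _ /=; case: (b); rewrite /= ?soppK.
(* With this sign the cocircuit agrees with [P] at [p]; by one-sidedness it does so at every element
   off the atom where it is nonzero. *)
pose k := if b then sopp (chi' (p :: enum A)) else chi' (p :: enum A).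
have k0 : k != Zero by rewrite /k; case: (b); rewrite ?sopp_eq0.
have YE e : e \in ground M' -> chi' (e :: enum A) != Zero ->
    ridge_cocircuit E k chi s e = P e.
  move=> eE ye; have eE0 := subsetP (@ground_sub _ _ _) _ eE.
  have := chi'E e eE; rewrite ffunE eE0.
  rewrite /k (os e p eE pE ye yp); move: yp; case: (chi' _) => // _;
  by case: (b); case: (P e); case: (chi _).
exists (ridge_cocircuit E k chi s); split.
- apply: (ridge_cocircuitP O) => //; first exact: circuits_sub omM.
    by rewrite rcons_uniq mem_enum vA enum_uniq.
  by rewrite setE -(indep_contract omM ll O va).
- move=> e; have [eE|eE] := boolP (e \in ground M').
    have [z|/(YE e eE) ->] := eqVneq (chi' (e :: enum A)) Zero; last by right; rewrite ffunE eE.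
    have eE0 := subsetP (@ground_sub _ _ _) _ eE.
    left; have := chi'E e eE; rewrite z ffunE eE0.
    by case: (b); case: (P e); case: (chi _) => //; case: (k).
  left; rewrite ffunE; case: ifP => // eE0; have ea : e \in val a.
    by move: eE; rewrite inE eE0 andbT negbK.
  rewrite (chi_atom ll O va ea) //; first by case: (k).
  by rewrite mem_rcons mem_head.
by rewrite YE // Psupp //; apply: subsetP pE; apply: ground_sub.
Qed.

(** * Residues of volumes *)

Section Residues.
Variable R : comPzRingType.
Local Open Scope ring_scope.

(** By [link_unique] no other element of the atom is a vertex, so the simplices avoiding [v] have
    residue zero. Listing [v] last in [B] makes the residue free of signs. *)
Lemma Res_volume_link v (D : {set {set T}}) : v \in val a ->
  (exists2 B, B \in D & v \in B) -> triangulation N D ->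
  Res a (volume (reorient_chi P chi) D (OSe R M))
  = volume (reorient_chi P_a (contract_chi P chi v)) (link v D) (OSe R M').
Proof.
move=> va [B0 B0D vB0] tD; have tT := triangulation_triang ON tD.
rewrite /volume (morphB_sum (@ResB _ _ _ mat ll ct R)) (bigID (fun B : {set T} => v \in B)) /=.
rewrite [X in _ + X]big1 ?addr0 => [|B /andP[BD vB]]; last first.
  rewrite (Res_sact mat ll ct) (Res_seq0 mat ll ct) ?sact0 // => x; rewrite mem_enum => xB.
  have [BE _ _] := t_base tT BD; rewrite inE (subsetP BE) // andbT; apply/negP=> xa.
  by move: vB; rewrite -(link_unique tD va xa B0D BD vB0 xB) xB.
rewrite /link big_imset /=; last first.
  move=> B B'; rewrite !inE => /andP[_ vB] /andP[_ vB'] e.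
  by rewrite -(setD1K vB) e setD1K.
apply: eq_big => [B|B /andP[BD vB]]; first by rewrite inE.
have [BE iB _] := t_base tT BD; rewrite indep_reorient in iB.
have sE : {subset enum (B :\ v) <= ground M'} := subset_enum (link_sub va iB vB).
have pv : perm_eq (enum B) (rcons (enum (B :\ v)) v).
  by rewrite perm_sym perm_rcons perm_sym perm_enumD1.
rewrite (sact_perm (o_alt ON) _ pv); last first.
  by move=> s1 x y s2; rewrite /OSe (ext_seq_alt mat ll) (morphBN (@OSpiB _ _ _)).
rewrite (Res_sact mat ll ct) (Res_seq mat ll ct) //.
congr sact; exact: (reorient_chi_contract chi Psupp va).
Qed.

Lemma Res_volume_unused (D : {set {set T}}) : triangulation N D ->
  (forall v B, v \in val a -> B \in D -> v \notin B) ->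
  Res a (volume (reorient_chi P chi) D (OSe R M)) = 0.
Proof.
move=> tD unused; have tT := triangulation_triang ON tD.
rewrite /volume (morphB_sum (@ResB _ _ _ mat ll ct R)) big1 // => B BD.
rewrite (Res_sact mat ll ct) (Res_seq0 mat ll ct) ?sact0 // => x; rewrite mem_enum => xB.
have [BE _ _] := t_base tT BD; rewrite inE (subsetP BE) // andbT; apply/negP=> xa.
by have := unused x B xa BD; rewrite xB.
Qed.

Lemma contract_os_like : os_like (ground M') r.-1 (indep M') (OSe R M').
Proof.
apply: OSe_os_like; [exact: contract_matroid mat ll ct | exact: contract_loopless mat ll ct |].
exact: rank_contract.
Qed.

Lemma volume_link_indep v (D D' : {set {set T}}) : v \in val a ->
  triangulation N' D -> triangulation N' D' ->
  volume (reorient_chi P_a (contract_chi P chi v)) D (OSe R M')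
  = volume (reorient_chi P_a (contract_chi P chi v)) D' (OSe R M').
Proof.
move=> va tD tD'; have O' := oriented_link_reorient va.
apply: volume_indep O' _ (triangulation_triang O' tD) (triangulation_triang O' tD').
by rewrite indep_reorient; apply: contract_os_like.
Qed.

Lemma Res_volume_nonfacet (D : {set {set T}}) : triangulation N D -> ~ facet M P (val a) ->
  Res a (volume (reorient_chi P chi) D (OSe R M)) = 0.
Proof.
move=> tD nf.
have [/existsP[v /andP[va /existsP[B /andP[BD vB]]]]|none] :=
  boolP [exists v, (v \in val a) && [exists B : {set T}, (B \in D) && (v \in B)]]; last first.
  apply: Res_volume_unused => // v B va BD; apply: contra none => vB.
  by apply/existsP; exists v; rewrite va; apply/existsP; exists B; rewrite BD.
have exB : exists2 B, B \in D & v \in B by exists B.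
have O' := oriented_link_reorient va; have [p pE pH] := nonfacet_common va nf.
rewrite (Res_volume_link va) //.
have := triangulation_triang O' (link_triangulation va exB tD).
rewrite indep_reorient in O' * => tL.
exact: (volume_eq0 O' contract_os_like tL pE pH).
Qed.

End Residues.
End Link.

(** * The canonical form *)

Theorem theorem2p11 (T : finType) (R : comPzRingType) (M : om T) (r : nat)
    (chi : seq T -> sign) (P : signvec T) :
  oriented_matroid M -> loopless M -> rank M (ground M) = r ->
  chirotope M chi -> tope M P ->
  [/\ forall Delta Delta' : {set {set T}},
        triangulation (reorient P M) Delta ->
        triangulation (reorient P M) Delta' ->
        Omega R M P chi Delta = Omega R M P chi Delta',
      r = 0%N -> forall Delta : {set {set T}},
        triangulation (reorient P M) Delta ->
        Omega R M P chi Delta = sact (chi [::]) (OS1 R M)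
    & (0 < r)%N -> forall (Delta : {set {set T}}) (a : atom M),
        triangulation (reorient P M) Delta ->
        let P_a := svrestr P (ground M :\: val a) in
        (facet M P (val a) -> forall i : T, i \in val a ->
           (exists Delta' : {set {set T}},
              triangulation (reorient P_a (contract M (val a))) Delta') /\
           (forall Delta' : {set {set T}},
              triangulation (reorient P_a (contract M (val a))) Delta' ->
              Res a (Omega R M P chi Delta)
              = Omega R (contract M (val a)) P_a (contract_chi P chi i) Delta')) /\
        (~ facet M P (val a) ->
           Res a (Omega R M P chi Delta) = 0%R)].
Proof.
move=> omM ll rE chiM tP; subst r.
have O := chirotope_oriented omM chiM.
have cE := circuits_sub omM; have mat := o_mat O.
have Psupp := tope_support O cE ll tP.
have Porth C : C \in circuits M -> Defs.orthogonal C P.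
  by apply: covector_orth; case: tP.
have ON := oriented_reorient_om P O.
have base D B : triangulation (reorient P M) D -> B \in D ->
    [/\ B \subset ground M, indep M B & #|B| = rank M (ground M)].
  by move=> /(triangulation_triang ON) tD /(t_base tD); rewrite indep_reorient.
have OmegaE D : triangulation (reorient P M) D ->
    Omega R M P chi D = volume (reorient_chi P (normalize M chi)) D (OSe R M).
  move=> tD; apply: eq_volume => B /(base D B tD)[BE iB cB].
  by rewrite /reorient_chi normalizeE ?size_enum //; apply: subset_enum.
have vol_indep D D' : triangulation (reorient P M) D -> triangulation (reorient P M) D' ->
    Omega R M P chi D = Omega R M P chi D'.
  move=> tD tD'; rewrite !OmegaE //.
  apply: volume_indep ON _ (triangulation_triang ON tD) (triangulation_triang ON tD').
  by rewrite indep_reorient; apply: OSe_os_like.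
split=> // [r0 D tD|r0 D a tD P_a].
  have eD : D = [set set0].
    have [/set0Pn[B BD] _ _ _] := tD.
    have e0 C : C \in D -> C = set0 by move=> /(base D C tD)[_ _]; rewrite r0 => /cards0_eq.
    apply/setP=> C; rewrite in_set1; apply/idP/eqP=> [/e0//|->].
    by rewrite -(e0 B BD).
  rewrite /Omega eD big_set1 enum_set0 /reorient_chi.
  by rewrite (_ : [set i in [::]] = set0) ?set0I ?cards0.
split=> [fa i ia|nf]; last by rewrite OmegaE //; apply: (Res_volume_nonfacet omM ll O).
(* The link of the vertex [v] in the atom provides the triangulation. This [v] may differ from the
   given [i], and [chi_parallel] passes from one to the other. *)
have [v [va exB]] := facet_used omM ll O Psupp fa tD.
have tL := link_triangulation omM ll O Psupp Porth va exB tD.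
split=> [|D' tD']; first by exists (link v D).
have sub L B : triangulation (reorient P_a (contract M (val a))) L -> B \in L ->
    B \subset ground (contract M (val a)) /\ #|B|.+1 = rank M (ground M).
  have O' := oriented_link_reorient omM ll O Psupp ia.
  move=> /(triangulation_triang O') t /(t_base t)[BE _ ->]; split=> //.
  by rewrite prednK.
rewrite OmegaE // (Res_volume_link omM ll O Psupp Porth R va exB tD).
have -> : volume (reorient_chi P_a (contract_chi P (normalize M chi) v)) (link v D)
      (OSe R (contract M (val a)))
    = volume (reorient_chi P_a (contract_chi P (normalize M chi) i)) (link v D)
      (OSe R (contract M (val a))).
  apply: eq_volume => B /(sub _ _ tL)[BE _]; rewrite /reorient_chi /contract_chi.
  by rewrite (chi_parallel omM ll O Psupp Porth va ia) //; apply: subset_enum.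
rewrite (volume_link_indep omM ll O Psupp R ia tL tD').
apply/esym/eq_volume => B /(sub _ _ tD')[BE cB].
rewrite /reorient_chi /contract_chi normalizeE //; first by rewrite size_rcons size_enum.
move=> x; rewrite mem_rcons inE mem_enum => /predU1P[->|/(subsetP BE)/(subsetP (@ground_sub _ _ _))//].
exact: subsetP (atom_sub a) _ ia.
Qed.
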